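(* Let $n\ge 3$ and let $a,b$ be real numbers with $a<n$, $b<n$. Let $\mathbf X$ be an i.i.d. sample of size $n$ from the bivariate normal distribution with parameters $(\mu_1,\mu_2,\sigma_1,\sigma_2,\rho)$, use the prior $\pi_{ab}$, and let $\theta_2=\sigma_2^2(1-\rho^2)$. (a) The posterior distribution of $\theta_2$ given $\mathbf X$ is the distribution (with the data held fixed) of $\theta_2^*=s_{22}(1-r^2)/\chi^{2*}_{n-b}$. (b) For every $\alpha\in(0,1)$, $\boldsymbol\xi=(\mu_1,\mu_2,\sigma_1,\sigma_2)$ and $\rho\in(-1,1)$, $$P(\theta_2<(\theta_2^* )_{1-\alpha}\mid\boldsymbol\xi,\rho)=P\left(\chi^2_{n-2}>(\chi^{2*}_{n-b})_{\alpha}\right),$$ which does not depend on $\rho$. Furthermore, this quantity equals $1-\alpha$ if and only if $b=2$.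
   Context: Model: $\mathbf x_k=(x_{1k},x_{2k})'$, $k=1,\dots,n$, are i.i.d. bivariate normal with mean $(\mu_1,\mu_2)'\in\mathbb R^2$ and covariance matrix $\boldsymbol\Sigma=\begin{pmatrix}\sigma_1^2&\rho\sigma_1\sigma_2\\ \rho\sigma_1\sigma_2&\sigma_2^2\end{pmatrix}$, $\sigma_1,\sigma_2>0$, $|\rho|<1$. Statistics: $\overline x_i=n^{-1}\sum_k x_{ik}$, $s_{ij}=\sum_k(x_{ik}-\overline x_i)(x_{jk}-\overline x_j)$, $r=s_{12}/\sqrt{s_{11}s_{22}}$ (with $|r|<1$ almost surely). Prior: $\pi_{ab}$ is the (improper) density, with respect to $d\mu_1\,d\mu_2\,d\sigma_1\,d\sigma_2\,d\rho$, $$\pi_{ab}(\mu_1,\mu_2,\sigma_1,\sigma_2,\rho)=\frac{1}{\sigma_1^{3-a}\sigma_2^{2-b}(1-\rho^2)^{2-b/2}},$$ and the posterior given $\mathbf X$ is the normalized product of likelihood and prior (proper when $a<n$, $b<n$). Random variables: $\chi^2_m$ and $\chi^{2*}_m$ denote chi-squared random variables with $m$ (real, positive) degrees of freedom, i.e. Gamma with shape $m/2$ and rate $1/2$. Quantiles: $(W)_{\beta}$ denotes the $\beta$ quantile of $W$ with respect to the distribution of the starred variables only, all non-starred quantities (in particular the data) being held fixed; so $(\theta_2^* )_{1-\alpha}$ is a function of $\mathbf X$, the posterior $1-\alpha$ quantile of $\theta_2$. Frequentist coverage: $P(\cdot\mid\boldsymbol\xi,\rho)$ is probability under the sampling distribution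 of $\mathbf X$ with the parameters fixed. *)

(* Defs.v *)
From HB Require Import structures.
From mathcomp Require Import all_boot all_order all_algebra.
From mathcomp Require Import all_classical all_reals all_analysis.

Set Implicit Arguments.
Unset Strict Implicit.
Unset Printing Implicit Defensive.

Import Order.TTheory GRing.Theory Num.Theory.
Import numFieldNormedType.Exports.

Local Open Scope classical_set_scope.
Local Open Scope ring_scope.

Section distributions.
Context {R : realType}.
Local Notation leb := (@lebesgue_measure R).

Definition gamma_function (s : R) : R :=
  \int[leb]_(t in `]0, +oo[) (t `^ (s - 1) * expR (- t)).

Definition gamma_pdf (shape rate x : R) : R :=
  rate `^ shape / gamma_function shape * x `^ (shape - 1) * expR (- (rate * x)).

Definition gamma_law (shape rate : R) (A : set R) : \bar R :=
  (\int[leb]_(x in A `&` `]0%R, +oo[) (gamma_pdf shape rate x)%:E)%E.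

Definition chi2 (m : R) : set R -> \bar R := gamma_law (m / 2) (1 / 2).

Definition quantile (nu : set R -> \bar R) (beta : R) : R :=
  inf [set t | (beta%:E <= nu `]-oo, t]%classic)%E].

Definition mvn_pdf (d : nat) (mu : 'rV[R]_d) (Sigma : 'M[R]_d) (x : 'rV[R]_d) : R :=
  expR (- (((x - mu) *m invmx Sigma *m (x - mu)^T) 0 0 / 2))
    / Num.sqrt ((2 * pi) ^+ d * \det Sigma).

Definition mutually_independent d (T : measurableType d) (P : probability T R)
    d' (T' : measurableType d') (n : nat) (X : 'I_n -> {RV P >-> T'}) : Prop :=
  forall A : 'I_n -> set T', (forall k, measurable (A k)) ->
    P (\bigcap_(k in [set: 'I_n]) X k @^-1` A k) =
    (\prod_(k < n) P (X k @^-1` A k))%E.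

End distributions.

Section model.
Context {R : realType}.
Local Notation leb := (@lebesgue_measure R).
(* A parameter is p = (mu1, mu2, sigma1, sigma2, rho). *)
Local Notation params := (R * R * R * R * R)%type.

Definition mu1 (p : params) : R := p.1.1.1.1.
Definition mu2 (p : params) : R := p.1.1.1.2.
Definition sigma1 (p : params) : R := p.1.1.2.
Definition sigma2 (p : params) : R := p.1.2.
Definition rho (p : params) : R := p.2.

Definition param_space : set params :=
  [set p | [/\ 0 < sigma1 p, 0 < sigma2 p & -1 < rho p < 1]].

Definition theta2 (p : params) : R := sigma2 p ^+ 2 * (1 - rho p ^+ 2).

Definition row2 (y : R * R) : 'rV[R]_2 :=
  \row_(i < 2) if i == 0 then y.1 else y.2.

Definition covmx (p : params) : 'M[R]_2 :=
  \matrix_(i < 2, j < 2)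
    if i == j then (if i == 0 then sigma1 p ^+ 2 else sigma2 p ^+ 2)
    else rho p * sigma1 p * sigma2 p.

Definition binormal_pdf (p : params) (y : R * R) : R :=
  mvn_pdf (row2 (mu1 p, mu2 p)) (covmx p) (row2 y).

Definition binormal_law (p : params) (A : set (R * R)) : \bar R :=
  (\int[leb \x leb]_(y in A) (binormal_pdf p y)%:E)%E.

Definition iid_binormal (p : params) d (T : measurableType d)
    (P : probability T R) (n : nat) (X : 'I_n -> {RV P >-> (R * R)%type}) : Prop :=
  mutually_independent X /\
  forall k A, measurable A -> distribution P (X k) A = binormal_law p A.

Section statistics.
Variables (n : nat) (x : 'I_n -> R * R).

Definition smean (u : 'I_n -> R) : R := n%:R^-1 * \sum_k u k.

Definition scross (u v : 'I_n -> R) : R :=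
  \sum_k (u k - smean u) * (v k - smean v).

Definition x1 (k : 'I_n) : R := (x k).1.
Definition x2 (k : 'I_n) : R := (x k).2.
Definition s11 : R := scross x1 x1.
Definition s12 : R := scross x1 x2.
Definition s22 : R := scross x2 x2.
Definition corr : R := s12 / Num.sqrt (s11 * s22).

(* The positivity of s11 and s22 says that corr is a genuine quotient. *)
Definition nondegenerate_data : Prop := [/\ 0 < s11, 0 < s22 & `|corr| < 1].

Definition likelihood (p : params) : R := \prod_k binormal_pdf p (x k).

Variables (a b : R).

Definition prior (p : params) : R :=
  (sigma1 p `^ (3 - a) * sigma2 p `^ (2 - b)
    * (1 - rho p ^+ 2) `^ (2 - b / 2))^-1.

Definition unnormalized_posterior (A : set params) : \bar R :=
  (\int[leb \x leb \x leb \x leb \x leb]_(p in A `&` param_space)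
     (likelihood p * prior p)%:E)%E.

(* By the conventions for division on the extended reals, this is identically 0
   when the normalizing constant is 0 or +oo; hence it is a probability measure
   only if the posterior is proper. *)
Definition posterior (A : set params) : \bar R :=
  (unnormalized_posterior A / unnormalized_posterior setT)%E.

(* The law of s22 (1 - r ^ 2) / chi2_(n - b), the data being held fixed. *)
Definition theta2_star : set R -> \bar R :=
  pushforward (chi2 (n%:R - b)) (fun c : R => s22 * (1 - corr ^+ 2) / c).

End statistics.

End model.

(* Main.v *)
(* (a) In the coordinates theta = sigma2 ^ 2 (1 - rho ^ 2) and
   t = rho / sqrt (1 - rho ^ 2), integrating mu1 and mu2 out of the posterior
   density leaves a function of sigma1, theta and t that is Gaussian in t.
   Integrating t out gives a multiple of sigma1, so that what remains is the
   product of a function of sigma1 and of theta ^ (-(n - b) / 2 - 1) *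
   exp (- s22 (1 - r ^ 2) / (2 theta)), the inverse gamma density of theta2_star.

   (b) s22 (1 - r ^ 2) / theta2 is the residual sum of squares in the regression
   of the standardised errors e_k on the x_1k and a constant.  When one more
   observation arrives, two plane rotations, with angles that depend only on the
   x_1k, turn the new error into a standard normal variable independent of the
   past residual, whose square is added to it.  By induction the residual is
   chi-squared with n - 2 degrees of freedom and independent of the x_1k.  Since
   the posterior quantile of theta2 is s22 (1 - r ^ 2) divided by the alpha
   quantile of chi2 (n - b), the coverage is that of a chi2 (n - 2) variable.
   For fixed rate, gamma densities of different shapes have a strictly monotone
   ratio, so their tails differ at every positive point; this forces n - 2 = n - b. *)
Require Import Defs.
From HB Require Import structures.
From mathcomp Require Import all_boot all_order all_algebra.
From mathcomp Require Import all_classical all_reals all_analysis.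
From mathcomp Require Import measurable_realfun.
From mathcomp Require Import ring lra.

Set Implicit Arguments.
Unset Strict Implicit.
Unset Printing Implicit Defensive.

Import Order.TTheory GRing.Theory Num.Theory.
Import numFieldNormedType.Exports.

Local Open Scope classical_set_scope.
Local Open Scope ring_scope.

(** Laws are handled through integrals of arbitrary nonnegative measurable functions: independence
    is an equality of iterated integrals, which Tonelli's theorem and one-dimensional substitutions
    can rearrange. Random angles are then harmless, since they are constants once the x_1k are fixed
    by the outer integrals. The obstacle is the start of the induction. With a single observation
    the centred sum of squares of the x_1k is 0 and the next rotation has cosine 0, so the claim
    starts at two observations, where the residual is 0 and its law is the point mass that stands
    for chi-squared with 0 degrees of freedom. The later angles are well defined only almost surely,
    where that sum of squares is positive. Normalising constants are avoided where possible. The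
    square of a normal variable and the sum of two gamma variables are treated up to a factor, which
    integrating the function 1 shows to be 1. The posterior is likewise computed up to one positive
    finite factor, the same for all events, which cancels in the quotient; that the factor is
    positive and finite is the properness of the posterior. *)

Section measurability.
Context d (T : measurableType d) (R : realType).
Implicit Types f g : T -> R.

Lemma measurableV f : measurable_fun setT f -> measurable_fun setT (fun x => (f x)^-1).
Proof.
move=> mf.
(* Inversion is reduced to [powR], whose measurability is known. The identity also holds where [f]
   vanishes, because the inverse of 0 is 0. *)
have -> : (fun x => (f x)^-1) = (fun x => f x * ((f x) ^+ 2) `^ (-1)).
  apply/funext => x; rewrite powR_inv1 ?sqr_ge0//.
  have [->|fx] := eqVneq (f x) 0; first by rewrite invr0 mul0r.
  by rewrite expr2 invfM mulrA mulfV// mul1r.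
apply: measurable_funM => //.
exact: (measurableT_comp (@measurable_powR R (-1)) (measurable_funX 2 mf)).
Qed.

Lemma measurable_expR_comp f : measurable_fun setT f -> measurable_fun setT (fun x => expR (f x)).
Proof. by move=> mf; exact: (measurableT_comp (@measurable_expR R) mf). Qed.

Lemma measurable_powR_comp f p : measurable_fun setT f -> measurable_fun setT (fun x => f x `^ p).
Proof. by move=> mf; exact: (measurableT_comp (@measurable_powR R p) mf). Qed.

Lemma measurable_sqrt_comp f : measurable_fun setT f ->
  measurable_fun setT (fun x => Num.sqrt (f x)).
Proof.
move=> mf; apply: (measurableT_comp _ mf).
by apply: continuous_measurable_fun; exact: sqrt_continuous.
Qed.

Lemma measurable_lt_set f g : measurable_fun setT f -> measurable_fun setT g ->
  measurable [set x | f x < g x].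
Proof.
move=> mf mg; have := measurable_fun_ltr mf mg.
by move=> /(_ measurableT [set true] I); rewrite setTI.
Qed.

Lemma measurable_comp_fst d1 d2 (T1 : measurableType d1) (T2 : measurableType d2)
  (f : T -> T1 * T2) : measurable_fun setT f -> measurable_fun setT (fun x => (f x).1).
Proof. by move=> mf; exact: (measurableT_comp measurable_fst mf). Qed.

Lemma measurable_comp_snd d1 d2 (T1 : measurableType d1) (T2 : measurableType d2)
  (f : T -> T1 * T2) : measurable_fun setT f -> measurable_fun setT (fun x => (f x).2).
Proof. by move=> mf; exact: (measurableT_comp measurable_snd mf). Qed.

End measurability.

(* The dispatch on the head symbol avoids the costly failed unifications of the
   exhaustive fallback. *)
Ltac mfun_step :=
  first
  [ match goal with H : measurable_fun _ ?f |- measurable_fun _ ?f => exact H end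
  | lazymatch goal with
    | |- measurable_fun _ (fun _ => ?c) => exact: measurable_cst
    | |- measurable_fun _ (fun x => x) => exact: measurable_id
    | |- measurable_fun _ (fun _ => GRing.add _ _) => apply: measurable_funD
    | |- measurable_fun _ (fun _ => GRing.opp _) => apply: measurable_funN
    | |- measurable_fun _ (fun _ => GRing.exp _ _) => apply: measurable_funX
    | |- measurable_fun _ (fun _ => GRing.mul _ _) => apply: measurable_funM
    | |- measurable_fun _ (fun _ => GRing.inv _) => apply: measurableV
    | |- measurable_fun _ (fun _ => expR _) => apply: measurable_expR_comp
    | |- measurable_fun _ (fun _ => powR _ _) => apply: measurable_powR_comp
    | |- measurable_fun _ (fun _ => Num.sqrt _) => apply: measurable_sqrt_comp
    | |- measurable_fun _ (fun _ => fst _) => apply: measurable_comp_fst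
    | |- measurable_fun _ (fun _ => snd _) => apply: measurable_comp_snd
    | |- measurable_fun _ (fun _ => pair _ _) => apply: measurable_fun_pair
    end
  | exact: measurable_cst | exact: measurable_id | assumption
  | apply: measurable_funN | apply: measurable_fun_pair | apply: measurable_funD
  | apply: measurable_funB | apply: measurable_funX | apply: measurable_funM
  | apply: measurableV | apply: measurable_expR_comp | apply: measurable_powR_comp
  | apply: measurable_sqrt_comp | apply: measurable_comp_fst | apply: measurable_comp_snd ].
Ltac mfun := repeat mfun_step.

(** * Measures given by a density *)

Section density.
Local Open Scope ereal_scope.
Context d (T : measurableType d) (R : realType) (mu : {measure set T -> \bar R}).
Variable f : T -> R.
Hypotheses (mf : measurable_fun setT f) (f0 : forall x, (0 <= f x)%R).

Let nu (A : set T) : \bar R := \int[mu]_(x in A) (f x)%:E.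
Let nu0 : nu set0 = 0. Proof. exact: integral_set0. Qed.
Let nu_ge0 A : 0 <= nu A. Proof. by apply: integral_ge0 => x _; rewrite lee_fin. Qed.
Let nu_sigma_additive : semi_sigma_additive nu.
Proof.
move=> F mF tF mUF; rewrite /nu ge0_integral_bigcup//; last 2 first.
- by apply/measurable_EFinP; exact: measurable_funS mf.
- by move=> x _; rewrite lee_fin.
by apply: is_cvg_ereal_nneg_natsum_cond => n _ _; exact: nu_ge0.
Qed.

#[local] HB.instance Definition _ := isMeasure.Build _ _ _ nu nu0 nu_ge0 nu_sigma_additive.

Lemma density_measure : exists m : {measure set T -> \bar R},
  forall A, m A = \int[mu]_(x in A) (f x)%:E.
Proof. by exists nu. Qed.

Import HBNNSimple.

(** Agreement of [m] with the density is asked only on measurable sets, so that the lemma applies to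
    measures built elsewhere, such as [normal_prob] or the distribution of a random variable. Both
    sides agree on simple functions by linearity, and monotone convergence does the rest. *)
Lemma integral_density (m : {measure set T -> \bar R}) :
  (forall A, measurable A -> m A = \int[mu]_(x in A) (f x)%:E) ->
  forall g, measurable_fun setT g -> (forall x, 0 <= g x) ->
  \int[m]_x g x = \int[mu]_x (g x * (f x)%:E).
Proof.
move=> mE g mg g0.
pose g_ := nnsfun_approx measurableT mg.
have mEf : measurable_fun setT (EFin \o f) by exact/measurable_EFinP.
transitivity (limn (fun n => \int[m]_x (g_ n x)%:E)).
  rewrite -monotone_convergence//.
  - by apply: eq_integral => x _; apply/esym/cvg_lim => //; exact: cvg_nnsfun_approx.
  - by move=> n; exact/measurable_EFinP/measurable_funP.
  - by move=> n x _; rewrite lee_fin.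
  - by move=> x _ a b ab; rewrite lee_fin; exact/lefP/nd_nnsfun_approx.
transitivity (limn (fun n => \int[mu]_x ((g_ n x)%:E * (f x)%:E))); last first.
  rewrite -monotone_convergence//.
  - apply: eq_integral => x _; apply/cvg_lim => //; apply: cvgeZr => //.
    exact: cvg_nnsfun_approx.
  - by move=> n; apply: emeasurable_funM => //; exact/measurable_EFinP/measurable_funP.
  - by move=> n x _; rewrite mule_ge0// lee_fin.
  - by move=> x _ a b ab; rewrite lee_wpmul2r ?lee_fin//; exact/lefP/nd_nnsfun_approx.
congr (limn _); apply/funext => n.
transitivity (\sum_(k \in range (g_ n)) \int[m]_x (k * \1_(g_ n @^-1` [set k]) x)%:E).
  under eq_integral do rewrite fimfunE -fsumEFin//.
  rewrite ge0_integral_fsum// => [r|r x _]; last by rewrite nnfun_muleindic_ge0.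
  exact/measurable_EFinP/measurable_funM.
transitivity (\sum_(k \in range (g_ n)) \int[mu]_x (k * \1_(g_ n @^-1` [set k]) x * f x)%:E).
  apply: eq_fsbigr => r _.
  have mr : measurable (g_ n @^-1` [set r]) by rewrite -[X in measurable X]setTI; exact: measurable_funP.
  rewrite integralZl_indic_nnsfun// integral_indic// setIT mE//.
  (* A negative value is not attained by a nonnegative simple function, so both terms are 0; the
     other case can use linearity for nonnegative scalars. *)
  have [r0|r0] := ltP r 0%R.
    rewrite preimage_nnfun0// integral_set0 mule0 integral0_eq// => x _.
    by rewrite indic0 mulr0 mul0r.
  rewrite -ge0_integralZl_EFin//; first last.
  - exact: measurable_funS mEf.
  - by move=> x _; rewrite lee_fin.
  rewrite integral_mkcond; apply: eq_integral => x _.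
  rewrite patchE indicE; case: ifPn => h; first by rewrite mulr1.
  by rewrite mulr0 mul0r.
rewrite -ge0_integral_fsum//.
- apply: eq_integral => x _; rewrite [in RHS]fimfunE -EFinM mulr_fsuml fsumEFin//.
- move=> r; apply/measurable_EFinP; apply: measurable_funM => //; exact: measurable_funM.
- by move=> r x _; rewrite EFinM mule_ge0 ?lee_fin// -lee_fin nnfun_muleindic_ge0.
Qed.

End density.

(** * One-dimensional change of variables *)

Section substitution.
Context {R : realType}.
Local Notation leb := (@lebesgue_measure R).
Local Open Scope ereal_scope.

Lemma integral_indicM d (T : measurableType d) (mu : {measure set T -> \bar R})
  (D : set T) (f : T -> \bar R) : 
  \int[mu]_(x in D) f x = \int[mu]_x (f x * (\1_D x)%:E).
Proof.
rewrite integral_mkcond; apply: eq_integral => x _; rewrite patchE indicE.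
by case: ifPn => _; rewrite ?mule1 ?mule0.
Qed.

Variables (psi dpsi psiV : R -> R) (J : set R).
Hypotheses (dpsiE : forall t, is_derive t (1%R : R) psi (dpsi t))
  (cdpsi : continuous dpsi) (dpsi0 : forall t, (0 < dpsi t)%R)
  (mJ : measurable J) (mpsiV : measurable_fun setT psiV)
  (Jpsi : forall t, J (psi t)) (psiK : forall t, psiV (psi t) = t)
  (psiVK : forall x, J x -> psi (psiV x) = x).

Let cpsi : continuous psi.
Proof.
move=> x; apply: differentiable_continuous; apply/derivable1_diffP.
by have [] := dpsiE x.
Qed.

Let mpsi : measurable_fun setT psi.
Proof. exact: continuous_measurable_fun. Qed.

Let mdpsi : measurable_fun setT dpsi.
Proof. exact: continuous_measurable_fun. Qed.

Let ndpsi x y : (x <= y)%R -> (psi x <= psi y)%R.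
Proof.
rewrite le_eqVlt => /predU1P[->//|xy].
have h : forall z, z \in `]x, y[%R -> is_derive z (1%R:R) psi (dpsi z) by [].
have [z _] := MVT xy h (continuous_subspaceT cpsi).
by move=> e; rewrite -subr_ge0 e mulr_ge0 ?(ltW (dpsi0 _))// subr_ge0 ltW.
Qed.

Let lepsi x y : (psi x <= psi y)%R = (x <= y)%R.
Proof.
apply/idP/idP; last exact: ndpsi.
move=> h; rewrite leNgt; apply/negP => yx.
have e : psi x = psi y by apply/eqP; rewrite eq_le h ndpsi// ltW.
by move: (psiK x); rewrite e psiK => yx'; move: yx; rewrite yx' ltxx.
Qed.

Let ltpsi x y : (psi x < psi y)%R = (x < y)%R.
Proof. by rewrite !ltNge lepsi. Qed.

Let FTC a b : (a <= b)%R -> \int[leb]_(t in `]a, b]) (dpsi t)%:E = (psi b - psi a)%:E.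
Proof.
rewrite le_eqVlt => /predU1P[->|ab].
  by rewrite set_itv_ge ?bnd_simp ?ltxx// integral_set0 subrr.
rewrite integral_itv_obnd_cbnd; last by apply/measurable_EFinP; exact: measurable_funS mdpsi.
rewrite (continuous_FTC2 (F := psi) ab)//.
- exact: continuous_subspaceT.
- split.
  + by move=> x _; have [] := dpsiE x.
  + exact/cvg_at_right_filter/cpsi.
  + exact/cvg_at_left_filter/cpsi.
- by move=> x _; rewrite derive1E; have [_] := dpsiE x.
Qed.

(** Lebesgue measure on [J], transported to the line by [psiV], has density [dpsi]: by the
    fundamental theorem of calculus both measures give []a, b]] the mass [psi b - psi a], and
    half-open intervals form a generating class stable under intersection. *)
Lemma substitution (f : R -> \bar R) : measurable_fun setT f -> (forall x, 0 <= f x) ->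
  \int[leb]_(x in J) f x = \int[leb]_t (f (psi t) * (dpsi t)%:E).
Proof.
move=> mf f0.
have [m1 m1E] := density_measure leb mdpsi (fun t => ltW (dpsi0 t)).
have [m2 m2E] := density_measure leb (@measurable_indic _ _ R setT J mJ) (fun t => ler0n _ _).
have mfpsi : measurable_fun setT (f \o psi) by exact: measurableT_comp.
have e1 : \int[m1]_t (f \o psi) t = \int[leb]_t (f (psi t) * (dpsi t)%:E).
  by apply: (integral_density (T := measurableTypeR R) mdpsi) => [t|A _|//|t]; [exact: ltW|exact: m1E|exact: f0].
rewrite -e1.
have mpsiV' : @measurable_fun _ _ (measurableTypeR R) (measurableTypeR R) setT psiV by exact: mpsiV.
pose psiVm := HB.pack_for {mfun measurableTypeR R >-> measurableTypeR R} psiV (isMeasurableFun.Build _ _ _ _ _ mpsiV').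
have m12 A : measurable A -> m1 A = (pushforward m2 psiVm) A.
  move=> mA; apply: (@measure_unique _ R (measurableTypeR R) (@ocitv R) (fun k => `](- k%:R)%R, k%:R]%classic) _ _ _ _ m1 (pushforward m2 psiVm)) => //.
  - exact: ocitvI.
  - by move=> k; exact: is_ocitv.
  - apply/seteqP; split=> // x _ /=.
    exists (Num.bound x) => //=.
    by rewrite in_itv/= ltrNl unstable.ltrNbound ltW ?unstable.ltr_bound.
  - move=> _ [[a b]] _ <-; rewrite m1E/= /pushforward m2E/=.
    have mA' : measurable (psiV @^-1` `]a, b]) by rewrite -[X in measurable X]setTI; apply: (mpsiV' measurableT).
    rewrite integral_indic//.
    (* Monotonicity gives one inclusion; the intermediate value theorem supplies the preimages
       needed for the other. *)
    have -> : J `&` psiV @^-1` `]a, b] = `](psi a), (psi b)]%classic.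
      apply/seteqP; split => x /=; rewrite !in_itv/=.
        by move=> [/psiVK Jx]; rewrite -ltpsi -lepsi Jx.
      move=> /andP[ax xb].
      have [y _ yx] : exists2 y, y \in `[a, b] & psi y = x.
        apply: IVT; first by rewrite -lepsi ltW// (lt_le_trans ax).
          exact: continuous_subspaceT.
        by rewrite ge_min le_max (ltW ax) xb orbT.
      split; first by rewrite -yx; exact: Jpsi.
      rewrite -yx psiK; apply/andP; split; first by rewrite -ltpsi yx.
      by rewrite -lepsi yx.
    rewrite [RHS]lebesgue_measure_itv/= lte_fin ltpsi -EFinB.
    case: ltP => ab; first by rewrite FTC// ltW.
    by rewrite set_itv_ge ?bnd_simp -?leNgt// integral_set0.
  - move=> k; have e : (- k%:R <= k%:R :> R)%R by rewrite (@le_trans _ _ 0%R) ?oppr_le0.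
    by have := ltry (psi k%:R - psi (- k%:R))%R; rewrite -(FTC e) -m1E.
transitivity (\int[pushforward m2 psiVm]_t (f \o psi) t); last first.
  by apply: eq_measure_integral => A mA _; rewrite m12.
rewrite ge0_integral_pushforward//= preimage_setT.
have e2 := integral_density (T := measurableTypeR R) (@measurable_indic _ _ R setT J mJ)
  (fun t => ler0n _ _) (fun A _ => m2E A) (measurableT_comp mfpsi mpsiV) (fun x => f0 _).
rewrite e2 -integral_indicM; apply: eq_integral => x /[!inE] Jx /=.
by rewrite psiVK.
Qed.
End substitution.

Lemma gt0_powRD (R : realType) (x r s : R) : 0 < x -> x `^ (r + s) = x `^ r * x `^ s.
Proof. by move=> x0; rewrite powRD// (gt_eqF x0) implybT. Qed.

Section substitution_instances.
Context {R : realType}.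
Local Notation leb := (@lebesgue_measure R).
Local Open Scope ereal_scope.
Implicit Types f : R -> \bar R.

Lemma integral_affine (a b : R) f : (0 < a)%R ->
  measurable_fun setT f -> (forall x, 0 <= f x) ->
  \int[leb]_x f x = \int[leb]_t (f (a * t + b)%R * a%:E).
Proof.
move=> a0 mf f0.
apply: (@substitution R (fun t => a * t + b)%R (fun=> a) (fun x => (x - b) / a)%R setT) => //.
- by move=> t; apply: trigger_derive; rewrite /GRing.scale/=; ring.
- by move=> t; exact: cvg_cst.
- by mfun.
- by move=> t; rewrite addrK mulrC mulKf// gt_eqF.
- by move=> x _; rewrite mulrCA mulfV ?gt_eqF// mulr1 subrK.
Qed.

Lemma integral_reflection f : measurable_fun setT f -> (forall x, 0 <= f x) ->
  \int[leb]_x f x = \int[leb]_t f (- t)%R.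
Proof.
move=> mf f0.
transitivity (\int[pushforward leb (-%R : measurableTypeR R -> measurableTypeR R)]_x f x).
  by apply: eq_measure_integral => A mA _; rewrite -[LHS]lebesgue_measureN.
by rewrite ge0_integral_pushforward// preimage_setT.
Qed.

Lemma integral_exp f : measurable_fun setT f -> (forall x, 0 <= f x) ->
  \int[leb]_(x in `]0%R, +oo[) f x = \int[leb]_t (f (expR t) * (expR t)%:E).
Proof.
move=> mf f0.
apply: (@substitution R expR expR (@ln R) `]0%R, +oo[%classic) => //.
- exact: continuous_expR.
- by move=> t; exact: expR_gt0.
- by move=> t; rewrite /= in_itv/= andbT expR_gt0.
- exact: expRK.
- by move=> x /=; rewrite in_itv/= andbT => x0; exact: lnK.
Qed.

Lemma integral_affine0 (a b : R) f : (a != 0)%R ->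
  measurable_fun setT f -> (forall x, 0 <= f x) ->
  \int[leb]_x f x = \int[leb]_t (f (a * t + b)%R * `|a|%:E).
Proof.
move=> a0 mf f0; have [a_gt0|a_le0] := ltP 0%R a.
  by rewrite (@integral_affine a b)// gtr0_norm.
have a_lt0 : (a < 0)%R by rewrite lt_neqAle a0.
rewrite (@integral_affine (- a) b)// ?oppr_gt0// integral_reflection.
- by apply: eq_integral => t _; rewrite ltr0_norm// mulrNN.
- apply: emeasurable_funM => //; apply: (measurableT_comp mf); mfun.
- by move=> x; rewrite mule_ge0// lee_fin oppr_ge0.
Qed.

Lemma integral_pow (K p : R) f : (0 < K)%R -> (p != 0)%R ->
  measurable_fun setT f -> (forall x, 0 <= f x) ->
  \int[leb]_(x in `]0%R, +oo[) f x =
  \int[leb]_(x in `]0%R, +oo[) (f (K * x `^ p)%R * (`|p| * K * x `^ (p - 1))%:E).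
Proof.
move=> K0 p0 mf f0.
have mexp : measurable_fun setT (@expR R) := @measurable_expR R.
rewrite integral_exp// (@integral_affine0 p (ln K)) //; first last.
- by move=> x; rewrite mule_ge0// lee_fin expR_ge0.
- apply: emeasurable_funM; last exact/measurable_EFinP.
  exact: (measurableT_comp mf).
rewrite integral_exp; first last.
- by move=> x; rewrite mule_ge0// lee_fin !mulr_ge0 ?powR_ge0// ltW.
- apply: emeasurable_funM; last by apply/measurable_EFinP; mfun.
  by apply: (measurableT_comp mf); mfun.
apply: eq_integral => t _.
have e : expR (p * t + ln K) = (K * expR t `^ p)%R.
  by rewrite expRD (lnK K0) /powR gt_eqF ?expR_gt0// expRK mulrC.
rewrite e -!muleA -!EFinM; congr (_ * _%:E).
have h : (expR t != 0)%R by rewrite gt_eqF ?expR_gt0.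
have -> : (expR t `^ (p - 1) = expR t `^ p / expR t)%R.
  by rewrite powRB ?h ?implybT// powRr1 ?expR_ge0.
by field.
Qed.

(** The substitution is t / sqrt (1 + t^2), with inverse x / sqrt (1 - x^2). It carries a
    correlation to a real variable. *)
Lemma integral_sqrt1D f : measurable_fun setT f -> (forall x, 0 <= f x) ->
  \int[leb]_(x in `](-1)%R, 1%R[) f x =
  \int[leb]_t (f (t * (1 + t ^+ 2) `^ (- 2^-1))%R * ((1 + t ^+ 2) `^ (- (3 / 2)))%:E).
Proof.
move=> mf f0.
have h0 (t : R) : (0 < 1 + t ^+ 2)%R by rewrite ltr_wpDr ?sqr_ge0.
have h1 (x : R) : x \in `](-1)%R, 1%R[ -> (0 < 1 - x ^+ 2)%R.
  by rewrite in_itv/= => /andP[? ?]; nra.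
have hp (x : R) : (0 < x -> (x `^ (- 2^-1)) ^+ 2 = x^-1)%R.
  by move=> x0; rewrite -powR_mulrn ?powR_ge0// -powRrM mulNr mulVf// powR_inv1// ltW.
have hv (t : R) : (1 - (t * (1 + t ^+ 2) `^ (- 2^-1)) ^+ 2 = (1 + t ^+ 2)^-1)%R.
  by rewrite exprMn hp//; field; rewrite gt_eqF.
apply: (@substitution R (fun t => t * (1 + t ^+ 2) `^ (- 2^-1))%R _
   (fun x => x * (1 - x ^+ 2) `^ (- 2^-1))%R) => //.
- move=> t.
  have hd : is_derive t (1 : R)%R (fun t : R => (1 + t ^+ 2) `^ (- 2^-1))%R
      ((- 2^-1 * (1 + t ^+ 2) `^ (- 2^-1 - 1)) * (2 * t))%R.
    apply: (@is_derive1_comp _ (fun x => x `^ (- 2^-1))%R (fun t => 1 + t ^+ 2)%R).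
      exact: is_derive1_powR.
    by apply: trigger_derive; rewrite /GRing.scale/=; ring.
  apply: (trigger_derive (is_deriveM (is_derive_id t 1%R) hd)).
  (* Both terms of the product rule are brought to the power -3/2, where their coefficients 1 + t^2
     and - t^2 add up to 1. *)
  have e : ((1 + t ^+ 2) `^ (- 2^-1) = (1 + t ^+ 2) * (1 + t ^+ 2) `^ (- (3 / 2)))%R.
    rewrite -{2}[(1 + t ^+ 2)%R]powRr1 ?(ltW (h0 _))// -gt0_powRD//.
    by congr (_ `^ _)%R; field.
  have -> : (- 2^-1 - 1 = - (3 / 2) :> R)%R by field.
  by rewrite e /GRing.scale/=; field.
- have cpsi : continuous (fun t : R => 1 + t ^+ 2)%R.
    move=> t; apply: cvgD; first exact: cvg_cst.
    exact: exprn_continuous.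
  move=> t.
  rewrite (_ : (fun t : R => _) = (fun t => expR (- (3 / 2) * ln (1 + t ^+ 2)))%R).
    apply: continuous_comp; last exact: continuous_expR.
    apply: continuousM; first exact: cvg_cst.
    apply: continuous_comp; first exact: cpsi.
    exact: continuous_ln.
  by apply/funext => x; rewrite /powR gt_eqF.
- by move=> t; rewrite powR_gt0.
- by mfun.
- move=> t; have := hv t; have : (0 < (1 + t ^+ 2)^-1)%R by rewrite invr_gt0.
  move=> /[swap] <-; rewrite set_itvE/= => h.
  by apply/andP; split; nra.
- move=> t; rewrite hv -mulrA -powRM ?invr_ge0 ?(ltW (h0 _))//.
  by rewrite mulfV ?gt_eqF// powR1 mulr1.
- move=> x /h1 x1.
  have -> : (1 + (x * (1 - x ^+ 2) `^ (- 2^-1)) ^+ 2 = (1 - x ^+ 2)^-1)%R.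
    by rewrite exprMn hp//; field; rewrite gt_eqF.
  by rewrite -mulrA -powRM ?invr_ge0 ?(ltW x1)// mulfV ?gt_eqF// powR1 mulr1.
Qed.

End substitution_instances.

Section probability_of_measure.
Context d (T : measurableType d) (R : realType) (m : {measure set T -> \bar R}).
Hypothesis m1 : m setT = 1%E.
Let pm : set T -> \bar R := m.
#[local] HB.instance Definition _ := Measure.on pm.
#[local] HB.instance Definition _ := Measure_isProbability.Build _ _ _ pm m1.

Lemma probability_of_measure : exists P : probability T R, forall A, P A = m A.
Proof. by exists pm. Qed.

End probability_of_measure.

(** * The gamma function and the gamma distribution *)

Section gamma_distribution.
Context {R : realType}.
Local Notation leb := (@lebesgue_measure R).
Local Open Scope ereal_scope.

(** A zero integral would make [f] vanish almost everywhere on [D], which then would lie in a null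
    set. *)
Lemma integral_gt0 d (T : measurableType d) (mu : {measure set T -> \bar R})
  (D : set T) (f : T -> \bar R) : measurable D -> 0 < mu D ->
  measurable_fun D f -> (forall x, D x -> 0 < f x) -> 0 < \int[mu]_(x in D) f x.
Proof.
move=> mD D0 mf f0; rewrite lt_def integral_ge0 ?andbT => [|x Dx]; last exact/ltW/f0.
apply/negP => /eqP e.
have /(ae_eq_integral_abs mu mD mf) h : \int[mu]_(x in D) `|f x| = 0.
  by rewrite -[RHS]e; apply: eq_integral => x /[!inE] Dx; rewrite gee0_abs// ltW// f0.
case: h => N [mN N0 sub].
suff : mu D <= mu N by rewrite N0 leNgt D0.
apply: le_measure; rewrite ?inE// => x Dx; apply: sub => /= /(_ Dx) fx.
by move: (f0 x Dx); rewrite fx ltxx.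
Qed.

(** The constant is the maximum of x^(s + 1) e^(- x), attained at x = s + 1; it comes from ln y <= y
    - 1 at y = x / (s + 1). The power -2 is integrable at infinity. *)
Lemma powR_expR_bound (s x : R) : (0 < s)%R -> (0 < x)%R ->
  (x `^ (s - 1) * expR (- x) <= expR ((s + 1) * (ln (s + 1) - 1)) * x `^ (- 2))%R.
Proof.
move=> s0 x0; rewrite /powR gt_eqF// -!expRD ler_expR.
have k0 : (0 < s + 1)%R by rewrite addr_gt0.
have h : (ln (x / (s + 1)) <= x / (s + 1) - 1)%R.
  have := @le_ln1Dx R (x / (s + 1) - 1); rewrite (_ : 1 + (_ - 1) = x / (s + 1))%R; last by ring.
  by apply; rewrite ltrBrDr addNr divr_gt0.
rewrite ln_div ?posrE// in h.
have : ((s + 1) * (ln x - ln (s + 1)) <= x - (s + 1))%R.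
  have -> : (x - (s + 1) = (s + 1) * (x / (s + 1) - 1))%R by field; rewrite gt_eqF.
  by rewrite ler_pM2l.
lra.
Qed.

Lemma measurable_gamma_kernel (s r : R) (D : set R) :
  measurable_fun D (fun x : R => (x `^ (s - 1) * expR (- (r * x)))%:E).
Proof. by apply: (measurable_funS measurableT) => //; apply/measurable_EFinP; mfun. Qed.

Lemma gamma_integral_lty (s : R) : (0 < s)%R ->
  \int[leb]_(x in `]0%R, +oo[) (x `^ (s - 1) * expR (- x))%:E < +oo.
Proof.
move=> s0.
pose C := expR ((s + 1) * (ln (s + 1) - 1)).
(* The two dominating functions, x^(s - 1) on ]0, 1] and x^(-2) beyond 1, are the transforms of this
   one indicator under x^s and x^(-1), up to the factor s in the first case. Their integrals follow
   from that of [g], which is 1. *)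
pose g (x : R) := (\1_(`]0%R, 1%R] : set R) x)%:E : \bar R.
have mg : measurable_fun setT g by apply/measurable_EFinP; exact: measurable_indic.
have g0 x : 0 <= g x by rewrite lee_fin.
have gint : \int[leb]_(x in `]0%R, +oo[) g x = 1.
  rewrite integral_indic//= setIidl; last first.
    by move=> x /=; rewrite !in_itv/= => /andP[-> _].
  by rewrite lebesgue_measure_itv/= lte01 sube0.
have h1 := @integral_pow R 1 s g ltr01 (lt0r_neq0 s0) mg g0.
have m10 : ((-1 : R) != 0)%R by rewrite oppr_eq0 oner_neq0.
have h2 := @integral_pow R 1 (-1) g ltr01 m10 mg g0.
rewrite gint in h1 h2.
have m1 : measurable_fun setT (fun x : R => g (1 * x `^ s)%R * (`|s| * 1 * x `^ (s - 1))%:E).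
  apply: emeasurable_funM; last by apply/measurable_EFinP; mfun.
  by apply: (measurableT_comp mg); mfun.
have m2 : measurable_fun setT (fun x : R => g (1 * x `^ (-1))%R * (`|(-1 : R)| * 1 * x `^ (-1 - 1))%:E).
  apply: emeasurable_funM; last by apply/measurable_EFinP; mfun.
  by apply: (measurableT_comp mg); mfun.
have p1 x : 0 <= g (1 * x `^ s)%R * (`|s| * 1 * x `^ (s - 1))%:E.
  by rewrite mule_ge0// lee_fin mulr1 mulr_ge0// powR_ge0.
have p2 x : 0 <= g (1 * x `^ (-1))%R * (`|(-1 : R)| * 1 * x `^ (-1 - 1))%:E.
  by rewrite mule_ge0// lee_fin mulr1 mulr_ge0// powR_ge0.
have C0 : (0 <= C)%R by exact: expR_ge0.
apply: (@le_lt_trans _ _ (\int[leb]_(x in `]0%R, +oo[)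
   (s^-1%:E * (g (1 * x `^ s)%R * (`|s| * 1 * x `^ (s - 1))%:E) +
    C%:E * (g (1 * x `^ (-1))%R * (`|(-1 : R)| * 1 * x `^ (-1 - 1))%:E)))); last first.
  rewrite ge0_integralD//=.
  - rewrite !ge0_integralZl_EFin//=; try exact: measurable_funS m1; try exact: measurable_funS m2.
      by rewrite -h1 -h2 !mule1 -EFinD ltry.
    by rewrite invr_ge0 ltW.
  - by move=> x _; rewrite mule_ge0// lee_fin invr_ge0 ltW.
  - by apply: measurable_funeM; exact: measurable_funS m1.
  - by move=> x _; rewrite mule_ge0// lee_fin.
  - by apply: measurable_funeM; exact: measurable_funS m2.
apply: ge0_le_integral => //=.
- by move=> x _; rewrite lee_fin mulr_ge0 ?powR_ge0 ?expR_ge0.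
- have := @measurable_gamma_kernel s 1 `]0%R, +oo[%classic.
  by under [X in measurable_fun _ X]eq_fun do rewrite mul1r.
- by apply: emeasurable_funD; apply: measurable_funeM; [exact: measurable_funS m1|exact: measurable_funS m2].
move=> /= x'; set x : R := x'; rewrite in_itv/= andbT => x0.
have [x1|x1] := leP x 1%R.
  rewrite -[leLHS]adde0; apply: leeD; last by apply: mule_ge0; [rewrite lee_fin|exact: p2].
  rewrite /g indicE mem_set/=; last first.
    rewrite /= in_itv/= mul1r powR_gt0//=.
    by have := @ge0_ler_powR R s (ltW s0) x 1%R; rewrite !nnegrE powR1; apply => //; exact: ltW.
  rewrite -!EFinM lee_fin mul1r mulr1 gtr0_norm// mulKf ?gt_eqF//.
  by rewrite ler_piMr ?powR_ge0// -expR0 ler_expR oppr_le0 ltW.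
rewrite -[leLHS]add0e; apply: leeD.
  by apply: mule_ge0; [rewrite lee_fin invr_ge0 ltW|exact: p1].
rewrite /g indicE mem_set/=; last first.
  by rewrite /= in_itv/= mul1r powR_gt0//= powR_inv1 ?(ltW x0)// invf_le1// ltW.
rewrite -!EFinM lee_fin mul1r mulr1 normrN normr1 mul1r.
have -> : (-1 - 1 = -2 :> R)%R by ring.
exact: powR_expR_bound.
Qed.

(** [gamma_function] is a real-valued integral, for which an infinite value would collapse to 0;
    finiteness identifies it with the extended integral. *)
Lemma gamma_function_integral (s : R) : (0 < s)%R ->
  \int[leb]_(x in `]0%R, +oo[) (x `^ (s - 1) * expR (- x))%:E = (gamma_function s)%:E.
Proof.
move=> s0; rewrite /gamma_function /Rintegral fineK//.
rewrite ge0_fin_numE; first exact: gamma_integral_lty.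
by apply: integral_ge0 => x _; rewrite lee_fin mulr_ge0 ?powR_ge0 ?expR_ge0.
Qed.

Lemma gamma_function_gt0 (s : R) : (0 < s)%R -> (0 < gamma_function s)%R.
Proof.
move=> s0; rewrite -lte_fin -gamma_function_integral//.
apply: integral_gt0 => //.
- by rewrite [X in _ < X]lebesgue_measure_itv/= ltry; exact: ltry.
- have := @measurable_gamma_kernel s 1 `]0%R, +oo[%classic.
  by under [X in measurable_fun _ X]eq_fun do rewrite mul1r.
- move=> x; rewrite /= in_itv/= andbT => x0.
  by rewrite lte_fin mulr_gt0 ?powR_gt0 ?expR_gt0.
Qed.

Lemma integral_gamma_kernel (s r : R) : (0 < s)%R -> (0 < r)%R ->
  \int[leb]_(x in `]0%R, +oo[) (x `^ (s - 1) * expR (- (r * x)))%:E =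
  (gamma_function s / r `^ s)%:E.
Proof.
move=> s0 r0.
pose f (y : R) := (y `^ (s - 1) * expR (- y))%:E : \bar R.
have mf : measurable_fun setT f by apply/measurable_EFinP; mfun.
have f0 y : 0 <= f y by rewrite lee_fin mulr_ge0 ?powR_ge0 ?expR_ge0.
rewrite EFinM -gamma_function_integral//.
rewrite (@integral_pow R r 1 f r0 (oner_neq0 _) mf f0).
rewrite -ge0_integralZr//=; first last.
- by rewrite lee_fin invr_ge0 powR_ge0.
- by move=> x _; rewrite mule_ge0// lee_fin !mulr_ge0 ?powR_ge0// ltW.
- apply: (measurable_funS measurableT) => //; apply: emeasurable_funM.
    by apply: (measurableT_comp mf); mfun.
  by apply/measurable_EFinP; mfun.
apply: eq_integral => x; rewrite inE/= in_itv/= andbT => x0.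
rewrite /f -!EFinM; congr (_%:E).
rewrite subrr powRr0 normr1 powRr1 ?(ltW x0)// powRM ?ltW// mul1r mulr1.
have -> : (r `^ s = r * r `^ (s - 1))%R by rewrite mulr_powRB1// ltW.
by field; rewrite !gt_eqF ?powR_gt0.
Qed.

Lemma gamma_pdf_ge0 (s r x : R) : (0 < s)%R -> (0 < r)%R -> (0 <= gamma_pdf s r x)%R.
Proof.
by move=> s0 r0; rewrite !mulr_ge0 ?powR_ge0 ?expR_ge0// invr_ge0 ltW// gamma_function_gt0.
Qed.

Lemma gamma_pdf_gt0 (s r x : R) : (0 < s)%R -> (0 < r)%R -> (0 < x)%R -> (0 < gamma_pdf s r x)%R.
Proof.
by move=> s0 r0 x0; rewrite !mulr_gt0 ?powR_gt0 ?expR_gt0// invr_gt0 gamma_function_gt0.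
Qed.

Lemma measurable_gamma_pdf (s r : R) : measurable_fun setT (gamma_pdf s r).
Proof. by rewrite /gamma_pdf; mfun. Qed.

Lemma gamma_pdfE (s r x : R) : (0 < s)%R -> (0 < r)%R ->
  gamma_pdf s r x = ((gamma_function s / r `^ s)^-1 * (x `^ (s - 1) * expR (- (r * x))))%R.
Proof. by move=> s0 r0; rewrite /gamma_pdf invfM invrK -mulrA; congr (_ * _)%R; rewrite mulrC. Qed.

Lemma gamma_lawT (s r : R) : (0 < s)%R -> (0 < r)%R -> gamma_law s r setT = 1.
Proof.
move=> s0 r0; rewrite /gamma_law setTI.
have h0 : (0 < gamma_function s / r `^ s)%R by rewrite divr_gt0 ?gamma_function_gt0// powR_gt0.
under eq_integral do rewrite gamma_pdfE// EFinM.
rewrite ge0_integralZl_EFin//=.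
- by rewrite integral_gamma_kernel// -EFinM mulVf// gt_eqF.
- by move=> x _; rewrite lee_fin mulr_ge0 ?powR_ge0 ?expR_ge0.
- exact: measurable_gamma_kernel.
- by rewrite invr_ge0 ltW.
Qed.

Lemma gamma_law_density (s r : R) (A : set R) : 
  gamma_law s r A = \int[leb]_(x in A) (gamma_pdf s r x * \1_(`]0%R, +oo[ : set R) x)%:E.
Proof.
rewrite /gamma_law integral_mkcondr; apply: eq_integral => x _.
by rewrite patchE indicE; case: ifPn => _; rewrite ?mulr1 ?mulr0.
Qed.

(** [gamma_law] is a bare set function; this gives access to the theory of probability measures for
    it. *)
Lemma gamma_prob (s r : R) : (0 < s)%R -> (0 < r)%R ->
  exists C : probability (measurableTypeR R) R, forall A, C A = gamma_law s r A.
Proof.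
move=> s0 r0.
have m1 : measurable_fun setT (fun x : R => gamma_pdf s r x * \1_(`]0%R, +oo[ : set R) x)%R.
  by apply: measurable_funM; [exact: measurable_gamma_pdf|exact: measurable_indic].
have f0 (x : R) : (0 <= gamma_pdf s r x * \1_(`]0%R, +oo[ : set R) x)%R.
  by rewrite mulr_ge0// gamma_pdf_ge0.
have [C CE] := density_measure (T := measurableTypeR R) leb m1 f0.
have C1 : C setT = 1 by rewrite CE -gamma_law_density gamma_lawT.
have [P PE] := probability_of_measure C1.
by exists P => A; rewrite PE CE gamma_law_density.
Qed.

Lemma integral_gamma (s r : R) (C : {measure set (measurableTypeR R) -> \bar R}) (f : R -> \bar R) :
  (0 < s)%R -> (0 < r)%R -> (forall A, C A = gamma_law s r A) ->
  measurable_fun setT f -> (forall x, 0 <= f x) ->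
  \int[C]_x f x = \int[leb]_(x in `]0%R, +oo[) (f x * (gamma_pdf s r x)%:E).
Proof.
move=> s0 r0 CE mf f0.
have m1 : measurable_fun setT (fun x : R => gamma_pdf s r x * \1_(`]0%R, +oo[ : set R) x)%R.
  by apply: measurable_funM; [exact: measurable_gamma_pdf|exact: measurable_indic].
rewrite (integral_density (T := measurableTypeR R) (mu := leb) m1)//.
- rewrite [RHS]integral_mkcond; apply: eq_integral => x _.
  by rewrite patchE indicE; case: ifPn => _; rewrite ?mulr1 ?mulr0// mule0.
- by move=> x; rewrite mulr_ge0// gamma_pdf_ge0.
- by move=> A _; rewrite CE gamma_law_density.
Qed.

End gamma_distribution.

(** * Quantiles of gamma laws *)

Section gamma_quantile.
Context {R : realType}.
Local Notation leb := (@lebesgue_measure R).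
Local Open Scope ereal_scope.
Variables (s r : R).
Hypotheses (s0 : (0 < s)%R) (r0 : (0 < r)%R).

Let f (x : R) : R := (gamma_pdf s r x * \1_(`]0%R, +oo[ : set R) x)%R.

Let mf : measurable_fun setT f.
Proof. by apply: measurable_funM; [exact: measurable_gamma_pdf|exact: measurable_indic]. Qed.

Let f0 x : (0 <= f x)%R.
Proof. by rewrite mulr_ge0// gamma_pdf_ge0. Qed.

(** The closed endpoint 0, where the indicator in [f] vanishes, gives the distribution function the
    form of an integral with variable upper limit, whose continuity is known. *)
Let lawE (t : R) : gamma_law s r `]-oo, t] = \int[leb]_(x in `[0%R, t]) (f x)%:E.
Proof.
rewrite gamma_law_density integral_mkcond [RHS]integral_mkcond.
apply: eq_integral => /= x _; rewrite !patchE.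
have [x0|x0] := leP x 0%R.
  have -> : (f x)%:E = 0.
    by rewrite /f indicE memNset ?mulr0//= in_itv/= andbT; apply/negP; rewrite -leNgt.
  by do 2 case: ifP.
rewrite /f; congr (if _ then _ else _).
by apply/idP/idP; rewrite !inE/= !in_itv/= ?(ltW x0)//.
Qed.

Let lawT : gamma_law s r setT = 1. Proof. exact: gamma_lawT. Qed.

Lemma gamma_law_lt (u t : R) : (u < t)%R -> (0 < t)%R ->
  gamma_law s r `]-oo, u] < gamma_law s r `]-oo, t].
Proof.
move=> ut t0; have [C CE] := gamma_prob s0 r0.
have e : `]-oo, t]%classic = `]-oo, u] `|` `]u, t] :> set R.
  apply/seteqP; split => x /=; rewrite !in_itv/=.
    by case: (leP x u) => xu xt; [left|right].
  by case=> [xu|/andP[]//]; rewrite (le_trans xu)// ltW.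
rewrite -!CE e measureU//=; last first.
  apply/seteqP; split => x //=; rewrite !in_itv/= => -[xu /andP[ux _]].
  by move: (le_lt_trans xu ux); rewrite ltxx.
rewrite lteDl ?fin_num_measure// CE.
(* The density is positive only on the positive half-line, so the gain in mass is read off on the
   part of []u, t]] that lies there. *)
apply: (@lt_le_trans _ _ (gamma_law s r `](Num.max 0 u)%R, t])); last first.
  rewrite -!CE; apply: le_measure; rewrite ?inE//= => x /=.
  by rewrite !in_itv/= gt_max => /andP[/andP[_ ->] ->].
have mt : (Num.max 0 u < t)%R by rewrite gt_max t0.
rewrite /gamma_law setIidl; last first.
  by move=> x /=; rewrite !in_itv/= gt_max => /andP[/andP[-> _] _].
apply: integral_gt0 => //.
- by rewrite [X in _ < X]lebesgue_measure_itv/= lte_fin mt -EFinB lte_fin subr_gt0.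
- by apply/measurable_EFinP; apply: measurable_funS (@measurable_gamma_pdf R s r).
- move=> x; rewrite /= in_itv/= gt_max => /andP[/andP[x0 _] _].
  by rewrite lte_fin gamma_pdf_gt0.
Qed.

Lemma gamma_law_le (u t : R) : (u <= t)%R ->
  gamma_law s r `]-oo, u] <= gamma_law s r `]-oo, t].
Proof.
move=> ut; have [C CE] := gamma_prob s0 r0.
rewrite -!CE; apply: le_measure; rewrite ?inE//= => x /=.
by rewrite !in_itv/= => /le_trans; apply.
Qed.

Lemma gamma_law_gtC (t : R) :
  gamma_law s r `]t, +oo[ = 1 - gamma_law s r `]-oo, t].
Proof.
have [C CE] := gamma_prob s0 r0.
by rewrite -!CE -setCitvl probability_setC.
Qed.

(** The distribution function is 0 at 0 and, by continuity from below, reaches at least [alpha]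
    somewhere; the intermediate value theorem gives [q], which is not 0 because [alpha] is
    positive. *)
Let law_surj (alpha : R) : (0 < alpha < 1)%R ->
  exists2 q, (0 < q)%R & gamma_law s r `]-oo, q] = alpha%:E.
Proof.
move=> /andP[a0 a1]; have [C CE] := gamma_prob s0 r0.
have [b [b0 hb]] : exists b, (0 <= b)%R /\ alpha%:E <= gamma_law s r `]-oo, b].
  apply: contrapT => /forallNP h.
  have cvgC : (C \o (fun n => `]-oo, n%:R]%classic)) x @[x --> \oo] --> C (\bigcup_n `]-oo, n%:R]%classic).
    apply: nondecreasing_cvg_mu => //; first exact: bigcup_measurable.
    move=> n m nm; apply/subsetPset => x /=; rewrite !in_itv/= => /le_trans; apply.
    by rewrite ler_nat.
  have UT : \bigcup_n `]-oo, n%:R]%classic = [set: R].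
    apply/seteqP; split => // x _; exists (Num.bound x) => //=.
    by rewrite in_itv/= ltW// unstable.ltr_bound.
  rewrite UT probability_setT in cvgC.
  suff : 1 <= alpha%:E by rewrite lee_fin leNgt a1.
  rewrite -(cvg_lim _ cvgC)//; apply: lime_le; first by apply/cvg_ex; exists 1.
  near=> n; rewrite /= CE leNgt; apply/negP => hn.
  by apply: (h n%:R); split; [exact: ler0n|exact: ltW].
have intf : leb.-integrable `[0%R, b] (EFin \o f).
  apply/integrableP; split; first by apply/measurable_EFinP; exact: measurable_funS mf.
  under eq_integral do rewrite /= ger0_norm//.
  by rewrite -lawE -CE (le_lt_trans (probability_le1 _ _)) ?ltry.
pose G (x : R) := (\int[leb]_(t in `[0%R, x]) f t)%R.
have lawG x : gamma_law s r `]-oo, x] = (G x)%:E.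
  rewrite lawE /G /Rintegral fineK// -lawE -CE fin_num_measure//.
have G0 : G 0%R = 0%R by rewrite /G set_itv1 Rintegral_set1.
have [q] : exists2 q, q \in `[0%R, b] & G q = alpha.
  apply: IVT => //; first exact: parameterized_integral_continuous.
  rewrite G0 ge_min ltW//= le_max; apply/orP; right.
  by rewrite -lee_fin -lawG.
rewrite in_itv/= => /andP[q0 _] Gq.
exists q; last by rewrite lawG Gq.
rewrite lt_def q0 andbT; apply/negP => /eqP qE.
by move: a0; rewrite -Gq qE G0 ltxx.
Unshelve. all: by end_near. Qed.

Lemma gamma_quantile (alpha : R) : (0 < alpha < 1)%R ->
  let q := quantile (gamma_law s r) alpha in
  [/\ (0 < q)%R, gamma_law s r `]-oo, q] = alpha%:E &
      forall t, (gamma_law s r `]-oo, t] <= alpha%:E) = (t <= q)%R].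
Proof.
move=> ha; have [p p0 pE] := law_surj ha.
have h t : (gamma_law s r `]-oo, t] <= alpha%:E) = (t <= p)%R.
  apply/idP/idP => [|tp]; last by rewrite -pE gamma_law_le.
  apply: contraTT; rewrite -!ltNge => pt.
  by rewrite -pE gamma_law_lt// (lt_trans p0).
have qp : quantile (gamma_law s r) alpha = p.
  rewrite /quantile; have -> : [set t | alpha%:E <= gamma_law s r `]-oo, t]] = `[p, +oo[%classic.
    apply/seteqP; split => t /=; rewrite in_itv/= andbT.
      move=> at_; rewrite leNgt; apply/negP => tp.
      by move: (gamma_law_lt tp p0); rewrite pE ltNge at_.
    by move=> pt; rewrite -pE gamma_law_le.
  by rewrite inf_itv.
by rewrite /= qp; split.
Qed.

(** The map c -> S / c is decreasing on the positive half-line, so it exchanges the upper and lower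
    quantiles. The case [S = 0] is included so that the formula holds for every sample, even a
    degenerate one. *)
Lemma quantile_div (S alpha : R) : (0 <= S)%R -> (0 < alpha < 1)%R ->
  quantile (pushforward (gamma_law s r) (fun c => S / c)%R) (1 - alpha) =
  (S / quantile (gamma_law s r) alpha)%R.
Proof.
move=> S0 ha; have [q0 qE qP] := gamma_quantile ha.
set q := quantile (gamma_law s r) alpha in q0 qE qP *.
have a1 : (0 < 1 - alpha)%R by case/andP: ha => _; rewrite subr_gt0.
have [C CE] := gamma_prob s0 r0.
have mS (t : R) : measurable ((fun c : R => S / c)%R @^-1` `]-oo, t]).
  have mdiv : measurable_fun setT (fun c : R => S / c)%R by mfun.
  by rewrite -[X in measurable X]setTI; exact: mdiv.
rewrite [LHS]/quantile.
suff -> : [set t | (1 - alpha)%:E <= pushforward (gamma_law s r) (fun c => S / c)%R `]-oo, t]] =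
    `[(S / q)%R, +oo[%classic by rewrite inf_itv.
apply/seteqP; split => t; rewrite /= in_itv/= andbT /pushforward; last first.
  move=> Sqt; rewrite EFinB -qE -gamma_law_gtC -!CE; apply: le_measure; rewrite ?inE//.
    exact: mS.
  move=> c; rewrite /= !in_itv/= andbT => qc; apply: le_trans Sqt.
  by rewrite ler_wpM2l// lef_pV2 ?posrE ?(lt_trans q0 qc)// ltW.
move=> h; rewrite leNgt; apply/negP => tS.
(* Below [S / q] the event S / c <= t forces c beyond some [p] strictly above [q], and its mass
   falls strictly below 1 - alpha. For t > 0 the midpoint of [q] and [S / t] serves as [p]; for t <=
   0 the event contains no positive c. *)
have [p qp hp] : exists2 p, (q < p)%R & forall c : R, (0 < c)%R -> (S / c <= t)%R -> (p < c)%R.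
  have [t0|t0] := ltP 0%R t.
    have St : (q < S / t)%R by rewrite ltr_pdivlMr// mulrC -ltr_pdivlMr.
    exists ((q + S / t) / 2)%R; first by lra.
    move=> c c0 ct; have : (S / t <= c)%R by rewrite ler_pdivrMr// mulrC -ler_pdivrMr.
    lra.
  exists (q + 1)%R; first by rewrite ltrDl.
  move=> c c0 ct.
  have Sc : (0 <= S / c)%R by rewrite divr_ge0// ltW.
  have /eqP : (S / c == 0)%R by rewrite eq_le Sc (le_trans ct t0).
  move=> Sc0; have te : t = 0%R by apply/eqP; rewrite eq_le t0 -Sc0 ct.
  move/eqP : Sc0; rewrite mulf_eq0 invr_eq0 (gt_eqF c0) orbF => /eqP SE.
  by move: tS; rewrite SE te mul0r ltxx.
have : (1 - alpha)%:E <= gamma_law s r `]p, +oo[.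
  apply: (le_trans h); rewrite /gamma_law; apply: ge0_subset_integral => //=.
  - by apply: measurableI => //; exact: mS.
  - exact: measurableI.
  - by apply/measurable_EFinP; apply: measurable_funS (@measurable_gamma_pdf R s r).
  - by move=> x _; rewrite lee_fin gamma_pdf_ge0.
  - move=> c [] /=; rewrite !in_itv/= andbT => ct; rewrite andbT => c0; split => //.
    by rewrite hp.
rewrite gamma_law_gtC leNgt => /negP; apply.
have lp : alpha%:E < gamma_law s r `]-oo, p] by rewrite ltNge qP -ltNge.
have fp : gamma_law s r `]-oo, p] \is a fin_num by rewrite -CE fin_num_measure.
move: lp; rewrite -(fineK fp) lte_fin -EFinB lte_fin => lp.
by rewrite ltrD2l ltrN2.
Qed.

End gamma_quantile.

(** * Strict dependence of gamma tails on the shape *)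

Section gamma_monotone_shape.
Context {R : realType}.
Local Notation leb := (@lebesgue_measure R).
Local Open Scope ereal_scope.

(* The densities have the increasing ratio [k * x `^ (s' - s)], which is below
   its value at [q] on ]0, q[ and above it on ]q, +oo[. *)
Lemma gamma_law_gt_shape (s s' r q : R) : (0 < s)%R -> (s < s')%R -> (0 < r)%R -> (0 < q)%R ->
  gamma_law s r `]q, +oo[ < gamma_law s' r `]q, +oo[.
Proof.
move=> s0 ss' r0 q0; have s'0 : (0 < s')%R by exact: lt_trans ss'.
have d0 : (0 < s' - s)%R by rewrite subr_gt0.
pose k := ((gamma_function s' / r `^ s')^-1 * (gamma_function s / r `^ s))%R.
have g0 (u : R) : (0 < u)%R -> (0 < gamma_function u / r `^ u)%R.
  by move=> u0; rewrite divr_gt0 ?gamma_function_gt0 ?powR_gt0.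
have k0 : (0 < k)%R by rewrite mulr_gt0 ?invr_gt0 ?g0.
have ratio (x : R) : (0 < x)%R -> gamma_pdf s' r x = (k * x `^ (s' - s) * gamma_pdf s r x)%R.
  move=> x0; rewrite !gamma_pdfE// /k.
  have -> : (s' - 1 = (s' - s) + (s - 1))%R by ring.
  by rewrite gt0_powRD//; field; rewrite !gt_eqF ?g0 ?gamma_function_gt0 ?powR_gt0.
have mono (x y : R) : (0 < x)%R -> (x <= y)%R -> (x `^ (s' - s) <= y `^ (s' - s))%R.
  move=> x0 xy; apply: ge0_ler_powR; rewrite ?nnegrE ?(ltW d0)//; first exact: ltW.
  by rewrite (le_trans _ xy)// ltW.
have [C CE] := gamma_prob s0 r0; have [C' CE'] := gamma_prob s'0 r0.
set K := (k * q `^ (s' - s))%R.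
have K0 : (0 < K)%R by rewrite mulr_gt0 ?powR_gt0.
have mg (u : R) D : measurable_fun D (fun x => (gamma_pdf u r x)%:E).
  by apply: (measurable_funS measurableT) => //; apply/measurable_EFinP; exact: measurable_gamma_pdf.
have tail : K%:E * gamma_law s r `]q, +oo[ <= gamma_law s' r `]q, +oo[.
  rewrite /gamma_law setIidl; last first.
    by move=> x /=; rewrite !in_itv/= !andbT; exact: lt_trans.
  rewrite -ge0_integralZl_EFin//=; first last.
  - exact: ltW.
  - exact: mg.
  - by move=> x _; rewrite lee_fin gamma_pdf_ge0.
  apply: ge0_le_integral => //=.
  - by move=> x _; rewrite mule_ge0// lee_fin ?gamma_pdf_ge0// ltW.
  - by apply: measurable_funeM; exact: mg.
  - exact: mg.
  - move=> x; rewrite /= in_itv/= andbT => qx.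
    rewrite -EFinM lee_fin ratio ?(lt_trans q0)// ler_wpM2r ?gamma_pdf_ge0//.
    by rewrite ler_wpM2l ?(ltW k0)// mono// ltW.
have headI (u : R) : gamma_law u r `]-oo, q] = \int[leb]_(x in `]0%R, q]) (gamma_pdf u r x)%:E.
  rewrite /gamma_law; congr (integral _ _ _); apply/seteqP; split => x /=; rewrite !in_itv/= andbT.
    by move=> [-> ->].
  by move=> /andP[-> ->].
have head : gamma_law s' r `]-oo, q] < K%:E * gamma_law s r `]-oo, q].
  rewrite !headI -ge0_integralZl_EFin//=; first last.
  - exact: ltW.
  - exact: mg.
  - by move=> x _; rewrite lee_fin gamma_pdf_ge0.
  pose D (x : R) := ((K - k * x `^ (s' - s)) * gamma_pdf s r x)%R.
  have D0 (x : R) : x \in `]0%R, q] -> (0 <= D x)%R.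
    rewrite in_itv/= => /andP[x0 xq]; rewrite mulr_ge0 ?gamma_pdf_ge0// subr_ge0.
    by rewrite ler_wpM2l ?(ltW k0)// mono.
  have mD : measurable_fun setT D.
    by apply: measurable_funM; [rewrite /K; mfun|exact: measurable_gamma_pdf].
  have mDE E : measurable_fun E (fun x => (D x)%:E).
    by apply: (measurable_funS measurableT) => //; exact/measurable_EFinP.
  have -> : \int[leb]_(x in `]0%R, q]) (K%:E * (gamma_pdf s r x)%:E) =
      \int[leb]_(x in `]0%R, q]) ((gamma_pdf s' r x)%:E + (D x)%:E).
    apply: eq_integral => x; rewrite inE/= in_itv/= => /andP[x0 xq].
    by rewrite -EFinM -EFinD ratio// /D; congr (_%:E); ring.
  rewrite ge0_integralD//=; first last.
  - exact: mDE.
  - exact: mg.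
  - by move=> x _; rewrite lee_fin gamma_pdf_ge0.
  rewrite -(headI s') lteDl; last by rewrite -CE' fin_num_measure.
  apply: (@lt_le_trans _ _ (\int[leb]_(x in `]0%R, q[) (D x)%:E)); last first.
    apply: ge0_subset_integral => //=; first exact: mDE.
    by move=> x /=; rewrite !in_itv/= => /andP[-> /ltW ->].
  apply: integral_gt0 => //; last 1 first.
  - move=> x; rewrite /= in_itv/= => /andP[x0 xq].
    rewrite lte_fin mulr_gt0 ?gamma_pdf_gt0// subr_gt0 ltr_pM2l//.
    by apply: gt0_ltr_powR; rewrite ?nnegrE ?ltW.
  - by rewrite [X in _ < X]lebesgue_measure_itv/= lte_fin q0 -EFinB lte_fin subr_gt0.
  - exact: mDE.
have tail0 : 0 < gamma_law s r `]q, +oo[.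
  rewrite /gamma_law setIidl; last first.
    by move=> x /=; rewrite !in_itv/= !andbT; exact: lt_trans.
  apply: integral_gt0 => //; first by rewrite [X in _ < X]lebesgue_measure_itv/= ltry; exact: ltry.
    exact: mg.
  by move=> x; rewrite /= in_itv/= andbT => qx; rewrite lte_fin gamma_pdf_gt0// (lt_trans q0).
move: tail head tail0; rewrite !gamma_law_gtC// -!CE -!CE'.
have fC : C `]-oo, q]%classic \is a fin_num by rewrite fin_num_measure.
have fC' : C' `]-oo, q]%classic \is a fin_num by rewrite fin_num_measure.
rewrite -(fineK fC) -(fineK fC') -!EFinB -!EFinM !lte_fin !lee_fin.
set L := fine _; set L' := fine _; move=> h1 h2 h3.
have L0 : (0 <= L)%R by rewrite fine_ge0.
(* If the tail did not grow, [h1] would force K <= 1; then [h2] gives L' < K L <= L, which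
   contradicts [h4]. *)
rewrite ltNge; apply/negP => h4.
have K1 : (K <= 1)%R by rewrite -(ler_pM2r h3) mul1r (le_trans h1).
by nra.
Qed.

End gamma_monotone_shape.

Lemma chi2_gt_quantile_eq (R : realType) (m m' alpha : R) : 0 < m -> 0 < m' -> 0 < alpha < 1 ->
  chi2 m `]quantile (chi2 m') alpha, +oo[%classic = (1 - alpha)%:E <-> m = m'.
Proof.
move=> m0 m'0 ha.
have h2 : (0 : R) < 1 / 2 by rewrite divr_gt0.
have p0 : 0 < m / 2 by rewrite divr_gt0.
have p'0 : 0 < m' / 2 by rewrite divr_gt0.
have [q0 qE _] := gamma_quantile p'0 h2 ha.
rewrite /chi2; set q := quantile _ _ in q0 qE *.
have e : gamma_law (m' / 2) (1 / 2) `]q, +oo[ = (1 - alpha)%:E by rewrite gamma_law_gtC// qE.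
split=> [|->//]; rewrite -e.
case: (ltgtP m m') => // mm' /eqP.
  by rewrite lt_eqF// gamma_law_gt_shape// ltr_pM2r.
by rewrite gt_eqF// gamma_law_gt_shape// ltr_pM2r.
Qed.

Lemma integral_probability_cst d (T : measurableType d) (R : realType)
  (P : probability T R) (c : \bar R) : (\int[P]_x c)%E = c.
Proof.
rewrite integral_cst// -[RHS]mule1; congr (_ * _)%E.
exact: probability_setT.
Qed.

(** * Curried forms of joint measurability and of Tonelli's theorem *)

Section measurable_binary.
Context d d1 d2 d3 (T : measurableType d) (T1 : measurableType d1)
  (T2 : measurableType d2) (T3 : measurableType d3).
Variable F : T1 -> T2 -> T3.
Hypothesis mF : measurable_fun setT (fun p : T1 * T2 => F p.1 p.2).

Lemma measurable_fun2 (f : T -> T1) (g : T -> T2) :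
  measurable_fun setT f -> measurable_fun setT g ->
  measurable_fun setT (fun t => F (f t) (g t)).
Proof. by move=> mf mg; exact: (measurableT_comp mF (measurable_fun_pair mf mg)). Qed.

End measurable_binary.

Section tonelli.
Context d1 d2 (T1 : measurableType d1) (T2 : measurableType d2) (R : realType).
Variables (m1 : {sigma_finite_measure set T1 -> \bar R})
  (m2 : {sigma_finite_measure set T2 -> \bar R}).
Local Open Scope ereal_scope.
Variable f : T1 -> T2 -> \bar R.
Hypotheses (mf : measurable_fun setT (fun p : T1 * T2 => f p.1 p.2))
  (f0 : forall x y, 0 <= f x y).

Lemma tonelli_swap : \int[m1]_x \int[m2]_y f x y = \int[m2]_y \int[m1]_x f x y.
Proof. by apply: (@fubini_tonelli _ _ _ _ _ m1 m2 (fun p => f p.1 p.2)). Qed.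

Lemma measurable_integral_snd : measurable_fun setT (fun x => \int[m2]_y f x y).
Proof.
by apply: (@measurable_fun_fubini_tonelli_F _ _ _ _ _ m2 (fun p => f p.1 p.2)).
Qed.

End tonelli.

(** * The standard normal law: rotations, symmetry and squares *)

Section standard_normal.
Context {R : realType}.
Local Notation leb := (@lebesgue_measure R).
Local Notation N := (@normal_prob R 0 1).
Local Notation phi := (normal_pdf 0 1 : R -> R).
Local Open Scope ereal_scope.

Lemma integral_normal (m sg : R) (f : R -> \bar R) :
  measurable_fun setT f -> (forall x, 0 <= f x) ->
  \int[normal_prob m sg]_x f x = \int[leb]_x (f x * (normal_pdf m sg x)%:E).
Proof.
move=> mf f0; apply: (integral_density (T := measurableTypeR R)) => //.
- exact: measurable_normal_pdf.
- by move=> x; exact: normal_pdf_ge0.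
Qed.

Lemma phiE (x : R) : phi x = ((Num.sqrt (pi *+ 2))^-1 * expR (- (x ^+ 2 / 2)))%R.
Proof.
rewrite normal_pdfE ?oner_neq0// /normal_peak /normal_fun expr1n mul1r subr0 mulNr.
by rewrite mulr2n.
Qed.

Lemma phi_ge0 (x : R) : (0 <= phi x)%R. Proof. exact: normal_pdf_ge0. Qed.

Lemma measurable_phi d (T : measurableType d) (f : T -> R) :
  measurable_fun setT f -> measurable_fun setT (fun x => phi (f x)).
Proof. by move=> mf; apply: (measurableT_comp _ mf); exact: measurable_normal_pdf. Qed.

Lemma phi_rotation (c s u e : R) : (c ^+ 2 + s ^+ 2 = 1)%R ->
  (phi (c * u + s * e) * phi (c * e - s * u) = phi u * phi e)%R.
Proof.
move=> cs; rewrite !phiE [LHS]mulrACA [RHS]mulrACA -!expRD; congr (_ * expR _)%R.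
transitivity (- ((u ^+ 2 + e ^+ 2) * (c ^+ 2 + s ^+ 2) / 2))%R; first by field.
by rewrite cs; field.
Qed.

(** Two one-dimensional affine substitutions replace a change of variables in the plane: y = c e - s
    u for fixed u, then x = u / c + (s / c) y for fixed y. Each side acquires the factor 1 / c. The
    divisions explain the condition on [c]. *)
Lemma normal_rotation (F : R -> R -> \bar R) (c s : R) :
  measurable_fun setT (fun p : R * R => F p.1 p.2) -> (forall x y, 0 <= F x y) ->
  (0 < c)%R -> (c ^+ 2 + s ^+ 2 = 1)%R ->
  \int[N]_u \int[N]_e F (c * u + s * e)%R (c * e - s * u)%R =
  \int[N]_u \int[N]_e F u e.
Proof.
move=> mF F0 c0 cs.
pose H x y := F x y * (phi x * phi y)%:E.
have mH : measurable_fun setT (fun p : R * R => H p.1 p.2).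
  apply: emeasurable_funM => //; apply/measurable_EFinP.
  by apply: measurable_funM; apply: measurable_phi; mfun.
have H0 x y : 0 <= H x y by rewrite mule_ge0// lee_fin mulr_ge0 ?phi_ge0.
have NNE (G : R -> R -> \bar R) : measurable_fun setT (fun p : R * R => G p.1 p.2) ->
    (forall x y, 0 <= G x y) ->
    \int[N]_u \int[N]_e G u e = \int[leb]_u \int[leb]_e (G u e * (phi u * phi e)%:E).
  move=> mG G0; rewrite integral_normal; first last.
  - by move=> x; exact: integral_ge0.
  - exact: (@measurable_integral_snd _ _ _ _ _ N).
  apply: eq_integral => u _; have mGu : measurable_fun setT (G u) by apply: (measurable_fun2 mG); mfun.
  rewrite integral_normal// -ge0_integralZr//=; first last.
  - by rewrite lee_fin phi_ge0.
  - by move=> e _; rewrite mule_ge0// lee_fin phi_ge0.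
  - by apply: emeasurable_funM => //; apply/measurable_EFinP; apply: measurable_phi; mfun.
  by apply: eq_integral => e _; rewrite -muleA -EFinM mulrC.
have mrot : measurable_fun setT (fun p : R * R => F (c * p.1 + s * p.2)%R (c * p.2 - s * p.1)%R).
  by apply: (measurable_fun2 mF); mfun.
rewrite [LHS](NNE _ mrot (fun x y => F0 _ _)) [RHS](NNE F mF F0).
transitivity (\int[leb]_u \int[leb]_e H (c * u + s * e)%R (c * e - s * u)%R).
  by apply: eq_integral => u _; apply: eq_integral => e _; rewrite /H phi_rotation.
have c1 : (0 < c^-1)%R by rewrite invr_gt0.
transitivity (\int[leb]_u \int[leb]_y (H (c^-1 * u + s / c * y)%R y * c^-1%:E)).
  apply: eq_integral => u _.
  have mHu : measurable_fun setT (fun e => H (c * u + s * e)%R (c * e - s * u)%R).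
    by apply: (measurable_fun2 mH); mfun.
  rewrite (integral_affine (s / c * u) c1 mHu (fun e => H0 _ _)).
  apply: eq_integral => y _.
  have -> : (c * (c^-1 * y + s / c * u) - s * u = y)%R by field; rewrite gt_eqF.
  have -> : (c * u + s * (c^-1 * y + s / c * u) = c^-1 * (c ^+ 2 + s ^+ 2) * u + s / c * y)%R.
    by field; rewrite gt_eqF.
  by rewrite cs mulr1.
rewrite [LHS](@tonelli_swap _ _ _ _ _ leb leb
  (fun u y => H (c^-1 * u + s / c * y)%R y * c^-1%:E)); first last.
- by move=> x y; apply: mule_ge0; [exact: H0|rewrite lee_fin ltW].
- apply: emeasurable_funM; last exact: measurable_cst.
  by apply: (measurable_fun2 mH); mfun.
rewrite [RHS](@tonelli_swap _ _ _ _ _ leb leb (fun x y => H x y) mH H0).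
apply: eq_integral => y _.
have mHy : measurable_fun setT (H ^~ y) by apply: (measurable_fun2 mH); mfun.
by rewrite [RHS](integral_affine (s / c * y) c1 mHy (fun e => H0 _ _)).
Qed.

Lemma normal_opp (F : R -> \bar R) : measurable_fun setT F -> (forall x, 0 <= F x) ->
  \int[N]_e F (- e)%R = \int[N]_e F e.
Proof.
move=> mF F0.
have mFN : measurable_fun setT (fun e : R => F (- e)%R) by apply: (measurableT_comp mF); mfun.
have mh : measurable_fun setT (fun e : R => F e * (phi e)%:E).
  by apply: emeasurable_funM => //; apply/measurable_EFinP; exact: measurable_normal_pdf.
have h0 e : 0 <= F e * (phi e)%:E by rewrite mule_ge0// lee_fin phi_ge0.
rewrite (integral_normal 0 1 mFN (fun e => F0 _)) (integral_normal 0 1 mF F0).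
rewrite [RHS](integral_reflection mh h0).
by apply: eq_integral => e _; rewrite !phiE sqrrN.
Qed.

Lemma integral_even (h : R -> \bar R) : measurable_fun setT h -> (forall x, 0 <= h x) ->
  (forall x, h (- x)%R = h x) ->
  \int[leb]_x h x = \int[leb]_(x in `]0%R, +oo[) h x + \int[leb]_(x in `]0%R, +oo[) h x.
Proof.
move=> mh h0 hN.
have mhD D : measurable_fun D h by exact: (measurable_funS measurableT).
have -> : [set: R] = `]-oo, 0%R] `|` `]0%R, +oo[.
  apply/seteqP; split => x //= _; rewrite !in_itv/= andbT.
  by case: (leP x 0%R) => ?; [left|right].
rewrite ge0_integral_setU//=; first last.
- apply/disj_setPS => x /=; rewrite !in_itv/= andbT => -[x0].
  by rewrite ltNge x0.
- exact: mhD.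
congr (_ + _).
transitivity (\int[leb]_(x in `]-oo, 0%R]) h (- x)%R).
  by apply: eq_integral => x _; rewrite hN.
rewrite -(ge0_integration_by_substitution0 mh h0) integral_itv_obnd_cbnd//.
Qed.

Lemma normal_sqr (C : probability (measurableTypeR R) R) (F : R -> \bar R) :
  (forall A, C A = gamma_law (1 / 2) (1 / 2) A) ->
  measurable_fun setT F -> (forall x, 0 <= F x) ->
  \int[N]_z F (z ^+ 2)%R = \int[C]_x F x.
Proof.
move=> CE mF F0.
have h2 : (0 < 1 / 2 :> R)%R by rewrite divr_gt0.
have h2' : (1 / 2 != 0 :> R)%R by rewrite gt_eqF.
(* This is Gamma(1/2) / sqrt pi. That it equals 1 is not computed but read off at the end from the
   function 1. *)
pose k := ((Num.sqrt (pi *+ 2))^-1 * (gamma_function (1 / 2) / (1 / 2) `^ (1 / 2)) : R)%R.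
have k0 : (0 <= k)%R.
  by rewrite mulr_ge0 ?invr_ge0 ?sqrtr_ge0// divr_ge0 ?powR_ge0// ltW// gamma_function_gt0.
have claim (G : R -> \bar R) : measurable_fun setT G -> (forall x, 0 <= G x) ->
    \int[N]_z G (z ^+ 2)%R = k%:E * \int[C]_x G x.
  move=> mG G0.
  have mGs : measurable_fun setT (fun z : R => G (z ^+ 2)%R) by apply: (measurableT_comp mG); mfun.
  rewrite (integral_normal 0 1 mGs (fun z => G0 _)).
  pose h (z : R) := G (z ^+ 2)%R * (phi z)%:E.
  have mh : measurable_fun setT h.
    by apply: emeasurable_funM => //; apply/measurable_EFinP; exact: measurable_normal_pdf.
  have h0 z : 0 <= h z by rewrite mule_ge0// lee_fin phi_ge0.
  have hN z : h (- z)%R = h z by rewrite /h !phiE sqrrN.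
  rewrite (integral_even mh h0 hN).
  rewrite (integral_pow ltr01 h2' mh h0).
  have mpdf : measurable_fun setT (gamma_pdf (1 / 2) (1 / 2) : R -> R) by exact: measurable_gamma_pdf.
  have -> : \int[leb]_(x in `]0%R, +oo[) (h (1 * x `^ (1 / 2))%R * (`|1 / 2| * 1 * x `^ (1 / 2 - 1))%:E)
     = (k / 2)%:E * \int[leb]_(x in `]0%R, +oo[) (G x * (gamma_pdf (1 / 2) (1 / 2) x)%:E).
    rewrite -ge0_integralZl_EFin//; first last.
    - by rewrite divr_ge0.
    - apply: (measurable_funS measurableT) => //.
      by apply: emeasurable_funM => //; exact/measurable_EFinP.
    - by move=> x _; rewrite mule_ge0// lee_fin gamma_pdf_ge0.
    apply: eq_integral => x; rewrite inE/= in_itv/= andbT => x0.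
    have xx : ((1 * x `^ (1 / 2)) ^+ 2 = x)%R.
      by rewrite mul1r -powR_mulrn ?powR_ge0// -powRrM (_ : 1 / 2 * 2 = 1)%R ?powRr1 ?(ltW x0)//; field.
    rewrite /h xx phiE xx gamma_pdfE// /k muleCA -!muleA -!EFinM; congr (_ * _%:E).
    rewrite gtr0_norm// (_ : 1 / 2 * x = x / 2)%R; last by field.
    have : (gamma_function (1 / 2) / (1 / 2) `^ (1 / 2) != 0 :> R)%R.
      by rewrite gt_eqF// divr_gt0 ?gamma_function_gt0 ?powR_gt0.
    set g := (gamma_function _ / _)%R; set q := (Num.sqrt (pi *+ 2))^-1%R => g0.
    by field.
  rewrite -(integral_gamma h2 h2 CE mG G0) -ge0_muleDl ?lee_fin ?divr_ge0//.
  by rewrite -EFinD; congr (_%:E * _); field.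
rewrite (claim F mF F0).
(* Both measures have total mass 1, so their ratio [k] is 1. *)
have := claim (cst 1) (measurable_cst _) (fun _ => lee01).
rewrite !integral_probability_cst mule1 => <-.
by rewrite mul1e.
Qed.

End standard_normal.

(** * Sums of independent gamma variables, and the chi-squared laws *)

Section gamma_convolution.
Context {R : realType}.
Local Notation leb := (@lebesgue_measure R).
Local Open Scope ereal_scope.
Variables (s t r : R) (C D E : probability (measurableTypeR R) R).
Hypotheses (s0 : (0 < s)%R) (t0 : (0 < t)%R) (r0 : (0 < r)%R)
  (CE : forall A, C A = gamma_law s r A) (DE : forall A, D A = gamma_law t r A)
  (EE : forall A, E A = gamma_law (s + t) r A).

Let p (u : R) (x : R) : R := (gamma_pdf u r x * \1_(`]0%R, +oo[ : set R) x)%R.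

Let mp u : measurable_fun setT (p u).
Proof. by apply: measurable_funM; [exact: measurable_gamma_pdf|exact: measurable_indic]. Qed.

Let p0 u x : (0 < u)%R -> (0 <= p u x)%R.
Proof. by move=> u0; rewrite mulr_ge0// gamma_pdf_ge0. Qed.

Let p_le0 u x : (x <= 0)%R -> p u x = 0%R.
Proof.
move=> x0; rewrite /p indicE memNset ?mulr0//= in_itv/= andbT.
by apply/negP; rewrite -leNgt.
Qed.

Let p_gt0 u x : (0 < x)%R -> p u x = gamma_pdf u r x.
Proof. by move=> x0; rewrite /p indicE mem_set ?mulr1//= in_itv/= andbT. Qed.

Let intE (u : R) (K : probability (measurableTypeR R) R) (F : R -> \bar R) : (0 < u)%R ->
  (forall A, K A = gamma_law u r A) -> measurable_fun setT F -> (forall x, 0 <= F x) ->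
  \int[K]_x F x = \int[leb]_x (F x * (p u x)%:E).
Proof.
move=> u0 KE mF F0; apply: (integral_density (T := measurableTypeR R)) => //.
- exact: mp.
- by move=> x; exact: p0.
- by move=> A _; rewrite [LHS]KE gamma_law_density.
Qed.

Lemma gamma_convolution (F : R -> \bar R) : measurable_fun setT F -> (forall x, 0 <= F x) ->
  \int[C]_x \int[D]_y F (x + y)%R = \int[E]_x F x.
Proof.
move=> mF F0.
pose cst u : R := ((gamma_function u / r `^ u)^-1)%R.
have cst0 u : (0 < u)%R -> (0 < cst u)%R.
  by move=> u0; rewrite invr_gt0 divr_gt0 ?gamma_function_gt0 ?powR_gt0.
have st0 : (0 < s + t)%R by rewrite addr_gt0.
(* The unnormalised beta density, cut off outside ]0, 1[ by the two indicators. *)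
pose b (v : R) : R := (\1_(`]0%R, +oo[ : set R) v * v `^ (s - 1) *
  (\1_(`]0%R, +oo[ : set R) (1 - v) * (1 - v) `^ (t - 1)))%R.
have mI (f : R -> R) : measurable_fun setT f -> measurable_fun setT (fun x => \1_(`]0%R, +oo[ : set R) (f x) : R).
  by move=> mf; apply: (measurableT_comp _ mf); exact: measurable_indic.
have mb : measurable_fun setT b.
  by apply: measurable_funM; apply: measurable_funM; try (apply: mI); mfun.
have b0 v : (0 <= b v)%R by rewrite !mulr_ge0 ?powR_ge0.
have mbE : measurable_fun setT (fun v => (b v)%:E) by exact/measurable_EFinP.
pose k := (cst s * cst t / cst (s + t))%:E * \int[leb]_v (b v)%:E.
have c0 : (0 <= cst s * cst t / cst (s + t))%R by rewrite divr_ge0 ?mulr_ge0 ?ltW ?cst0.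
have k0 : 0 <= k.
  by rewrite mule_ge0 ?lee_fin//; apply: integral_ge0 => v _; rewrite lee_fin.
have mpc u d (T : measurableType d) (f : T -> R) : measurable_fun setT f ->
    measurable_fun setT (fun x => p u (f x)).
  by move=> mf; exact: (measurableT_comp (mp u) mf).
have conv w : \int[leb]_x (p s x * p t (w - x))%:E = k * (p (s + t) w)%:E.
  have [w0|w0] := leP w 0%R.
    rewrite (p_le0 _ w0) mule0; apply: integral0_eq => x _.
    have [x0|x0] := leP x 0%R; first by rewrite (p_le0 _ x0) mul0r.
    by rewrite (@p_le0 t) ?mulr0// subr_le0 (le_trans w0)// ltW.
  have mx : measurable_fun setT (fun x => (p s x * p t (w - x))%:E).
    by apply/measurable_EFinP; apply: measurable_funM; apply: mpc; mfun.
  have px x : 0 <= (p s x * p t (w - x))%:E by rewrite lee_fin mulr_ge0 ?p0.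
  (* The substitution x = w v separates the convolution integral into a power of w and a beta
     integral. *)
  rewrite (integral_affine 0 w0 mx px) /k muleAC -EFinM.
  rewrite -(ge0_integralZl_EFin leb measurableT (fun v _ => _) mbE); first last.
  - by rewrite mulr_ge0 ?p0.
  - by move=> v; rewrite lee_fin.
  apply: eq_integral => v _; rewrite -!EFinM; congr (_%:E).
  rewrite addr0 (p_gt0 _ w0) /b.
  have -> : (w - w * v = w * (1 - v))%R by ring.
  have [v0|v0] := leP v 0%R.
    rewrite (@p_le0 s) ?pmulr_rle0// indicE memNset ?(mulr0, mul0r)//= in_itv/= andbT.
    by apply/negP; rewrite -leNgt.
  have [v1|v1] := leP (1 - v)%R 0%R.
    rewrite (@p_le0 t) ?pmulr_rle0// [\1__ (1 - v)%R]indicE memNset ?(mulr0, mul0r)//= in_itv/= andbT.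
    by apply/negP; rewrite -leNgt.
  rewrite !p_gt0 ?mulr_gt0// !indicE !mem_set ?mul1r; last 2 first.
  - by rewrite /= in_itv/= andbT.
  - by rewrite /= in_itv/= andbT.
  rewrite !gamma_pdfE// -![(gamma_function _ / _)^-1%R]/(cst _).
  rewrite !powRM ?(ltW w0) ?(ltW v0) ?(ltW v1)//.
  have -> : expR (- (r * w)) = (expR (- (r * (w * v))) * expR (- (r * (w * (1 - v)))))%R.
    by rewrite -expRD; congr expR; ring.
  have -> : (s + t - 1 = (s - 1) + (t - 1) + 1)%R by ring.
  rewrite !gt0_powRD// powRr1 ?(ltW w0)//.
  by field; rewrite gt_eqF ?cst0.
have claim (G : R -> \bar R) : measurable_fun setT G -> (forall x, 0 <= G x) ->
    \int[C]_x \int[D]_y G (x + y)%R = k * \int[E]_x G x.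
  move=> mG G0.
  have mG2 : measurable_fun setT (fun q : R * R => G (q.1 + q.2)%R) by apply: (measurableT_comp mG); mfun.
  have mG1 x : measurable_fun setT (fun y : R => G (x + y)%R) by apply: (measurableT_comp mG); mfun.
  rewrite (intE s0 CE (@measurable_integral_snd _ _ _ _ _ D (fun x y : R => G (x + y)%R) mG2 (fun _ _ => G0 _))
    (fun x => integral_ge0 _ (fun _ _ => G0 _))).
  have mH : measurable_fun setT (fun q : R * R => G q.2 * (p s q.1 * p t (q.2 - q.1))%:E).
    apply: emeasurable_funM; first by apply: (measurableT_comp mG); mfun.
    by apply/measurable_EFinP; apply: measurable_funM; apply: mpc; mfun.
  have H0 x w : 0 <= G w * (p s x * p t (w - x))%:E by rewrite mule_ge0// lee_fin mulr_ge0 ?p0.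
  transitivity (\int[leb]_x \int[leb]_w (G w * (p s x * p t (w - x))%:E)).
    apply: eq_integral => x _; rewrite (intE t0 DE (mG1 x) (fun _ => G0 _)).
    have mf : measurable_fun setT (fun y => G (x + y)%R * (p t y)%:E).
      by apply: emeasurable_funM => //; apply/measurable_EFinP.
    have f0 y : 0 <= G (x + y)%R * (p t y)%:E by rewrite mule_ge0// lee_fin p0.
    rewrite (integral_affine (- x) ltr01 mf f0) -ge0_integralZr//; first last.
    - by rewrite lee_fin p0.
    - by move=> w _; rewrite mule1.
    - apply: emeasurable_funM; last exact: measurable_cst.
      by apply: (measurableT_comp mf); mfun.
    apply: eq_integral => w _; rewrite mule1 -muleA -EFinM mul1r.
    by rewrite [(x + _)%R]addrC subrK [(p t _ * _)%R]mulrC.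
  rewrite (@tonelli_swap _ _ _ _ _ leb leb (fun x w => G w * (p s x * p t (w - x))%:E) mH H0).
  rewrite (intE st0 EE mG G0) -ge0_integralZl//; first last.
  - by move=> w _; rewrite mule_ge0// lee_fin p0.
  - by apply: emeasurable_funM => //; apply/measurable_EFinP; exact: mp.
  apply: eq_integral => w _; rewrite muleCA -conv -ge0_integralZl//.
  - by apply/measurable_EFinP; apply: measurable_funM; apply: mpc; mfun.
  - by move=> x _; rewrite lee_fin mulr_ge0 ?p0.
rewrite (claim F mF F0).
(* Integrating 1 shows [k] to be 1, which replaces the evaluation of the beta integral by gamma
   functions. *)
have := claim (fun=> 1) (measurable_cst _) (fun _ => lee01).
under eq_integral do rewrite integral_probability_cst.
by rewrite (integral_probability_cst C) (integral_probability_cst E) mule1 => <-; rewrite mul1e.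
Qed.

End gamma_convolution.

Section chi2_sequence.
Context {R : realType}.
Local Notation N := (@normal_prob R 0 1).
Local Open Scope ereal_scope.

Lemma chi2_sequence : exists C : nat -> probability (measurableTypeR R) R,
  [/\ C 0%N = \d_ (0 : R)%R :> (set R -> \bar R),
      forall m A, C m.+1 A = chi2 (m.+1%:R) A &
      forall m (F : R -> \bar R), measurable_fun setT F -> (forall x, 0 <= F x) ->
        \int[C m]_r \int[N]_z F (r + z ^+ 2)%R = \int[C m.+1]_x F x].
Proof.
have h2 : (0 < 1 / 2 :> R)%R by rewrite divr_gt0.
have hm (m : nat) : (0 < m.+1%:R / 2 :> R)%R by rewrite divr_gt0.
have /choice[D DE] : forall m : nat, exists C : probability (measurableTypeR R) R,
    forall A, C A = gamma_law (m.+1%:R / 2) (1 / 2) A by move=> m; exact: gamma_prob.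
exists (fun m => if m is m'.+1 then D m' else (@dirac _ (measurableTypeR R) (0 : R)%R R : probability (measurableTypeR R) R)); split => //.
move=> [|m] F mF F0.
  rewrite integral_dirac//; last first.
    apply: (@measurable_integral_snd _ _ _ _ _ N (fun r z : R => F (r + z ^+ 2)%R)) => //.
    by apply: (measurableT_comp mF); mfun.
  rewrite diracT mul1e.
  under eq_integral do rewrite add0r.
  by apply: normal_sqr => // A; rewrite DE.
have E1 A : D 0%N A = gamma_law (1 / 2) (1 / 2) A by rewrite DE.
have E2 A : D m.+1 A = gamma_law (m.+1%:R / 2 + 1 / 2) (1 / 2) A.
  by rewrite DE -mulrDl -natr1.
rewrite -(gamma_convolution (hm m) h2 h2 (DE m) E1 E2 mF F0).
apply: eq_integral => r _.
by apply: normal_sqr => //; apply: (measurableT_comp mF); mfun.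
Qed.

End chi2_sequence.

(** * Factorisation of the bivariate normal density *)

Section binormal_density.
Context {R : realType}.
Local Notation params := (R * R * R * R * R)%type.
Variable p : params.
Hypothesis hp : param_space p.

Definition slope : R := rho p * sigma2 p / sigma1 p.
Definition resid_sd : R := Num.sqrt (theta2 p).

Lemma one_sub_rho2_gt0 : 0 < 1 - rho p ^+ 2.
Proof. by case: hp => _ _ /andP[h1 h2]; nra. Qed.

Lemma theta2_gt0 : 0 < theta2 p.
Proof. by case: hp => _ h2 _; rewrite mulr_gt0 ?one_sub_rho2_gt0// exprn_gt0. Qed.

Lemma resid_sd_gt0 : 0 < resid_sd.
Proof. by rewrite sqrtr_gt0 theta2_gt0. Qed.

Lemma resid_sd2 : resid_sd ^+ 2 = theta2 p.
Proof. by rewrite sqr_sqrtr// ltW// theta2_gt0. Qed.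

Lemma det_covmx : \det (covmx p) = sigma1 p ^+ 2 * theta2 p.
Proof.
rewrite (expand_det_row _ ord0) !big_ord_recl big_ord0 /cofactor !det_mx11 !mxE/= /theta2.
by ring.
Qed.

Let inv_cov : 'M[R]_2 := (sigma1 p ^+ 2 * theta2 p)^-1 *:
  \matrix_(i < 2, j < 2)
    if i == j then (if i == 0 then sigma2 p ^+ 2 else sigma1 p ^+ 2)
    else - (rho p * sigma1 p * sigma2 p).

Lemma invmx_covmx : invmx (covmx p) = inv_cov.
Proof.
have [s1 s2 _] := hp.
have h : sigma1 p ^+ 2 * theta2 p != 0 by rewrite gt_eqF// mulr_gt0 ?theta2_gt0 ?exprn_gt0.
have e : covmx p *m inv_cov = 1%:M.
  rewrite /inv_cov -scalemxAr; apply/matrixP => i j; rewrite !mxE !big_ord_recl big_ord0 !mxE/=.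
  have n1 : sigma1 p != 0 by rewrite gt_eqF.
  have n2 : sigma2 p != 0 by rewrite gt_eqF.
  have n3 : 1 - rho p ^+ 2 != 0 by rewrite gt_eqF// one_sub_rho2_gt0.
  rewrite /theta2; move: (sigma1 p) (sigma2 p) (rho p) n1 n2 n3 => a b r n1 n2 n3.
  by case: i => [[|[|//]] ?]; case: j => [[|[|//]] ?] /=; field; rewrite ?n1 ?n2 ?n3.
have u : covmx p \in unitmx by rewrite unitmxE det_covmx unitfE.
by rewrite -[LHS]mulmx1 -e mulmxA mulVmx// mul1mx.
Qed.

(** Completing the square in [y] splits the density into the marginal of the first coordinate and
    the regression of the second on it; [theta2] is the conditional variance. *)
Lemma binormal_pdfE (x y : R) : binormal_pdf p (x, y) =
  normal_pdf (mu1 p) (sigma1 p) x * normal_pdf (mu2 p + slope * (x - mu1 p)) resid_sd y.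
Proof.
have [s1 s2 hr] := hp; have t0 := theta2_gt0; have sd0 := resid_sd_gt0.
rewrite !normal_pdfE ?gt_eqF// /normal_peak /normal_fun resid_sd2.
rewrite mulrACA -expRD /binormal_pdf /mvn_pdf det_covmx invmx_covmx mulrC.
congr (_ * expR _).
  rewrite -invfM -sqrtrM; last by rewrite mulrn_wge0// mulr_ge0 ?sqr_ge0// pi_ge0.
  congr (Num.sqrt _)^-1; ring.
rewrite -mulNr; rewrite /inv_cov -scalemxAr -scalemxAl !mxE.
rewrite !big_ord_recl !big_ord0 !mxE !big_ord_recl !big_ord0 !mxE/=.
have n1 : sigma1 p != 0 by rewrite gt_eqF.
have n2 : sigma2 p != 0 by rewrite gt_eqF.
have n3 : 1 - rho p ^+ 2 != 0 by rewrite gt_eqF// one_sub_rho2_gt0.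
rewrite /slope /theta2.
move: (mu1 p) (mu2 p) (sigma1 p) (sigma2 p) (rho p) n1 n2 n3 => m1 m2 u v r n1 n2 n3.
by field; rewrite ?n1 ?n2 ?n3.
Qed.

End binormal_density.

(** * The effect of one new observation on the residual *)

Section step.
Context {R : realType}.
Local Notation N := (@normal_prob R 0 1).
Local Open Scope ereal_scope.

Lemma measurable_fun3 d d1 d2 d3 d4 (T : measurableType d) (T1 : measurableType d1)
  (T2 : measurableType d2) (T3 : measurableType d3) (T4 : measurableType d4)
  (G : T1 -> T2 -> T3 -> T4) (f : T -> T1) (g : T -> T2) (h : T -> T3) :
  measurable_fun setT (fun q : T1 * T2 * T3 => G q.1.1 q.1.2 q.2) ->
  measurable_fun setT f -> measurable_fun setT g -> measurable_fun setT h ->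
  measurable_fun setT (fun t => G (f t) (g t) (h t)).
Proof.
move=> mG mf mg mh.
exact: (measurableT_comp mG (measurable_fun_pair (measurable_fun_pair mf mg) mh)).
Qed.

(** The integrals are permuted so that the pair to be rotated is always innermost: first (u, e),
    giving u and a fresh normal w, then (v, w), giving v and z. Only r and z then remain coupled,
    and [conv] merges them. The cosines and sines are constants because the x_j are held fixed where
    this is applied. *)
Lemma normal_chi2_step (Cm Cm1 : probability (measurableTypeR R) R) (G : R -> R -> R -> \bar R)
  (c s c' s' : R) :
  (forall F : R -> \bar R, measurable_fun setT F -> (forall x, 0 <= F x) ->
     \int[Cm]_r \int[N]_z F (r + z ^+ 2)%R = \int[Cm1]_x F x) ->
  measurable_fun setT (fun q : R * R * R => G q.1.1 q.1.2 q.2) ->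
  (forall u v r, 0 <= G u v r) ->
  (0 < c)%R -> (c ^+ 2 + s ^+ 2 = 1)%R -> (0 < c')%R -> (c' ^+ 2 + s' ^+ 2 = 1)%R ->
  \int[Cm]_r \int[N]_v \int[N]_u \int[N]_e
    G (c * u + s * e)%R (c' * v + s' * (c * e - s * u))%R
      (r + (c' * (c * e - s * u) - s' * v) ^+ 2)%R =
  \int[Cm1]_r \int[N]_v \int[N]_u G u v r.
Proof.
move=> conv mG G0 c0 cs c'0 cs'.
have i0 d (T : measurableType d) (m : {measure set T -> \bar R}) (f : T -> \bar R) :
  (forall x, 0 <= f x) -> 0 <= \int[m]_x f x by move=> f0; exact: integral_ge0.
transitivity (\int[Cm]_r \int[N]_v \int[N]_u \int[N]_w
    G u (c' * v + s' * w)%R (r + (c' * w - s' * v) ^+ 2)%R).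
  apply: eq_integral => r _; apply: eq_integral => v _.
  apply: (normal_rotation (F := fun u w => G u (c' * v + s' * w)%R (r + (c' * w - s' * v) ^+ 2)%R)) => //.
  by apply: (measurable_fun3 mG); mfun.
pose H r := \int[N]_v \int[N]_u G u v r.
have mGu : measurable_fun setT (fun q : R * R => \int[N]_u G u q.1 q.2).
  apply: (@measurable_integral_snd _ _ _ _ _ N (fun (q : R * R) u => G u q.1 q.2)) => //.
  by apply: (measurable_fun3 mG); mfun.
have mGu' : measurable_fun setT (fun q : R * R => \int[N]_u G u q.2 q.1).
  by apply: (measurable_fun2 (F := fun v r : R => \int[N]_u G u v r) mGu); mfun.
have mH : measurable_fun setT H.
  apply: (@measurable_integral_snd _ _ _ _ _ N (fun r v : R => \int[N]_u G u v r)); last by move=> *; exact: i0.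
  exact: mGu'.
have H0 r : 0 <= H r by apply: (i0) => v; exact: (i0).
rewrite -(conv H mH H0).
apply: eq_integral => r _.
rewrite (@tonelli_swap _ _ _ _ _ N N (fun v u : R => \int[N]_w
  G u (c' * v + s' * w)%R (r + (c' * w - s' * v) ^+ 2)%R)); first last.
- by move=> v u; exact: i0.
- apply: (@measurable_integral_snd _ _ _ _ _ N (fun (q : R * R) w =>
    G q.2 (c' * q.1 + s' * w)%R (r + (c' * w - s' * q.1) ^+ 2)%R)) => //.
  by apply: (measurable_fun3 mG); mfun.
transitivity (\int[N]_u \int[N]_v \int[N]_z G u v (r + z ^+ 2)%R).
  apply: eq_integral => u _.
  apply: (normal_rotation (F := fun v z => G u v (r + z ^+ 2)%R)) => //.
  by apply: (measurable_fun3 mG); mfun.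
transitivity (\int[N]_u \int[N]_z \int[N]_v G u v (r + z ^+ 2)%R).
  apply: eq_integral => u _.
  apply: (@tonelli_swap _ _ _ _ _ N N (fun v z : R => G u v (r + z ^+ 2)%R)) => //.
  by apply: (measurable_fun3 mG); mfun.
rewrite (@tonelli_swap _ _ _ _ _ N N (fun u z : R => \int[N]_v G u v (r + z ^+ 2)%R)); first last.
- by move=> u z; exact: i0.
- apply: (@measurable_integral_snd _ _ _ _ _ N (fun (q : R * R) v => G q.1 v (r + q.2 ^+ 2)%R)) => //.
  by apply: (measurable_fun3 mG); mfun.
apply: eq_integral => z _.
apply: (@tonelli_swap _ _ _ _ _ N N (fun u v : R => G u v (r + z ^+ 2)%R)) => //.
by apply: (measurable_fun3 mG); mfun.
Qed.

End step.

(** * Recursions driven by independent variables *)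

Section independent_recursion.
Context d (T : measurableType d) (R : realType) (P : probability T R).
Context dS dU (S : measurableType dS) (U : measurableType dU).
Variables (n : nat) (Z : nat -> T -> U) (f : nat -> S -> U -> S) (w0 : S).
Hypotheses (mZ : forall j, measurable_fun setT (Z j))
  (mf : forall j, measurable_fun setT (fun q : S * U => f j q.1 q.2))
  (indZ : forall B : nat -> set U, (forall j, measurable (B j)) ->
     P [set w | forall j, (j < n)%N -> B j (Z j w)] = (\prod_(0 <= j < n) P (Z j @^-1` B j))%E).
Local Open Scope ereal_scope.

Fixpoint state (k : nat) (w : T) : S :=
  if k is k'.+1 then f k' (state k' w) (Z k' w) else w0.

Lemma measurable_state k : measurable_fun setT (state k).
Proof.
elim: k => [|k IH] /=; first exact: measurable_cst.
exact: (measurable_fun2 (mf k) IH (mZ k)).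
Qed.

Let tail (B : nat -> set U) k := [set w | forall j, (k <= j < n)%N -> B j (Z j w)].

Let mpre j (B : set U) : measurable B -> measurable (Z j @^-1` B).
Proof. by move=> mB; rewrite -[X in measurable X]setTI; exact: mZ. Qed.

Let mpreS j (A : set S) : measurable A -> measurable (state j @^-1` A).
Proof. by move=> mA; rewrite -[X in measurable X]setTI; exact: measurable_state. Qed.

Let mtail B k : (forall j, measurable (B j)) -> measurable (tail B k).
Proof.
move=> mB; rewrite (_ : tail B k = \bigcap_(j in [set j | (k <= j < n)%N]) (Z j @^-1` B j)).
  by apply: bigcap_measurableType => j _; exact: mpre.
by apply/seteqP; split => w /= h j; exact: h.
Qed.

Let measure_rect (m1 m2 : {measure set (S * U) -> \bar R}) : m1 setT < +oo ->
  (forall A B, measurable A -> measurable B -> m1 (A `*` B) = m2 (A `*` B)) ->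
  forall C, measurable C -> m1 C = m2 C.
Proof.
move=> m1oo h C mC.
pose G : set (set (S * U)) := [set C | exists A, measurable A /\ exists B, measurable B /\ C = A `*` B].
apply: (measure_unique G (fun=> setT)) => //.
- rewrite measurable_prod_measurableType //; congr (<<s _ >>).
  rewrite predeqE; split => [[A mA [B mB <-]]|[A [mA [B [mB ->]]]]].
    by exists A; split => //; exists B.
  by exists A => //; exists B.
- move=> /= _ _ [X1 [mX1 [X2 [mX2 ->]]]] [Y1 [mY1 [Y2 [mY2 ->]]]].
  rewrite -setXI; exists (X1 `&` Y1); split; first exact: measurableI.
  by exists (X2 `&` Y2); split => //; exact: measurableI.
- by move=> _; exists setT; split => //; exists setT; split => //; rewrite setXTT.
- by rewrite bigcup_const//; exists 0%N.
- by move=> A [A1 [mA1 [A2 [mA2 ->]]]]; rewrite h.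
Qed.

Let weighted (g : T -> R) (h : T -> S * U) : measurable_fun setT g -> (forall w, (0 <= g w)%R) ->
  measurable_fun setT h -> exists m : {measure set (S * U) -> \bar R},
    forall C, m C = \int[P]_(w in h @^-1` C) (g w)%:E.
Proof.
move=> mg g0 mh; have [m mE] := density_measure P mg g0.
unshelve eexists; first exact: (pushforward m h).
by move=> C; rewrite /= /pushforward mE.
Qed.

(** Independence of the state from all variables not yet consumed. Keeping the whole future in the
    statement is what makes the induction pass: the next state depends on [Z k], which belongs to
    the future of [state k]. *)
Lemma state_tail k (A : set S) (B : nat -> set U) : (k <= n)%N -> measurable A ->
  (forall j, measurable (B j)) ->
  P (state k @^-1` A `&` tail B k) =
  P (state k @^-1` A) * \prod_(k <= j < n) P (Z j @^-1` B j).
Proof.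
elim: k A B => [|k IH] A B kn mA mB.
  have -> : tail B 0%N = [set w | forall j, (j < n)%N -> B j (Z j w)] by [].
  have [Aw|Aw] := pselect (A w0).
    have -> : state 0 @^-1` A = setT by apply/seteqP; split.
    by rewrite setTI indZ// probability_setT mul1e.
  have -> : state 0 @^-1` A = set0 by apply/seteqP; split.
  by rewrite set0I measure0 mul0e.
have kn' : (k <= n)%N := ltnW kn.
pose W w := (state k w, Z k w).
have mW : measurable_fun setT W by apply: measurable_fun_pair => //; exact: measurable_state.
set pt := \prod_(k.+1 <= j < n) P (Z j @^-1` B j).
have pt0 : 0 <= pt by apply: prode_ge0 => j _; exact: measure_ge0.
have ptf : pt \is a fin_num.
  by apply: prode_fin_num => j _; rewrite fin_num_measure//; exact: mpre.
have mTl := mtail k.+1 mB.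
(* [m1] is the law of (state k, Z k) on the event that the later variables lie in their sets, and
   [m2] is the law of that pair times the probability of this event. The induction hypothesis
   equates them on rectangles. *)
have [m1 m1E] := weighted (@measurable_indic _ _ R setT _ mTl) (fun w => ler0n _ _) mW.
have [m2 m2E] := weighted (@measurable_cst _ _ T R setT (fine pt)) (fun w => fine_ge0 pt0) mW.
have mWC C : measurable C -> measurable (W @^-1` C).
  by move=> mC; rewrite -[X in measurable X]setTI; exact: mW.
have m1E' C : measurable C -> m1 C = P (W @^-1` C `&` tail B k.+1).
  by move=> mC; rewrite m1E (integral_indic P (mWC _ mC) mTl) setIC.
have m2E' C : measurable C -> m2 C = P (W @^-1` C) * pt.
  move=> mC; rewrite m2E (_ : (fun w => _) = cst pt); last by apply/funext => w /=; rewrite fineK.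
  by rewrite (integral_cst P (mWC _ mC)) muleC.
have m12 C : measurable C -> m1 C = m2 C.
  apply: measure_rect.
    rewrite m1E'// (le_lt_trans (probability_le1 _ _)) ?ltry//.
    by apply: measurableI => //; exact: mWC.
  move=> A1 B1 mA1 mB1; rewrite m1E' ?m2E'; try exact: measurableX.
  have key (B2 : nat -> set U) : (forall j, measurable (B2 j)) ->
      P (state k @^-1` A1 `&` Z k @^-1` B1 `&` tail B2 k.+1) =
      P (state k @^-1` A1) * (P (Z k @^-1` B1) * \prod_(k.+1 <= j < n) P (Z j @^-1` B2 j)).
    (* The second side of the rectangle is inserted at index [k], which makes the rectangle an
       instance of the induction hypothesis. *)
    move=> mB2; pose B3 j := if j == k then B1 else B2 j.
    have mB3 j : measurable (B3 j) by rewrite /B3; case: ifP.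
    have := IH A1 B3 kn' mA1 mB3; rewrite big_ltn// {2}/B3 eqxx.
    have -> : \prod_(k.+1 <= j < n) P (Z j @^-1` B3 j) = \prod_(k.+1 <= j < n) P (Z j @^-1` B2 j).
      by apply: eq_big_nat => j /andP[kj _]; rewrite /B3 gtn_eqF.
    move=> <-; congr (P _); rewrite -setIA; congr (_ `&` _).
    apply/seteqP; split => w /=.
      move=> [Bw h] j /andP[kj jn]; rewrite /B3; case: eqP => [->//|jk].
      by apply: h; rewrite jn andbT ltn_neqAle kj andbT eq_sym; exact/eqP.
    move=> h; split; first by have := h k; rewrite leqnn kn /B3 eqxx; apply.
    by move=> j /andP[kj jn]; have := h j; rewrite (ltnW kj) jn /B3 gtn_eqF//; apply.
  have WE : W @^-1` (A1 `*` B1) = state k @^-1` A1 `&` Z k @^-1` B1 by [].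
  rewrite WE (key B mB) muleA; congr (_ * _).
  have := key (fun=> setT) (fun=> measurableT).
  have -> : tail (fun=> setT) k.+1 = setT by apply/seteqP; split => // w _ j.
  rewrite setIT => ->; rewrite big1_seq ?mule1// => j _.
  by rewrite preimage_setT probability_setT.
(* The next state lies in [A] exactly when the pair lies in this set, which is not a rectangle;
   hence the extension from rectangles to all measurable sets. *)
pose C := [set q : S * U | A (f k q.1 q.2)].
have mC : measurable C by rewrite -[X in measurable X]setTI; exact: (mf k).
by have := m12 C mC; rewrite m1E'// m2E'.
Qed.

(** The joint law of [state k] and [Z k] is the product of their laws, so the new variable may be
    replaced by an independent copy. *)
Lemma integral_state k (F : S -> U -> \bar R) : (k < n)%N ->
  measurable_fun setT (fun q : S * U => F q.1 q.2) -> (forall s u, 0 <= F s u) ->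
  \int[P]_w F (state k w) (Z k w) = \int[P]_w \int[P]_w' F (state k w) (Z k w').
Proof.
move=> kn mF F0.
pose sm := HB.pack_for {mfun T >-> S} (state k) (isMeasurableFun.Build _ _ _ _ _ (measurable_state k)).
pose zm := HB.pack_for {mfun T >-> U} (Z k) (isMeasurableFun.Build _ _ _ _ _ (mZ k)).
pose W w := (state k w, Z k w).
have mW : measurable_fun setT W by apply: measurable_fun_pair => //; exact: measurable_state.
pose wm := HB.pack_for {mfun T >-> (S * U)%type} W (isMeasurableFun.Build _ _ _ _ _ mW).
have e C : measurable C -> (distribution P sm \x distribution P zm) C = distribution P wm C.
  apply: product_measure_unique => A B mA mB; rewrite /distribution /pushforward/=.
  pose B' j := if j == k then B else setT.
  have mB' j : measurable (B' j) by rewrite /B'; case: ifP.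
  have := state_tail (ltnW kn) mA mB'; rewrite big_ltn// {2}/B' eqxx.
  rewrite big_nat_cond big1 ?mule1 => [<-|j /andP[/andP[kj _] _]]; last first.
    by rewrite /B' gtn_eqF// preimage_setT probability_setT.
  congr (P _); apply/seteqP; split => w /=.
    by move=> [Aw Bw]; split => // j _; rewrite /B'; case: eqP => // ->.
  by move=> [Aw h]; split => //; have := h k; rewrite leqnn kn /B' eqxx; apply.
transitivity (\int[distribution P wm]_q F q.1 q.2).
  by rewrite ge0_integral_distribution.
rewrite -(eq_measure_integral _ (fun C mC _ => e C mC)).
rewrite (fubini_tonelli1 (fun q => F q.1 q.2))//.
rewrite /fubini_F /= ge0_integral_distribution//; last first.
- by move=> s; exact: integral_ge0.
- exact: measurable_integral_snd.
apply: eq_integral => w _ /=; rewrite ge0_integral_distribution//.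
by apply: (measurable_fun2 (F := F) mF); mfun.
Qed.

End independent_recursion.

(** * Measurability and exchange in fourfold integrals *)

Section iterated_integrals.
Context {R : realType}.
Local Notation N := (@normal_prob R 0 1).
Local Open Scope ereal_scope.
Variable C : probability (measurableTypeR R) R.

Let i0 d (T : measurableType d) (m : {measure set T -> \bar R}) (f : T -> \bar R) :
  (forall x, 0 <= f x) -> 0 <= \int[m]_x f x.
Proof. by move=> f0; exact: integral_ge0. Qed.

Lemma measurable_integral3 d (T : measurableType d) (H : T -> R -> R -> R -> \bar R) :
  measurable_fun setT (fun q : T * R * R * R => H q.1.1.1 q.2 q.1.2 q.1.1.2) ->
  (forall t u v r, 0 <= H t u v r) ->
  measurable_fun setT (fun t => \int[C]_r \int[N]_v \int[N]_u H t u v r).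
Proof.
move=> mH H0.
have m1 : measurable_fun setT (fun q : T * R * R => \int[N]_u H q.1.1 u q.2 q.1.2).
  exact: (@measurable_integral_snd _ _ _ _ _ N (fun (q : T * R * R) u => H q.1.1 u q.2 q.1.2)).
have m2 : measurable_fun setT (fun q : T * R => \int[N]_v \int[N]_u H q.1 u v q.2).
  apply: (@measurable_integral_snd _ _ _ _ _ N (fun (q : T * R) v => \int[N]_u H q.1 u v q.2) m1).
  by move=> *; exact: i0.
apply: (@measurable_integral_snd _ _ _ _ _ C (fun t r => \int[N]_v \int[N]_u H t u v r) m2).
by move=> *; apply: (i0) => v; exact: (i0).
Qed.

Lemma tonelli_swap3 (M : probability (measurableTypeR R) R) (H : R -> R -> R -> R -> \bar R) :
  measurable_fun setT (fun q : R * R * R * R => H q.1.1.1 q.2 q.1.2 q.1.1.2) ->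
  (forall x u v r, 0 <= H x u v r) ->
  \int[C]_r \int[N]_v \int[N]_u \int[M]_x H x u v r =
  \int[M]_x \int[C]_r \int[N]_v \int[N]_u H x u v r.
Proof.
move=> mH H0.
have mH' d (T : measurableType d) (f1 f2 f3 f4 : T -> R) :
    measurable_fun setT f1 -> measurable_fun setT f2 -> measurable_fun setT f3 ->
    measurable_fun setT f4 -> measurable_fun setT (fun t => H (f1 t) (f2 t) (f3 t) (f4 t)).
  move=> h1 h2 h3 h4; exact: (measurableT_comp mH (measurable_fun_pair
    (measurable_fun_pair (measurable_fun_pair h1 h4) h3) h2)).
transitivity (\int[C]_r \int[N]_v \int[M]_x \int[N]_u H x u v r).
  apply: eq_integral => r _; apply: eq_integral => v _.
  have m : measurable_fun setT (fun q : R * R => H q.2 q.1 v r) by apply: mH'; mfun.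
  exact: (@tonelli_swap _ _ _ _ _ N M (fun u x : R => H x u v r) m).
have m1 (r : R) : measurable_fun setT (fun q : R * R => \int[N]_u H q.2 u q.1 r).
  have m : measurable_fun setT (fun q : R * R * R => H q.1.2 q.2 q.1.1 r) by apply: mH'; mfun.
  exact: (@measurable_integral_snd _ _ _ _ _ N (fun (q : R * R) u => H q.2 u q.1 r) m).
transitivity (\int[C]_r \int[M]_x \int[N]_v \int[N]_u H x u v r).
  apply: eq_integral => r _.
  apply: (@tonelli_swap _ _ _ _ _ N M (fun v x : R => \int[N]_u H x u v r) (m1 r)).
  by move=> *; exact: i0.
apply: (@tonelli_swap _ _ _ _ _ C M (fun r x : R => \int[N]_v \int[N]_u H x u v r)).
  have m : measurable_fun setT (fun q : R * R * R => \int[N]_u H q.1.2 u q.2 q.1.1).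
    have m : measurable_fun setT (fun q : R * R * R * R => H q.1.1.2 q.2 q.1.2 q.1.1.1) by apply: mH'; mfun.
    exact: (@measurable_integral_snd _ _ _ _ _ N (fun (q : R * R * R) u => H q.1.2 u q.2 q.1.1) m).
  apply: (@measurable_integral_snd _ _ _ _ _ N (fun (q : R * R) v => \int[N]_u H q.2 u v q.1) m).
  by move=> *; exact: i0.
by move=> *; apply: (i0) => v; exact: (i0).
Qed.

End iterated_integrals.

(** * Recursive least squares by plane rotations *)

Section regression_state.
Context {R : realType}.
Local Notation S := (R * R * R * R * R)%type.

(** The angle comes from the normalised sum u = (e_0 + ... + e_(k-1)) / sqrt k: its update is (sqrt
    k u + e) / sqrt (k + 1). *)
Definition rot_c (k : nat) : R := Num.sqrt k%:R / Num.sqrt k.+1%:R.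
Definition rot_s (k : nat) : R := (Num.sqrt k.+1%:R)^-1.
(** Welford's updates of a mean and a centred sum of squares; the latter grows by k / (k + 1) (x -
    m)^2. *)
Definition next_m (k : nat) (m x : R) : R := m + (x - m) / k.+1%:R.
Definition next_s (k : nat) (m s x : R) : R := s + (rot_c k * (x - m)) ^+ 2.

(* Regressing e_0, ..., e_(k-1) on x_0, ..., x_(k-1) and a constant, the state
   ((((m, s), u), v), r) holds the mean m and the sum of squares s of the x_j
   about m, the normalised coordinates u, v of the e_j along the constants and
   along the centred x_j, and the residual sum of squares r.  A new observation
   rotates (u, e) into (u', w) and then (v, w) into (v', z), and r' = r + z^2. *)
Definition next_state (k : nat) (t : S) (z : R * R) : S :=
  let m := t.1.1.1.1 in let s := t.1.1.1.2 in
  let w := rot_c k * z.2 - rot_s k * t.1.1.2 in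
  let s1 := next_s k m s z.1 in
  let c' := Num.sqrt s / Num.sqrt s1 in
  let s' := rot_c k * (z.1 - m) / Num.sqrt s1 in
  (next_m k m z.1, s1, rot_c k * t.1.1.2 + rot_s k * z.2,
   c' * t.1.2 + s' * w, t.2 + (c' * w - s' * t.1.2) ^+ 2).

Lemma rot_c0 : rot_c 0 = 0. Proof. by rewrite /rot_c sqrtr0 mul0r. Qed.
Lemma rot_s0 : rot_s 0 = 1. Proof. by rewrite /rot_s sqrtr1 invr1. Qed.

Lemma sqrt_nat_gt0 k : 0 < Num.sqrt k.+1%:R :> R.
Proof. by rewrite sqrtr_gt0. Qed.

Lemma rot_c_gt0 k : (0 < k)%N -> 0 < rot_c k.
Proof. by case: k => // k _; rewrite divr_gt0 ?sqrt_nat_gt0. Qed.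

Lemma rot_cs k : rot_c k ^+ 2 + rot_s k ^+ 2 = 1.
Proof.
rewrite /rot_c /rot_s exprMn !exprVn !sqr_sqrtr ?ler0n// -[X in _ + X]mul1r -mulrDl.
by rewrite -natr1 mulfV// natr1 pnatr_eq0.
Qed.

Lemma measurable_next_m k d (T : measurableType d) (f g : T -> R) :
  measurable_fun setT f -> measurable_fun setT g ->
  measurable_fun setT (fun t => next_m k (f t) (g t)).
Proof.
move=> mf mg; apply: measurable_funD => //.
by apply: measurable_funM; [exact: measurable_funB|exact: measurable_cst].
Qed.

Lemma measurable_next_s k d (T : measurableType d) (f g h : T -> R) :
  measurable_fun setT f -> measurable_fun setT g -> measurable_fun setT h ->
  measurable_fun setT (fun t => next_s k (f t) (g t) (h t)).
Proof.
move=> mf mg mh; apply: measurable_funD => //; apply: measurable_funX.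
by apply: measurable_funM; [exact: measurable_cst|exact: measurable_funB].
Qed.

Lemma measurable_next_state k :
  measurable_fun setT (fun q : S * (R * R) => next_state k q.1 q.2).
Proof.
pose m (q : S * (R * R)) := q.1.1.1.1.1; pose s (q : S * (R * R)) := q.1.1.1.1.2.
pose u (q : S * (R * R)) := q.1.1.1.2; pose v (q : S * (R * R)) := q.1.1.2.
pose r (q : S * (R * R)) := q.1.2; pose x (q : S * (R * R)) := q.2.1.
pose e (q : S * (R * R)) := q.2.2.
have mm : measurable_fun setT m by rewrite /m; mfun.
have ms : measurable_fun setT s by rewrite /s; mfun.
have mu : measurable_fun setT u by rewrite /u; mfun.
have mv : measurable_fun setT v by rewrite /v; mfun.
have mr : measurable_fun setT r by rewrite /r; mfun.
have mx : measurable_fun setT x by rewrite /x; mfun.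
have me : measurable_fun setT e by rewrite /e; mfun.
have mcst (c : R) : measurable_fun [set: S * (R * R)] (fun=> c) by exact: measurable_cst.
have md : measurable_fun setT (fun q => rot_c k * (x q - m q)).
  by apply: measurable_funM => //; apply: measurable_funB.
have ms1 : measurable_fun setT (fun q => next_s k (m q) (s q) (x q)).
  by apply: measurable_funD => //; apply: measurable_funX.
have mw : measurable_fun setT (fun q => rot_c k * e q - rot_s k * u q).
  by apply: measurable_funB; apply: measurable_funM.
have mV : measurable_fun setT (fun q => (Num.sqrt (next_s k (m q) (s q) (x q)))^-1).
  by apply: measurableV; apply: measurable_sqrt_comp.
have mc : measurable_fun setT (fun q => Num.sqrt (s q) / Num.sqrt (next_s k (m q) (s q) (x q))).
  by apply: measurable_funM => //; apply: measurable_sqrt_comp.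
have ms' := measurable_funM md mV.
apply: measurable_fun_pair; last first.
  apply: measurable_funD => //; apply: measurable_funX.
  by apply: measurable_funB; apply: measurable_funM.
apply: measurable_fun_pair; last by apply: measurable_funD; apply: measurable_funM.
apply: measurable_fun_pair; last by apply: measurable_funD; apply: measurable_funM.
apply: measurable_fun_pair => //.
by apply: measurable_funD => //; apply: measurable_funM => //; apply: measurable_funB.
Qed.

(** With s = 0 the second rotation is a quarter turn: its cosine is 0 and its sine the sign of x -
    x0. So v becomes the new normal coordinate up to sign, and the residual of two points stays
    0. *)
Lemma next_state1 (x0 e0 x e : R) : x != x0 ->
  next_state 1 (x0, 0, e0, 0, 0) (x, e) =
  (next_m 1 x0 x, next_s 1 x0 0 x, rot_c 1 * e0 + rot_s 1 * e,
   Num.sg (x - x0) * (rot_c 1 * e - rot_s 1 * e0), 0).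
Proof.
move=> xx0; rewrite /next_state /= sqrtr0 !mul0r mulr0 subr0 expr0n/= !add0r.
congr (_, _, _, _ * _, _); rewrite /next_s add0r sqrtr_sqr normrM (gtr0_norm (rot_c_gt0 _))//.
have h : x - x0 != 0 by rewrite subr_eq0.
rewrite invfM mulrACA mulfV ?gt_eqF ?rot_c_gt0// mul1r.
by rewrite {1}(numEsg (x - x0)) -mulrA mulfV ?mulr1// normr_eq0.
Qed.

Lemma next_s_ge k m s x : s <= next_s k m s x.
Proof. by rewrite lerDl sqr_ge0. Qed.

Lemma next_s1_gt0 (x0 x : R) : x != x0 -> 0 < next_s 1 x0 0 x.
Proof.
move=> h; rewrite /next_s add0r lt_def sqr_ge0 andbT sqrf_eq0 mulf_eq0 subr_eq0.
by rewrite negb_or h andbT gt_eqF ?rot_c_gt0.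
Qed.

(* The raw power sums of the first k observations, in terms of the state. *)
Definition state_sums (k : nat) (t : S) (a : R * R * R * R * R) : Prop :=
  [/\ a.1.1.1.1 = k%:R * t.1.1.1.1, a.1.1.1.2 = Num.sqrt k%:R * t.1.1.2,
      a.1.1.2 = t.1.1.1.2 + k%:R * t.1.1.1.1 ^+ 2,
      a.1.2 = Num.sqrt t.1.1.1.2 * t.1.2 + t.1.1.1.1 * Num.sqrt k%:R * t.1.1.2 &
      a.2 = t.1.1.2 ^+ 2 + t.1.2 ^+ 2 + t.2].

Lemma state_sums_next k t (a : R * R * R * R * R) (x e : R) : 0 <= t.1.1.1.2 ->
  0 < next_s k t.1.1.1.1 t.1.1.1.2 x -> state_sums k t a ->
  state_sums k.+1 (next_state k t (x, e))
    (a.1.1.1.1 + x, a.1.1.1.2 + e, a.1.1.2 + x ^+ 2, a.1.2 + x * e, a.2 + e ^+ 2).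
Proof.
case: t => [[[[m s] u] v] r]; case: a => [[[[a1 a2] a3] a4] a5] /= s0.
set s1 := next_s k m s x => s1_gt0 [/= -> -> -> -> ->].
rewrite /state_sums /next_state /= -/s1.
have K : k%:R = Num.sqrt k%:R ^+ 2 :> R by rewrite sqr_sqrtr// ler0n.
have K1 : k.+1%:R = Num.sqrt k.+1%:R ^+ 2 :> R by rewrite sqr_sqrtr// ler0n.
have K2 : Num.sqrt k.+1%:R ^+ 2 = Num.sqrt k%:R ^+ 2 + 1 :> R by rewrite -K -K1 natr1.
have q1_gt0 := sqrt_nat_gt0 k.
have : s1 = s + (rot_c k * (x - m)) ^+ 2 by [].
have : Num.sqrt s1 ^+ 2 = s1 by rewrite sqr_sqrtr// ltW.
have : Num.sqrt s ^+ 2 = s by rewrite sqr_sqrtr.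
have : 0 < Num.sqrt s1 by rewrite sqrtr_gt0.
(* Once the four square roots are replaced by variables, only their quadratic relations remain, and
   the claims become identities of rational functions. *)
rewrite /next_m /rot_c /rot_s; move: K K1 K2 q1_gt0.
move: (Num.sqrt k%:R) (Num.sqrt k.+1%:R) (Num.sqrt s) (Num.sqrt s1) => q q1 S0 S1.
move=> -> -> K2 q1_gt0 S1_gt0 sE s1E1 s1E2.
have n1 : q1 != 0 by rewrite gt_eqF.
have n2 : S1 != 0 by rewrite gt_eqF.
have qE : q ^+ 2 = q1 ^+ 2 - 1 by rewrite K2 addrK.
have key : S1 ^+ 2 = S0 ^+ 2 + (q / q1 * (x - m)) ^+ 2 by rewrite s1E1 s1E2 sE.
split.
- by rewrite mulrDr [_ * (_ / _)]mulrCA mulfV ?sqrf_eq0// mulr1 qE; ring.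
- by field.
- rewrite s1E2 -sE; transitivity (S0 ^+ 2 + q ^+ 2 * m ^+ 2 + x ^+ 2) => //.
  have -> : (q / q1 * (x - m)) ^+ 2 = q ^+ 2 / q1 ^+ 2 * (x - m) ^+ 2 by field.
  by rewrite qE; field.
- transitivity (S0 * v + q / q1 * (x - m) * (q / q1 * e - q1^-1 * u) +
    (m + (x - m) / q1 ^+ 2) * (q * u + e)); last by field; rewrite n1 n2.
  have -> : q / q1 * (x - m) * (q / q1 * e - q1^-1 * u) =
    (x - m) * (q ^+ 2 * e - q * u) / q1 ^+ 2 by field.
  by rewrite qE; field.
(* Each rotation preserves a sum of two squares, so u^2 + v^2 + r grows by exactly e^2. *)
- set w := q / q1 * e - q1^-1 * u; set d := q / q1 * (x - m).
  have e1 : (S0 / S1 * v + d / S1 * w) ^+ 2 + (S0 / S1 * w - d / S1 * v) ^+ 2 = v ^+ 2 + w ^+ 2.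
    transitivity ((v ^+ 2 + w ^+ 2) * (S0 ^+ 2 + d ^+ 2) / S1 ^+ 2); first by field.
    by rewrite -key mulfK// sqrf_eq0.
  have e2 : (q / q1 * u + q1^-1 * e) ^+ 2 + w ^+ 2 = u ^+ 2 + e ^+ 2.
    transitivity ((u ^+ 2 + e ^+ 2) * (q ^+ 2 + 1) / q1 ^+ 2); first by rewrite /w; field.
    by rewrite -K2 mulfK// sqrf_eq0.
  transitivity ((u ^+ 2 + e ^+ 2) + v ^+ 2 + r); first by ring.
  rewrite -e2 [RHS](_ : _ = (q / q1 * u + q1^-1 * e) ^+ 2 +
    ((S0 / S1 * v + d / S1 * w) ^+ 2 + (S0 / S1 * w - d / S1 * v) ^+ 2) + r); last by ring.
  by rewrite e1; ring.
Qed.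

End regression_state.

(** * The law of the state: independence of residual and regressors *)

Section state_law.
Context {R : realType}.
Local Notation S := (R * R * R * R * R)%type.
Local Notation N := (@normal_prob R 0 1).
Local Open Scope ereal_scope.
Context d (T : measurableType d) (P : probability T R).
Variables (n : nat) (Z : nat -> T -> R * R) (mx sx : R).
Hypotheses (sx0 : sx != 0%R) (mZ : forall j, measurable_fun setT (Z j))
  (indZ : forall B : nat -> set (R * R), (forall j, measurable (B j)) ->
     P [set w | forall j, (j < n)%N -> B j (Z j w)] = \prod_(0 <= j < n) P (Z j @^-1` B j))
  (lawZ : forall j (F : R * R -> \bar R), (j < n)%N -> measurable_fun setT F ->
     (forall z, 0 <= F z) ->
     \int[P]_w F (Z j w) = \int[normal_prob mx sx]_x \int[N]_e F (x, e)).
Variable C : nat -> probability (measurableTypeR R) R.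
Hypotheses (C0 : C 0%N = \d_ (0 : R)%R :> (set R -> \bar R))
  (CS : forall m (F : R -> \bar R), measurable_fun setT F -> (forall x, 0 <= F x) ->
        \int[C m]_r \int[N]_z F (r + z ^+ 2)%R = \int[C m.+1]_x F x).

Local Notation Nx := (normal_prob mx sx).
Local Notation st := (state Z next_state (0, 0, 0, 0, 0)%R).

Let i0 d' (T' : measurableType d') (m : {measure set T' -> \bar R}) (f : T' -> \bar R) :
  (forall x, 0 <= f x) -> 0 <= \int[m]_x f x.
Proof. by move=> f0; exact: integral_ge0. Qed.

Let mst k : measurable_fun setT (st k).
Proof. by apply: measurable_state => // j; exact: measurable_next_state. Qed.

Let mst_m k : measurable_fun setT (fun w => (st k w).1.1.1.1).
Proof. by do 4 apply: measurable_comp_fst; exact: mst. Qed.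

Let mst_s k : measurable_fun setT (fun w => (st k w).1.1.1.2).
Proof. by apply: measurable_comp_snd; do 3 apply: measurable_comp_fst; exact: mst. Qed.

(** The mean of [F] when the regressor part (m1, s1) is fixed and u, v, r are independent, with two
    standard normal laws and the law [C m]. [state_law] identifies it with the conditional mean. *)
Let average (m : nat) (F : S -> \bar R) (m1 s1 : R) : \bar R :=
  \int[C m]_r \int[N]_v \int[N]_u F (m1, s1, u, v, r).

Let average_ge0 m F m1 s1 : (forall t, 0 <= F t) -> 0 <= average m F m1 s1.
Proof. by move=> F0; apply: (i0) => r; apply: (i0) => v; exact: (i0). Qed.

Let measurable_state_tuple d' (T' : measurableType d') (F : S -> \bar R) (f1 f2 f3 f4 f5 : T' -> R) :
  measurable_fun setT F ->
  measurable_fun setT f1 -> measurable_fun setT f2 -> measurable_fun setT f3 ->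
  measurable_fun setT f4 -> measurable_fun setT f5 ->
  measurable_fun setT (fun t => F (f1 t, f2 t, f3 t, f4 t, f5 t)).
Proof.
move=> mF h1 h2 h3 h4 h5; exact: (measurableT_comp mF (measurable_fun_pair
  (measurable_fun_pair (measurable_fun_pair (measurable_fun_pair h1 h2) h3) h4) h5)).
Qed.

Let measurable_average m F d' (T' : measurableType d') (f g : T' -> R) :
  measurable_fun setT F -> (forall t, 0 <= F t) ->
  measurable_fun setT f -> measurable_fun setT g ->
  measurable_fun setT (fun t => average m F (f t) (g t)).
Proof.
move=> mF F0 mf mg.
apply: (@measurable_integral3 R (C m) _ T' (fun t u v r => F (f t, g t, u, v, r))) => //.
apply: measurable_state_tuple => //; try mfun.
- by apply: (measurableT_comp mf); mfun.
- by apply: (measurableT_comp mg); mfun.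
Qed.

Let integral_next k (F : S -> \bar R) : (k < n)%N -> measurable_fun setT F -> (forall t, 0 <= F t) ->
  \int[P]_w F (st k.+1 w) = \int[P]_w \int[Nx]_x \int[N]_e F (next_state k (st k w) (x, e)).
Proof.
move=> kn mF F0.
have mFn : measurable_fun setT (fun q : S * (R * R) => F (next_state k q.1 q.2)).
  exact: (measurableT_comp mF (@measurable_next_state R k)).
rewrite (@integral_state _ T R P _ _ S (R * R)%type n Z next_state _ mZ (@measurable_next_state R)
  indZ k (fun t z => F (next_state k t z)) kn mFn (fun _ _ => F0 _)).
apply: eq_integral => w _.
apply: (lawZ (F := fun z => F (next_state k (st k w) z))) => //.
apply: (measurable_fun2 (F := fun t z => F (next_state k t z)) mFn); mfun.
Qed.

Let integral_next_average k m (F : S -> \bar R) : (k < n)%N -> measurable_fun setT F ->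
  (forall t, 0 <= F t) ->
  \int[P]_w average m F (st k.+1 w).1.1.1.1 (st k.+1 w).1.1.1.2 =
  \int[P]_w \int[Nx]_x average m F (next_m k (st k w).1.1.1.1 x)
    (next_s k (st k w).1.1.1.1 (st k w).1.1.1.2 x).
Proof.
move=> kn mF F0.
rewrite (@integral_next k (fun t => average m F t.1.1.1.1 t.1.1.1.2) kn); first last.
- by move=> t; exact: average_ge0.
- by apply: measurable_average => //; mfun.
apply: eq_integral => w _; apply: eq_integral => x _.
exact: (@integral_probability_cst _ _ R N (average m F (next_m k (st k w).1.1.1.1 x)
  (next_s k (st k w).1.1.1.1 (st k w).1.1.1.2 x))).
Qed.

(** The zero start leaves no trace: at k = 0 the first rotation is a quarter turn that puts e in the
    place of u, and the second has 0 / 0 = 0 for both coefficients. *)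
Let state1 w : st 1%N w = ((Z 0%N w).1, 0, (Z 0%N w).2, 0, 0)%R.
Proof.
rewrite /= /next_state /next_m /next_s /= rot_c0 rot_s0 divr1 subr0 !mul0r !mul1r !add0r.
have z2 : (0 ^+ 2 = 0 :> R)%R by rewrite expr0n.
by rewrite !(z2, sqrtr0, mul0r, oppr0, addr0).
Qed.

(** The base case needs its own proof because the second rotation has cosine 0 and escapes
    [normal_rotation]. Off the null event x = x0, [next_state1] gives the state explicitly. *)
Lemma state_law2 (F : S -> \bar R) : (1 < n)%N -> measurable_fun setT F -> (forall t, 0 <= F t) ->
  \int[P]_w F (st 2%N w) =
  \int[P]_w average 0 F (st 2%N w).1.1.1.1 (st 2%N w).1.1.1.2.
Proof.
move=> n1 mF F0; have n0 : (0 < n)%N := ltnW n1.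
rewrite (@integral_next 1%N F n1 mF F0) (@integral_next_average 1%N 0%N F n1 mF F0).
under eq_integral do rewrite state1.
under [RHS]eq_integral do rewrite state1 /=.
have mFn : measurable_fun setT (fun q : S * (R * R) => F (next_state 1 q.1 q.2)).
  exact: (measurableT_comp mF (@measurable_next_state R 1)).
have mA : measurable_fun setT (fun q : R * R => average 0 F (next_m 1 q.1 q.2) (next_s 1 q.1 0 q.2)).
  by apply: measurable_average => //; [apply: measurable_next_m|apply: measurable_next_s]; mfun.
have mG d' (T' : measurableType d') (f1 f2 f3 f4 : T' -> R) :
    measurable_fun setT f1 -> measurable_fun setT f2 -> measurable_fun setT f3 ->
    measurable_fun setT f4 ->
    measurable_fun setT (fun t => F (next_state 1 (f1 t, 0, f2 t, 0, 0)%R (f3 t, f4 t))).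
  move=> h1 h2 h3 h4.
  apply: (measurable_fun2 (F := fun t z => F (next_state 1 t z)) mFn); mfun.
have mGe : measurable_fun setT (fun q : R * R * R => \int[N]_e F (next_state 1 (q.1.1, 0, q.1.2, 0, 0)%R (q.2, e))).
  have m : measurable_fun setT (fun q : R * R * R * R => F (next_state 1 (q.1.1.1, 0, q.1.1.2, 0, 0)%R (q.1.2, q.2))).
    by apply: mG; mfun.
  exact: (@measurable_integral_snd _ _ _ _ _ N (fun (q : R * R * R) e => F (next_state 1 (q.1.1, 0, q.1.2, 0, 0)%R (q.2, e))) m).
have mGx : measurable_fun setT (fun z : R * R => \int[Nx]_x \int[N]_e F (next_state 1 (z.1, 0, z.2, 0, 0)%R (x, e))).
  apply: (@measurable_integral_snd _ _ _ _ _ Nx (fun (z : R * R) x => \int[N]_e F (next_state 1 (z.1, 0, z.2, 0, 0)%R (x, e))) mGe).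
  by move=> *; exact: i0.
rewrite (lawZ n0 mGx (fun _ => i0 _ (fun _ => i0 _ (fun _ => F0 _)))).
have mAx : measurable_fun setT (fun z : R * R => \int[Nx]_x average 0 F (next_m 1 z.1 x) (next_s 1 z.1 0 x)).
  have m : measurable_fun setT (fun q : R * R * R => average 0 F (next_m 1 q.1.1 q.2) (next_s 1 q.1.1 0 q.2)).
    by apply: measurable_average => //; [apply: measurable_next_m|apply: measurable_next_s]; mfun.
  apply: (@measurable_integral_snd _ _ _ _ _ Nx (fun (z : R * R) x => average 0 F (next_m 1 z.1 x) (next_s 1 z.1 0 x)) m).
  by move=> *; exact: average_ge0.
rewrite (lawZ n0 mAx (fun _ => i0 _ (fun _ => average_ge0 _ _ _ F0))).
apply: eq_integral => x0 _; rewrite [RHS](@integral_probability_cst _ _ R N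
  (\int[Nx]_x average 0 F (next_m 1 x0 x) (next_s 1 x0 0 x))).
have mE0 : measurable_fun setT (fun q : R * R => \int[N]_e F (next_state 1 (x0, 0, q.1, 0, 0)%R (q.2, e))).
  have m : measurable_fun setT (fun q : R * R * R => F (next_state 1 (x0, 0, q.1.1, 0, 0)%R (q.1.2, q.2))).
    by apply: mG; mfun.
  exact: (@measurable_integral_snd _ _ _ _ _ N (fun (q : R * R) e => F (next_state 1 (x0, 0, q.1, 0, 0)%R (q.2, e))) m).
rewrite (@tonelli_swap _ _ _ _ _ N Nx (fun e0 x : R => \int[N]_e F (next_state 1 (x0, 0, e0, 0, 0)%R (x, e))) mE0); last first.
  by move=> *; exact: i0.
have mE0' : measurable_fun setT (fun q : R * R => \int[N]_e F (next_state 1 (x0, 0, q.2, 0, 0)%R (q.1, e))).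
  apply: (measurable_fun2 (F := fun a b : R => \int[N]_e F (next_state 1 (x0, 0, a, 0, 0)%R (b, e))) mE0); mfun.
apply: ge0_ae_eq_integral => //.
- apply: (@measurable_integral_snd _ _ _ _ _ N (fun x e0 : R => \int[N]_e F (next_state 1 (x0, 0, e0, 0, 0)%R (x, e))) mE0').
  by move=> *; exact: i0.
- by apply: measurable_average => //; [apply: measurable_next_m|apply: measurable_next_s]; mfun.
- by move=> x _; apply: (i0) => e0; exact: (i0).
- by move=> x _; exact: average_ge0.
(* For fixed x0 the exceptional set is a single point, null for the normal law of x. *)
exists [set x0 : R]; split => //; first exact: integral_set1.
move=> x /= h; apply: contrapT => /eqP xx0; apply: h => _.
rewrite /average.
have -> : \int[N]_e0 \int[N]_e F (next_state 1 (x0, 0, e0, 0, 0)%R (x, e)) =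
    \int[N]_u \int[N]_v F (next_m 1 x0 x, next_s 1 x0 0 x, u, Num.sg (x - x0) * v, 0)%R.
  under eq_integral do under eq_integral do rewrite next_state1//.
  apply: (normal_rotation (F := fun u v => F (next_m 1 x0 x, next_s 1 x0 0 x, u, Num.sg (x - x0) * v, 0)%R)) => //.
  - by apply: measurable_state_tuple => //; mfun.
  - exact: rot_c_gt0.
  - exact: rot_cs.
have -> : \int[C 0]_r \int[N]_v \int[N]_u F (next_m 1 x0 x, next_s 1 x0 0 x, u, v, r) =
    \int[N]_v \int[N]_u F (next_m 1 x0 x, next_s 1 x0 0 x, u, v, 0%R).
  have m : measurable_fun setT (fun r : R => \int[N]_v \int[N]_u F (next_m 1 x0 x, next_s 1 x0 0 x, u, v, r)).
    have m' : measurable_fun setT (fun q : R * R => \int[N]_u F (next_m 1 x0 x, next_s 1 x0 0 x, u, q.2, q.1)).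
      have m'' : measurable_fun setT (fun q : R * R * R => F (next_m 1 x0 x, next_s 1 x0 0 x, q.2, q.1.2, q.1.1)).
        by apply: measurable_state_tuple => //; mfun.
      exact: (@measurable_integral_snd _ _ _ _ _ N (fun (q : R * R) u => F (next_m 1 x0 x, next_s 1 x0 0 x, u, q.2, q.1)) m'').
    apply: (@measurable_integral_snd _ _ _ _ _ N (fun r v : R => \int[N]_u F (next_m 1 x0 x, next_s 1 x0 0 x, u, v, r)) m').
    by move=> *; exact: i0.
  transitivity (\int[@dirac _ (measurableTypeR R) (0 : R)%R R]_r \int[N]_v \int[N]_u F (next_m 1 x0 x, next_s 1 x0 0 x, u, v, r)).
    by apply: eq_measure_integral => A _ _; exact: (congr1 (fun f => f A) C0).
  by rewrite integral_dirac// diracT mul1e.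
have mv (a : R) : measurable_fun setT (fun v : R => F (next_m 1 x0 x, next_s 1 x0 0 x, a, v, 0%R)).
  by apply: measurable_state_tuple => //; mfun.
(* The sign of x - x0 in front of v disappears by the symmetry of the normal law. *)
transitivity (\int[N]_u \int[N]_v F (next_m 1 x0 x, next_s 1 x0 0 x, u, v, 0%R)).
  apply: eq_integral => u _.
  have : (x - x0 != 0)%R by rewrite subr_eq0.
  case: (sgrP (x - x0)%R) => // _ _.
    by under eq_integral do rewrite mul1r.
  under eq_integral do rewrite mulN1r.
  exact: (normal_opp (F := fun v => F (next_m 1 x0 x, next_s 1 x0 0 x, u, v, 0%R))).
apply: (@tonelli_swap _ _ _ _ _ N N (fun u v : R => F (next_m 1 x0 x, next_s 1 x0 0 x, u, v, 0%R))) => //.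
have m : measurable_fun setT (fun q : R * R => F (next_m 1 x0 x, next_s 1 x0 0 x, q.1, q.2, 0%R)).
  by apply: measurable_state_tuple => //; mfun.
exact: m.
Qed.

(** At two observations [state_law2] is applied to the indicator of s <= 0; integrating over the
    second x gives 0, since s > 0 unless the two x coincide. Later observations can only increase
    s. *)
Lemma state_s_gt0 k : (2 <= k <= n)%N -> {ae P, forall w, (0 < (st k w).1.1.1.2)%R}.
Proof.
case: k => [|[|k]] //; elim: k => [/= n1|k IH kn].
  pose F (t : S) : \bar R := (\1_[set s : R | (s <= 0)%R] t.1.1.1.2)%:E.
  have mle : measurable [set s : R | (s <= 0)%R].
    rewrite (_ : [set s | _] = `]-oo, 0%R]%classic); first exact: measurable_itv.
    by apply/seteqP; split => s /=; rewrite in_itv.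
  have mF : measurable_fun setT F.
    have m1 := @measurable_indic _ _ R setT _ mle.
    have m2 : measurable_fun setT (fun t : S => t.1.1.1.2) by mfun.
    by apply/measurable_EFinP; exact: (measurableT_comp m1 m2).
  have F0 t : 0 <= F t by rewrite lee_fin.
  have := state_law2 n1 mF F0.
  rewrite (@integral_next_average 1%N 0%N F n1 mF F0).
  under [RHS]eq_integral do rewrite state1 /=.
  have -> : \int[P]_w \int[Nx]_x average 0 F (next_m 1 (Z 0%N w).1 x) (next_s 1 (Z 0%N w).1 0 x) = 0.
    apply: integral0_eq => w _.
    transitivity (\int[Nx]_(x in [set: R]) (cst 0 : R -> \bar R) x); last exact: integral0.
    apply: ge0_ae_eq_integral => //.
    - by apply: measurable_average => //; [apply: measurable_next_m|apply: measurable_next_s]; mfun.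
    - by move=> x _; exact: average_ge0.
    exists [set (Z 0%N w).1]; split => //; first exact: integral_set1.
    move=> x /= h; apply: contrapT => /eqP xx0; apply: h => _.
    apply: integral0_eq => r _; apply: integral0_eq => v _; apply: integral0_eq => u _.
    rewrite /F /= indicE memNset//= => /(lt_le_trans (next_s1_gt0 xx0)).
    by rewrite ltxx.
  move=> h.
  have mA : measurable [set w | ((st 2%N w).1.1.1.2 <= 0)%R].
    rewrite (_ : [set w | _] = ~` [set w | (0 < (st 2%N w).1.1.1.2)%R]).
      by apply: measurableC; exact: (measurable_lt_set (@measurable_cst _ _ T R setT 0%R) (mst_s 2)).
    by apply/seteqP; split => w /=; rewrite leNgt => /negP.
  exists [set w | ((st 2%N w).1.1.1.2 <= 0)%R]; split => //.
    have := @integral_indic _ _ _ P setT measurableT _ mA; rewrite setIT => <-.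
    by rewrite -[RHS]h; apply: eq_integral.
  by move=> w /= /negP; rewrite -leNgt.
have /andP[_ kn'] := kn.
have /IH : (1 < k.+2 <= n)%N by rewrite /= ltnW.
apply: filterS => w h; apply: (lt_le_trans h); exact: next_s_ge.
Qed.

(** The equality for all [F] says that u, v, r are independent of each other and of (m, s). The
    degrees of freedom are [k.-2] because u and v absorb two dimensions. The induction hypothesis is
    applied to [F] already integrated over the new observation. *)
Lemma state_law k (F : S -> \bar R) : (2 <= k <= n)%N -> measurable_fun setT F ->
  (forall t, 0 <= F t) ->
  \int[P]_w F (st k w) = \int[P]_w average k.-2 F (st k w).1.1.1.1 (st k w).1.1.1.2.
Proof.
case: k => [|[|k]] //; elim: k F => [|k IH] F kn mF F0; first exact: state_law2.
have kn' : (k.+2 < n)%N by case/andP: kn.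
rewrite (@integral_next k.+2 F kn' mF F0) (@integral_next_average k.+2 k.+1 F kn' mF F0).
have mFn : measurable_fun setT (fun q : S * (R * R) => F (next_state k.+2 q.1 q.2)).
  exact: (measurableT_comp mF (@measurable_next_state R k.+2)).
have mFxe : measurable_fun setT (fun q : S * R => \int[N]_e F (next_state k.+2 q.1 (q.2, e))).
  have m : measurable_fun setT (fun q : S * R * R => F (next_state k.+2 q.1.1 (q.1.2, q.2))).
    apply: (measurable_fun2 (F := fun t z => F (next_state k.+2 t z)) mFn); mfun.
  exact: (@measurable_integral_snd _ _ _ _ _ N (fun (q : S * R) e => F (next_state k.+2 q.1 (q.2, e))) m).
pose F' (t : S) := \int[Nx]_x \int[N]_e F (next_state k.+2 t (x, e)).
have mF' : measurable_fun setT F'.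
  apply: (@measurable_integral_snd _ _ _ _ _ Nx (fun t x => \int[N]_e F (next_state k.+2 t (x, e))) mFxe).
  by move=> *; exact: i0.
have F'0 t : 0 <= F' t by apply: (i0) => x; exact: (i0).
have kn2 : (2 <= k.+2 <= n)%N by rewrite (ltnW kn').
rewrite (IH F' kn2 mF' F'0).
apply: ge0_ae_eq_integral => //.
- by apply: measurable_average.
- pose g (t : S) := \int[Nx]_x average k.+1 F (next_m k.+2 t.1.1.1.1 x) (next_s k.+2 t.1.1.1.1 t.1.1.1.2 x).
  have mg : measurable_fun setT g.
    have m : measurable_fun setT (fun q : S * R => average k.+1 F (next_m k.+2 q.1.1.1.1.1 q.2) (next_s k.+2 q.1.1.1.1.1 q.1.1.1.1.2 q.2)).
      by apply: measurable_average => //; [apply: measurable_next_m|apply: measurable_next_s]; mfun.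
    apply: (@measurable_integral_snd _ _ _ _ _ Nx (fun (t : S) x => average k.+1 F (next_m k.+2 t.1.1.1.1 x) (next_s k.+2 t.1.1.1.1 t.1.1.1.2 x)) m).
    by move=> *; exact: average_ge0.
  exact: (measurableT_comp mg (mst k.+2)).
- by move=> w _; exact: average_ge0.
- by move=> w _; apply: (i0) => x; exact: average_ge0.
have := @state_s_gt0 k.+2 kn2.
apply: filterS => w s0 _.
move: (st k.+2 w).1.1.1.1 (st k.+2 w).1.1.1.2 s0 => m s s0.
rewrite /average /F'.
(* The new x is moved outermost: the second angle depends on it and must be constant while (v, w) is
   rotated. *)
rewrite (@tonelli_swap3 R (C k) Nx (fun x u v r => \int[N]_e F (next_state k.+2 (m, s, u, v, r) (x, e)))); first last.
- by move=> *; exact: i0.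
- apply: (measurable_fun2 (F := fun t x => \int[N]_e F (next_state k.+2 t (x, e))) mFxe); mfun.
apply: eq_integral => x _.
have s1_gt0 : (0 < next_s k.+2 m s x)%R by rewrite (lt_le_trans s0)// next_s_ge.
have := @normal_chi2_step R (C k) (C k.+1) (fun u v r => F (next_m k.+2 m x, next_s k.+2 m s x, u, v, r))
  (rot_c k.+2) (rot_s k.+2) (Num.sqrt s / Num.sqrt (next_s k.+2 m s x))
  (rot_c k.+2 * (x - m) / Num.sqrt (next_s k.+2 m s x)) (@CS k).
apply => //.
- by apply: measurable_state_tuple => //; mfun.
- exact: rot_c_gt0.
- exact: rot_cs.
(* The cosine is positive because s > 0; this is the use of [state_s_gt0]. *)
- by rewrite divr_gt0 ?sqrtr_gt0.
- rewrite !expr_div_n !sqr_sqrtr ?(ltW s0) ?(ltW s1_gt0)// -mulrDl.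
  by rewrite -/(next_s _ _ _ _) mulfV// gt_eqF.
Qed.

End state_law.

(** * Algebra of centred sums and of the sample residual *)

Section regression_sums.
Context {R : realType}.
Variable n : nat.
Implicit Types (x e : 'I_n.+1 -> R).

Lemma scrossE (u v : 'I_n.+1 -> R) :
  scross u v = \sum_k u k * v k - n.+1%:R * smean u * smean v.
Proof.
have n0 : n.+1%:R != 0 :> R by rewrite pnatr_eq0.
have s1 (w : 'I_n.+1 -> R) : \sum_k w k = n.+1%:R * smean w by rewrite /smean mulVKf.
rewrite /scross.
transitivity (\sum_k (u k * v k) - smean v * (\sum_k u k) - smean u * (\sum_k v k) + \sum_(k < n.+1) smean u * smean v).
  by rewrite !mulr_sumr -!sumrN -!big_split /=; apply: eq_bigr => k _; ring.
by rewrite (s1 u) (s1 v) sumr_const card_ord -mulr_natl; ring.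
Qed.

Lemma scross_linear (a b c : R) (u v w : 'I_n.+1 -> R) :
  scross u (fun k => c + (a * v k + b * w k)) = a * scross u v + b * scross u w.
Proof.
have n0 : n.+1%:R != 0 :> R by rewrite pnatr_eq0.
rewrite /scross.
have -> : smean (fun k => c + (a * v k + b * w k)) = c + (a * smean v + b * smean w).
  rewrite /smean !big_split /= -!mulr_sumr sumr_const card_ord -mulr_natl.
  by field; rewrite ?n0.
by rewrite !mulr_sumr -big_split /=; apply: eq_bigr => k _; ring.
Qed.

Lemma scrossC (u v : 'I_n.+1 -> R) : scross u v = scross v u.
Proof. by apply: eq_bigr => k _; rewrite mulrC. Qed.

Lemma scross_ge0 (u : 'I_n.+1 -> R) : 0 <= scross u u.
Proof. by apply: sumr_ge0 => k _; rewrite -expr2 sqr_ge0. Qed.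

Lemma scross_quadratic (a b c : R) (v w : 'I_n.+1 -> R) :
  let y k := c + (a * v k + b * w k) in
  scross y y = a ^+ 2 * scross v v + 2 * a * b * scross v w + b ^+ 2 * scross w w.
Proof.
move=> y; rewrite scross_linear scrossC scross_linear [scross y w]scrossC scross_linear.
by rewrite [scross w v]scrossC; ring.
Qed.

(** The centred sum of squares of a v - b u, which is nonnegative, expands to a (a c - b^2), where c
    is [scross v v]. *)
Lemma scross_CauchySchwarz (u v : 'I_n.+1 -> R) : 0 < scross u u ->
  scross u v ^+ 2 <= scross u u * scross v v.
Proof.
move=> u0; set a := scross u u; set b := scross u v.
have := scross_ge0 (fun k => 0 + (a * v k + (- b) * u k)).
rewrite scross_quadratic [scross v u]scrossC -/a -/b => h.
have : 0 <= a * (a * scross v v - b ^+ 2) by apply: le_trans h _; rewrite le_eqVlt; apply/orP; left; apply/eqP; ring.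
by rewrite pmulr_rge0// subr_ge0.
Qed.

End regression_sums.

Section statistics.
Context {R : realType}.
Variables (n : nat) (y : 'I_n.+1 -> R * R).

(** No nondegeneracy is assumed: if s11 s22 is not positive, division by 0 makes [corr] equal to 0.
    This lets the quantile formula hold at every sample point. *)
Lemma residual_ge0 : 0 <= s22 y * (1 - corr y ^+ 2).
Proof.
apply: mulr_ge0; first exact: scross_ge0.
rewrite subr_ge0 /corr expr_div_n.
have [h|h] := leP (s11 y * s22 y) 0; first by rewrite (ler0_sqrtr h) expr0n/= invr0 mulr0 ler01.
rewrite sqr_sqrtr ?(ltW h)// ler_pdivrMr// mul1r; apply: scross_CauchySchwarz.
by rewrite lt_def scross_ge0 andbT; apply: contraTneq h => e; rewrite /s11 e mul0r ltxx.
Qed.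

Lemma residual_nondegenerate : nondegenerate_data y ->
  s22 y * (1 - corr y ^+ 2) = s22 y - s12 y ^+ 2 / s11 y.
Proof.
move=> [h1 h2 _]; rewrite /corr expr_div_n sqr_sqrtr; last by rewrite mulr_ge0// ltW.
by field; rewrite !gt_eqF.
Qed.

Lemma residual_gt0 : nondegenerate_data y -> 0 < s22 y * (1 - corr y ^+ 2).
Proof.
move=> [_ h2 h3]; rewrite mulr_gt0// subr_gt0 -real_normK ?num_real//.
by rewrite expr_lt1.
Qed.

Lemma nondegenerateP : 0 < s11 y -> s12 y ^+ 2 < s11 y * s22 y -> nondegenerate_data y.
Proof.
move=> h1 h; have h2 : 0 < s22 y.
  by rewrite -(pmulr_rgt0 _ h1) (le_lt_trans _ h)// sqr_ge0.
split=> //; rewrite -(expr_lt1 (n := 2))// real_normK ?num_real//.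
by rewrite /corr expr_div_n sqr_sqrtr ?ltr_pdivrMr ?mul1r// ?mulr_gt0// ltW// mulr_gt0.
Qed.

End statistics.

(* The second component is the standardised error of the regression of y.2 on y.1. *)
Definition standardize {R : realType} (p : R * R * R * R * R) (y : R * R) : R * R :=
  (y.1, (y.2 - (mu2 p + slope p * (y.1 - mu1 p))) / resid_sd p).

Section standardized_statistics.
Context {R : realType}.
Variables (p : R * R * R * R * R) (n : nat) (y : 'I_n.+1 -> R * R).
Hypothesis hp : param_space p.

Let x k := (standardize p (y k)).1.
Let e k := (standardize p (y k)).2.

(** A residual sum of squares ignores constants and multiples of the regressor, and scales with the
    square of the error, here by [theta2]. *)
Lemma standardized_residual : 0 < scross x x ->
  s11 y = scross x x /\
  s22 y - s12 y ^+ 2 / s11 y = theta2 p * (scross e e - scross x e ^+ 2 / scross x x).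
Proof.
move=> sx; have tau0 := resid_sd_gt0 hp.
have e1 : s11 y = scross x x by [].
have y2 : x2 y = fun k => (mu2 p - slope p * mu1 p) + (slope p * x k + resid_sd p * e k).
  apply/funext => k; rewrite /x2 /x /e /standardize /=.
  by field; rewrite gt_eqF.
split=> //; rewrite /s22 /s12 e1 y2 scross_quadratic -/x (_ : x1 y = x)// scross_linear.
by rewrite -(resid_sd2 hp); field; rewrite gt_eqF.
Qed.

End standardized_statistics.

(** * The law of the standardised observations *)

Section standardized_law.
Context {R : realType}.
Local Notation leb := (@lebesgue_measure R).
Local Notation N := (@normal_prob R 0 1).
Local Open Scope ereal_scope.

Lemma measurable_normal_pdf_comp d (T : measurableType d) (m s x : T -> R) :
  (forall t, s t != 0%R) -> measurable_fun setT m -> measurable_fun setT s ->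
  measurable_fun setT x -> measurable_fun setT (fun t => normal_pdf (m t) (s t) (x t)).
Proof.
move=> s0 mm ms mx.
rewrite (_ : (fun t => _) = (fun t => (Num.sqrt ((s t ^+ 2 * pi) * 2))^-1 *
   expR (- (x t - m t) ^+ 2 * ((s t ^+ 2) * 2)^-1))%R); last first.
  apply/funext => t; rewrite normal_pdfE// /normal_peak /normal_fun.
  by rewrite -(mulr_natr (s t ^+ 2 * pi)%R) -(mulr_natr (s t ^+ 2)%R).
by mfun.
Qed.

Lemma normal_pdf_affine (m tau e : R) : (0 < tau)%R ->
  (normal_pdf m tau (tau * e + m) * tau = normal_pdf 0 1 e)%R.
Proof.
move=> tau0; rewrite phiE normal_pdfE ?gt_eqF// /normal_peak /normal_fun addrK.
have -> : (tau ^+ 2 * pi *+ 2 = tau ^+ 2 * (pi *+ 2))%R by rewrite -(mulr_natr (tau ^+ 2 * pi)%R) -(mulr_natr pi) mulrA.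
rewrite sqrtrM ?sqr_ge0// sqrtr_sqr gtr0_norm//.
have -> : (- (tau * e) ^+ 2 / (tau ^+ 2 *+ 2) = - (e ^+ 2 / 2))%R.
  by rewrite -mulr_natr; field; rewrite gt_eqF.
have h : (Num.sqrt (pi *+ 2) != 0 :> R)%R by rewrite gt_eqF// sqrtr_gt0 mulrn_wgt0// pi_gt0.
by field; rewrite h gt_eqF.
Qed.

Variable p : R * R * R * R * R.
Hypothesis hp : param_space p.

Lemma measurable_standardize : measurable_fun setT (standardize p).
Proof. by rewrite /standardize; mfun. Qed.

Context d (T : measurableType d) (P : probability T R) (X : {RV P >-> (R * R)%type}).
Hypothesis XE : forall A, measurable A -> distribution P X A = binormal_law p A.

(** By the factorisation of the density, an affine substitution in the second coordinate, for fixed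
    first coordinate, turns its conditional law into the standard normal law. *)
Lemma integral_standardize (F : R * R -> \bar R) : measurable_fun setT F ->
  (forall z, 0 <= F z) ->
  \int[P]_w F (standardize p (X w)) =
  \int[normal_prob (mu1 p) (sigma1 p)]_x \int[N]_e F (x, e).
Proof.
move=> mF F0; have tau0 := resid_sd_gt0 hp; have [s10 _ _] := hp.
pose MR := measurableTypeR R.
have mX : @measurable_fun _ _ T (MR * MR)%type setT X by exact: (measurable_funP X).
pose Xm := HB.pack_for {mfun T >-> (MR * MR)%type} (X : T -> MR * MR) (isMeasurableFun.Build _ _ _ _ _ mX).
pose G (y : R * R) := F (standardize p y).
have mG : measurable_fun setT G by exact: (measurableT_comp mF measurable_standardize).
pose f (y : R * R) : R := (normal_pdf (mu1 p) (sigma1 p) y.1 *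
  normal_pdf (mu2 p + slope p * (y.1 - mu1 p)) (resid_sd p) y.2)%R.
have fE y : binormal_pdf p y = f y by case: y => a b; rewrite binormal_pdfE.
have mf : measurable_fun setT f.
  by apply: measurable_funM; apply: measurable_normal_pdf_comp; try mfun;
    move=> _; rewrite gt_eqF.
have f0 y : (0 <= f y)%R by rewrite mulr_ge0// normal_pdf_ge0.
transitivity (\int[distribution P Xm]_y G y).
  by rewrite ge0_integral_distribution//; move=> y; exact: F0.
rewrite (@integral_density _ (MR * MR)%type R (leb \x leb) f mf f0 (distribution P Xm)); first last.
- by move=> y; exact: F0.
- exact: mG.
- move=> A mA; rewrite [LHS]XE// /binormal_law.
  by apply: eq_integral => y _; rewrite fE.
have mGf : measurable_fun setT (fun y : R * R => G y * (f y)%:E).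
  by apply: emeasurable_funM => //; exact/measurable_EFinP.
have Gf0 y : 0 <= G y * (f y)%:E by rewrite mule_ge0 ?F0// lee_fin.
rewrite (fubini_tonelli1 (m1 := leb) (m2 := leb) (fun y => G y * (f y)%:E) mGf Gf0) /fubini_F.
have mNF : measurable_fun setT (fun x : R => \int[N]_e F (x, e)).
  have m : measurable_fun setT (fun q : R * R => F (q.1, q.2)).
    by apply: (measurableT_comp mF); mfun.
  exact: (@measurable_integral_snd _ _ _ _ _ N (fun x e : R => F (x, e)) m (fun _ _ => F0 _)).
rewrite (integral_normal (mu1 p) (sigma1 p) mNF (fun x => integral_ge0 _ (fun _ _ => F0 _))).
apply: eq_integral => x _.
have mFx : measurable_fun setT (fun e : R => F (x, e)) by apply: (measurableT_comp mF); mfun.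
rewrite (integral_normal 0 1 mFx (fun _ => F0 _)) -ge0_integralZr//=; first last.
- by rewrite lee_fin normal_pdf_ge0.
- by move=> e _; rewrite mule_ge0// lee_fin normal_pdf_ge0.
- by apply: emeasurable_funM => //; apply/measurable_EFinP; exact: measurable_normal_pdf.
have mh : measurable_fun setT (fun y : R => G (x, y) * (f (x, y))%:E).
  by apply: (measurableT_comp mGf); mfun.
rewrite (integral_affine (mu2 p + slope p * (x - mu1 p)) tau0 mh (fun _ => Gf0 _)).
apply: eq_integral => e _.
have -> : G (x, resid_sd p * e + (mu2 p + slope p * (x - mu1 p)))%R = F (x, e).
  by rewrite /G /standardize /= addrK [(resid_sd p * e)%R]mulrC mulfK// gt_eqF.
rewrite /f /= -!muleA -!EFinM; congr (_ * _%:E).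
by rewrite -mulrA (normal_pdf_affine _ _ tau0) mulrC.
Qed.

End standardized_law.

(** * From the recursive state to the sample statistics *)

Section state_of_data.
Context {R : realType} d (T : measurableType d) (Z : nat -> T -> R * R) (w : T).
Local Notation st := (state Z next_state (0, 0, 0, 0, 0)).

Lemma state_s_ge k : (2 <= k)%N -> (st 2%N w).1.1.1.2 <= (st k w).1.1.1.2.
Proof.
case: k => [|[|k]] //; elim: k => // k IH _.
by apply: (le_trans (IH isT)); exact: next_s_ge.
Qed.

(** The recursion divides by the square root of s, which is nondecreasing in k; positivity at two
    observations therefore serves all later steps. *)
Lemma state_sums_state k : 0 < (st 2%N w).1.1.1.2 -> (0 < k)%N ->
  state_sums k (st k w) (\sum_(j < k) (Z j w).1, \sum_(j < k) (Z j w).2,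
    \sum_(j < k) (Z j w).1 ^+ 2, \sum_(j < k) (Z j w).1 * (Z j w).2,
    \sum_(j < k) (Z j w).2 ^+ 2).
Proof.
move=> s2; case: k => // k _.
have st1 : st 1%N w = ((Z 0%N w).1, 0, (Z 0%N w).2, 0, 0).
  rewrite /= /next_state /next_m /next_s /= rot_c0 rot_s0 divr1 subr0 !mul0r !mul1r !add0r.
  have z2 : (0 ^+ 2 = 0 :> R)%R by rewrite expr0n.
  by rewrite !(z2, sqrtr0, mul0r, oppr0, addr0).
elim: k => [|k IH].
  rewrite !big_ord1 /state_sums st1 /= sqrtr1 sqrtr0.
  by split; ring.
rewrite !(big_ord_recr k.+1) /= -[Z k.+1 w]/(Z k.+1 w).
have s1 : 0 <= (st k.+1 w).1.1.1.2.
  by case: (k) => [|k']; [rewrite st1|rewrite ltW// (lt_le_trans s2)// state_s_ge].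
have sn : 0 < next_s k.+1 (st k.+1 w).1.1.1.1 (st k.+1 w).1.1.1.2 (Z k.+1 w).1.
  by rewrite (lt_le_trans s2)//; apply: (@state_s_ge k.+2).
have := state_sums_next (Z k.+1 w).2 s1 sn IH.
by rewrite -surjective_pairing.
Qed.

End state_of_data.

Section residual_of_state.
Context {R : realType} d (T : measurableType d).
Variables (p : R * R * R * R * R) (n : nat) (Y : T -> 'I_n.+1 -> R * R) (w : T).
Hypothesis hp : param_space p.
Let Z j w := standardize p (Y w (inord j)).
Local Notation st := (state Z next_state (0, 0, 0, 0, 0)).

(** Centring the power sums of [state_sums] gives s for xx, sqrt s v for xe and v^2 + r for ee; the
    residual ee - xe^2 / xx is thus r. *)
Lemma residual_state : (1 < n.+1)%N -> 0 < (st 2%N w).1.1.1.2 ->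
  s11 (Y w) = (st n.+1 w).1.1.1.2 /\
  s22 (Y w) - s12 (Y w) ^+ 2 / s11 (Y w) = theta2 p * (st n.+1 w).2.
Proof.
move=> n1 s2.
pose x (k : 'I_n.+1) := (standardize p (Y w k)).1.
pose e (k : 'I_n.+1) := (standardize p (Y w k)).2.
have := @state_sums_state R d T Z w n.+1 s2 isT.
have sn : (1 < n.+1)%N -> 0 < (st n.+1 w).1.1.1.2.
  by move=> _; rewrite (lt_le_trans s2)// state_s_ge.
have zE (k : 'I_n.+1) : Z k w = standardize p (Y w k) by rewrite /Z inord_val.
have -> : \sum_(j < n.+1) (Z j w).1 = \sum_k x k by apply: eq_bigr => k _; rewrite zE.
have -> : \sum_(j < n.+1) (Z j w).2 = \sum_k e k by apply: eq_bigr => k _; rewrite zE.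
have -> : \sum_(j < n.+1) (Z j w).1 ^+ 2 = \sum_k x k * x k by apply: eq_bigr => k _; rewrite zE.
have -> : \sum_(j < n.+1) (Z j w).1 * (Z j w).2 = \sum_k x k * e k by apply: eq_bigr => k _; rewrite zE.
have -> : \sum_(j < n.+1) (Z j w).2 ^+ 2 = \sum_k e k * e k by apply: eq_bigr => k _; rewrite zE.
rewrite /state_sums; move: (st n.+1 w) sn => [[[[m s] u] v] r] /= sn [h1 h2 h3 h4 h5].
have K0 : n.+1%:R != 0 :> R by rewrite pnatr_eq0.
have q2 : Num.sqrt n.+1%:R ^+ 2 = n.+1%:R :> R by rewrite sqr_sqrtr// ler0n.
have q0 : Num.sqrt n.+1%:R != 0 :> R by rewrite gt_eqF// sqrt_nat_gt0.
move: q2 q0 h2 h4; move: (Num.sqrt n.+1%:R) => q q2 q0 h2 h4.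
have mx : smean x = m by rewrite /smean h1 mulKf.
have me : smean e = u / q by rewrite /smean h2 -q2; field.
have xx : scross x x = s by rewrite scrossE mx h3; ring.
have xe : scross x e = Num.sqrt s * v by rewrite scrossE mx me h4 -q2; field.
have ee : scross e e = v ^+ 2 + r by rewrite scrossE me h5 -q2; field.
have s0 := sn n1.
have sx : 0 < scross x x by rewrite xx.
have [-> ->] := @standardized_residual R p n (Y w) hp sx.
rewrite -/x -/e xx xe ee; split => //.
by rewrite exprMn sqr_sqrtr ?(ltW s0)//; field; rewrite gt_eqF.
Qed.

End residual_of_state.

(** * Frequentist coverage *)

Section coverage.
Context {R : realType}.
Local Notation N := (@normal_prob R 0 1).
Local Open Scope ereal_scope.

Lemma ae_eq_measure d (T : measurableType d) (P : probability T R) (A B : set T) :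
  measurable A -> measurable B -> {ae P, forall w, A w <-> B w} -> P A = P B.
Proof.
move=> mA mB AB.
have e D : measurable D -> P D = \int[P]_w (\1_D w)%:E.
  by move=> mD; rewrite integral_indic// setIT.
rewrite (e _ mA) (e _ mB); apply: ge0_ae_eq_integral => //.
- by apply/measurable_EFinP; exact: measurable_indic.
- by apply/measurable_EFinP; exact: measurable_indic.
apply: filterS AB => w [h1 h2] _; congr (_%:E); rewrite !indicE; congr (_%:R).
by congr nat_of_bool; apply/idP/idP; rewrite !inE.
Qed.

Lemma measurable_smean d (T : measurableType d) n (u : 'I_n -> T -> R) :
  (forall k, measurable_fun setT (u k)) ->
  measurable_fun setT (fun w => smean (fun k => u k w)).
Proof.
by move=> mu; apply: measurable_funM => //; exact: (@measurable_sum _ T R setT _ (index_enum 'I_n) u).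
Qed.

Lemma measurable_scross d (T : measurableType d) n (u v : 'I_n -> T -> R) :
  (forall k, measurable_fun setT (u k)) -> (forall k, measurable_fun setT (v k)) ->
  measurable_fun setT (fun w => scross (fun k => u k w) (fun k => v k w)).
Proof.
move=> mu mv; apply: (@measurable_sum _ T R setT _ (index_enum 'I_n) (fun k w =>
  ((u k w - smean (fun k => u k w)) * (v k w - smean (fun k => v k w)))%R)) => k.
by apply: measurable_funM; apply: measurable_funB => //; exact: measurable_smean.
Qed.

Context d (T : measurableType d) (P : probability T R) (m : nat).
Variables (p : R * R * R * R * R) (X : 'I_m.+3 -> {RV P >-> (R * R)%type}).
Hypotheses (hp : param_space p) (iidX : iid_binormal p X).
Let Z j w := standardize p (X (inord j) w).
Let Y w k := X k w.
Local Notation st := (state Z next_state (0, 0, 0, 0, 0)%R).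
Local Notation S w := (s22 (Y w) * (1 - corr (Y w) ^+ 2))%R.

Let mX k : measurable_fun setT (X k : T -> R * R).
Proof. exact: (measurable_funP (X k)). Qed.

Let mZ j : measurable_fun setT (Z j).
Proof. exact: (measurableT_comp (measurable_standardize p) (mX _)). Qed.

Let indZ (B : nat -> set (R * R)) : (forall j, measurable (B j)) ->
  P [set w | forall j, (j < m.+3)%N -> B j (Z j w)] = \prod_(0 <= j < m.+3) P (Z j @^-1` B j).
Proof.
move=> mB; have [ind _] := iidX.
have mA (k : 'I_m.+3) : measurable (standardize p @^-1` B k).
  by rewrite -[_ @^-1` _]setTI; exact: measurable_standardize.
rewrite big_mkord.
transitivity (P (\bigcap_(k in [set: 'I_m.+3]) X k @^-1` (standardize p @^-1` B k))).
  congr (P _); apply/seteqP; split => w /=.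
    by move=> h k _; have := h k (ltn_ord k); rewrite /Z inord_val.
  move=> h j jn; have := h (Ordinal jn) I; rewrite /Z.
  by rewrite (_ : inord j = Ordinal jn)//; apply: val_inj; rewrite /= inordK.
by rewrite ind//; apply: eq_bigr => k _; rewrite /Z inord_val.
Qed.

Let lawZ j (F : R * R -> \bar R) : (j < m.+3)%N -> measurable_fun setT F ->
  (forall z, 0 <= F z) ->
  \int[P]_w F (Z j w) = \int[normal_prob (mu1 p) (sigma1 p)]_x \int[N]_e F (x, e).
Proof.
move=> jn mF F0; apply: integral_standardize => //; exact: iidX.2.
Qed.

Let mst k : measurable_fun setT (st k).
Proof. by apply: measurable_state => // j; exact: measurable_next_state. Qed.

Let mr : measurable_fun setT (fun w => (st m.+3 w).2).
Proof. by apply: measurable_comp_snd; exact: mst. Qed.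

Lemma residual_law (A : set R) : measurable A ->
  P [set w | A (st m.+3 w).2] = chi2 m.+1%:R A.
Proof.
move=> mA; have [C [C0 CE CS]] := @chi2_sequence R.
pose F (t : R * R * R * R * R) : \bar R := (\1_A t.2)%:E.
have mF : measurable_fun setT F.
  have m1 := @measurable_indic _ _ R setT _ mA.
  have m2 : measurable_fun setT (fun t : R * R * R * R * R => t.2) by mfun.
  by apply/measurable_EFinP; exact: (measurableT_comp m1 m2).
have F0 t : 0 <= F t by rewrite lee_fin.
have k3 : (2 <= m.+3 <= m.+3)%N by rewrite leqnn.
have mE : measurable [set w | A (st m.+3 w).2].
  by rewrite -[[set w | _]]setTI; exact: mr.
transitivity (\int[P]_w F (st m.+3 w)).
  have := @integral_indic _ _ _ P setT measurableT _ mE; rewrite setIT => <-.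
  by apply: eq_integral.
have := @state_law R d T P m.+3 Z (mu1 p) (sigma1 p) mZ indZ lawZ C C0 CS m.+3 F k3 mF F0.
move=> ->; rewrite -CE.
transitivity (\int[P]_w C m.+1 A); last exact: integral_probability_cst.
apply: eq_integral => w _.
transitivity (\int[C m.+1]_r (\1_A r)%:E).
  apply: eq_integral => r _; rewrite /F /=.
  rewrite [X in \int[N]_v X](_ : _ = (\1_A r)%:E); last exact: integral_probability_cst.
  exact: integral_probability_cst.
by rewrite (integral_indic (C m.+1) measurableT mA) setIT.
Qed.

Let s_gt0 : {ae P, forall w, (0 < (st 2%N w).1.1.1.2)%R}.
Proof.
have [C [C0 CE CS]] := @chi2_sequence R.
exact: (@state_s_gt0 R d T P m.+3 Z (mu1 p) (sigma1 p) mZ indZ lawZ C C0 2%N isT).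
Qed.

Let r_gt0 : {ae P, forall w, (0 < (st m.+3 w).2)%R}.
Proof.
exists [set w | `]-oo, 0%R]%classic (st m.+3 w).2]; split.
- by rewrite -[[set w | _]]setTI; apply: mr => //; exact: measurable_itv.
- apply: etrans; first by apply: residual_law; exact: measurable_itv.
  rewrite /chi2 /gamma_law (_ : _ `&` _ = set0) ?integral_set0//.
  by apply/seteqP; split => x //= []; rewrite !in_itv/= andbT => /le_lt_trans h /h; rewrite ltxx.
- by move=> w /= /negP; rewrite -leNgt in_itv.
Qed.

(** The strict inequality between [s12 ^+ 2] and the product of [s11] and [s22] is the positivity of
    r, which holds almost surely because chi-squared with [m.+1] degrees of freedom, here n - 2, has
    no mass on the nonpositive half-line. *)
Lemma nondegenerate_ae : {ae P, forall w, nondegenerate_data (Y w) /\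
  (S w = theta2 p * (st m.+3 w).2)%R}.
Proof.
apply: filterS2 s_gt0 r_gt0 => w s2 r0.
have [e1 e2] := @residual_state R d T p m.+2 Y w hp isT s2.
have s0 : (0 < s11 (Y w))%R by rewrite e1 (lt_le_trans s2)//; exact: state_s_ge.
have nd : nondegenerate_data (Y w).
  apply: nondegenerateP => //.
  have : (0 < s22 (Y w) - s12 (Y w) ^+ 2 / s11 (Y w))%R.
    by rewrite e2 mulr_gt0// theta2_gt0.
  by rewrite subr_gt0 ltr_pdivrMr// mulrC.
by split=> //; rewrite residual_nondegenerate.
Qed.

Let mS : measurable_fun setT (fun w => S w).
Proof.
have m1 k : measurable_fun setT (fun w => (X k w).1) by apply: measurable_comp_fst; exact: mX.
have m2 k : measurable_fun setT (fun w => (X k w).2) by apply: measurable_comp_snd; exact: mX.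
have h11 := measurable_scross m1 m1; have h12 := measurable_scross m1 m2.
have h22 := measurable_scross m2 m2.
apply: measurable_funM; first exact: h22.
apply: measurable_funB; first exact: measurable_cst.
apply: measurable_funX; apply: measurable_funM; first exact: h12.
by apply: measurableV; apply: measurable_sqrt_comp; apply: measurable_funM.
Qed.

Lemma coverage_quantile (b alpha : R) : (b < m.+3%:R)%R -> (0 < alpha < 1)%R ->
  P [set w | (theta2 p < quantile (theta2_star (Y w) b) (1 - alpha))%R] =
  chi2 (m.+3%:R - 2) `]quantile (chi2 (m.+3%:R - b)) alpha, +oo[%classic.
Proof.
move=> hb ha.
have s0 : (0 < (m.+3%:R - b) / 2)%R by rewrite divr_gt0// subr_gt0.
have h2 : (0 < 1 / 2 :> R)%R by rewrite divr_gt0.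
have [q0 _ _] := gamma_quantile s0 h2 ha.
pose q := quantile (chi2 (m.+3%:R - b)) alpha.
have -> : (m.+3%:R - 2 = m.+1%:R :> R)%R.
  by rewrite -[m.+3]addn2 natrD addrK.
rewrite -residual_law; last exact: measurable_itv.
(* This holds at every [w], so the event has an explicit and visibly measurable form before null
   sets are discarded. *)
have qE w : quantile (theta2_star (Y w) b) (1 - alpha) = (S w / q)%R.
  exact: (quantile_div s0 h2 (residual_ge0 (Y w)) ha).
rewrite (_ : [set w | _] = [set w | (theta2 p < S w / q)%R]); last first.
  by apply/seteqP; split => w /=; rewrite qE.
apply: ae_eq_measure.
- apply: measurable_lt_set; first exact: measurable_cst.
  by apply: measurable_funM; [exact: mS|exact: measurable_cst].
- by rewrite -[X in measurable X]setTI; apply: mr => //; exact: measurable_itv.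
apply: filterS nondegenerate_ae => w [_ SE] /=.
have q0' : (0 < q)%R by [].
by rewrite SE in_itv/= andbT -mulrA ltr_pMr ?theta2_gt0// ltr_pdivlMr// mul1r.
Qed.

End coverage.

(** * Integrating the mean out of a normal likelihood *)

Section gaussian_product.
Context {R : realType}.
Local Notation leb := (@lebesgue_measure R).

Lemma normal_pdf_sqrt2piE (m s x : R) : 0 < s ->
  normal_pdf m s x = (s * Num.sqrt (pi *+ 2))^-1 * expR (- ((x - m) ^+ 2 / (2 * s ^+ 2))).
Proof.
move=> s0; rewrite normal_pdfE ?gt_eqF// /normal_peak /normal_fun.
have -> : (s ^+ 2 * pi *+ 2 = s ^+ 2 * (pi *+ 2))%R.
  by rewrite -(mulr_natr (s ^+ 2 * pi)%R) -(mulr_natr pi) mulrA.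
rewrite sqrtrM ?sqr_ge0// sqrtr_sqr gtr0_norm// mulNr; congr (_ * expR (- (_ / _))).
by rewrite -(mulr_natr (s ^+ 2)) mulrC.
Qed.

Lemma sqrt2pi_gt0 : 0 < Num.sqrt (pi *+ 2) :> R.
Proof. by rewrite sqrtr_gt0 mulrn_wgt0// pi_gt0. Qed.

Variable n : nat.

(** The sample size is [n.+1]: integrating the mean out uses up one factor 1 / (s sqrt (2 pi)) and
    leaves 1 / sqrt n.+1. *)
Definition gauss_const (s : R) : R :=
  (Num.sqrt (pi *+ 2) ^- n) / Num.sqrt n.+1%:R * s ^- n.

Lemma gauss_const_gt0 s : 0 < s -> 0 < gauss_const s.
Proof.
move=> s0; rewrite mulr_gt0 ?divr_gt0 ?invr_gt0 ?exprn_gt0 ?sqrt2pi_gt0// sqrtr_gt0.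
Qed.

Lemma sum_sqr_dev (y : 'I_n.+1 -> R) (mu : R) :
  \sum_k (y k - mu) ^+ 2 = scross y y + n.+1%:R * (mu - smean y) ^+ 2.
Proof.
have n0 : n.+1%:R != 0 :> R by rewrite pnatr_eq0.
have s1 : \sum_k y k = n.+1%:R * smean y by rewrite /smean mulVKf.
rewrite scrossE.
transitivity (\sum_k (y k * y k) - (2 * mu) * (\sum_k y k) + \sum_(k < n.+1) mu ^+ 2).
  by rewrite !mulr_sumr -!sumrN -!big_split /=; apply: eq_bigr => k _; ring.
by rewrite s1 sumr_const card_ord -mulr_natl; ring.
Qed.

(** As a function of the mean the likelihood is a multiple of a normal density, by the decomposition
    of the squared deviations about the sample mean. *)
Lemma prod_normal_pdf (s mu : R) (y : 'I_n.+1 -> R) : 0 < s ->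
  \prod_k normal_pdf mu s (y k) =
  gauss_const s * expR (- (scross y y / (2 * s ^+ 2))) *
  normal_pdf (smean y) (s / Num.sqrt n.+1%:R) mu.
Proof.
move=> s0.
under eq_bigr do rewrite (normal_pdf_sqrt2piE _ _ s0).
have r0 : 0 < Num.sqrt n.+1%:R :> R by rewrite sqrtr_gt0.
have r2 : Num.sqrt n.+1%:R ^+ 2 = n.+1%:R :> R by rewrite sqr_sqrtr// ler0n.
rewrite (normal_pdf_sqrt2piE _ _ (divr_gt0 s0 r0)).
rewrite big_split /= prodr_const card_ord -expR_sum sumrN -mulr_suml sum_sqr_dev.
set q := Num.sqrt (pi *+ 2); have q0 : q != 0 by rewrite gt_eqF// sqrt2pi_gt0.
have s0' : s != 0 by rewrite gt_eqF.
have r0' : Num.sqrt n.+1%:R != 0 :> R by rewrite gt_eqF.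
have qn0 : q ^+ n != 0 by rewrite expf_neq0.
have sn0 : s ^+ n != 0 by rewrite expf_neq0.
rewrite /gauss_const -/q; move: (Num.sqrt n.+1%:R) r0' r2 => r r0' r2.
have -> : - ((scross y y + n.+1%:R * (mu - smean y) ^+ 2) / (2 * s ^+ 2)) =
  - (scross y y / (2 * s ^+ 2)) + - ((mu - smean y) ^+ 2 / (2 * (s / r) ^+ 2)).
  by rewrite -r2; field; rewrite ?r0' ?s0'.
rewrite expRD; move: (expR _) (expR _) => E1 E2.
rewrite exprVn exprMn !exprS; move: (q ^+ n) (s ^+ n) qn0 sn0 => Q S' Q0 S0.
by field; rewrite ?q0 ?s0' ?r0' ?Q0 ?S0.
Qed.

Lemma integral_prod_normal_pdf (s : R) (y : 'I_n.+1 -> R) : 0 < s ->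
  (\int[leb]_mu (\prod_k normal_pdf mu s (y k))%:E =
  (gauss_const s * expR (- (scross y y / (2 * s ^+ 2))))%:E)%E.
Proof.
move=> s0; have r0 : 0 < s / Num.sqrt n.+1%:R by rewrite divr_gt0// sqrtr_gt0.
under eq_integral do rewrite (prod_normal_pdf _ _ s0) EFinM.
rewrite ge0_integralZl_EFin//; first last.
- by rewrite mulr_ge0 ?expR_ge0// ltW// gauss_const_gt0.
- by apply/measurable_EFinP; exact: measurable_normal_pdf.
- by move=> m _; rewrite lee_fin normal_pdf_ge0.
by rewrite integral_normal_pdf ?mule1// gt_eqF.
Qed.

End gaussian_product.

(** * Integration over the parameter space as an iterated integral *)

Section iterated_integral.
Context {R : realType}.
Local Notation leb := (@lebesgue_measure R).
Local Open Scope ereal_scope.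

Section product.
Context d1 d2 (T1 : measurableType d1) (T2 : measurableType d2).
Variables (m1 : {sigma_finite_measure set T1 -> \bar R})
  (m2 : {sigma_finite_measure set T2 -> \bar R}).

Lemma sigma_finite_product : sigma_finite setT (m1 \x m2).
Proof.
have /sigma_finiteP[F [FT Fnd Foo]] := sigma_finiteT m1.
have /sigma_finiteP[G [GT Gnd Goo]] := sigma_finiteT m2.
exists (fun k => F k `*` G k) => [|k]; last first.
  have [[mF F1] [mG G1]] := (Foo k, Goo k); split; first exact: measurableX.
  by rewrite product_measure1E// lte_mul_pinfty// ge0_fin_numE.
apply/seteqP; split => // -[u v] _.
have [i _ Fu] : (\bigcup_k F k) u by rewrite -FT.
have [j _ Gv] : (\bigcup_k G k) v by rewrite -GT.
exists (maxn i j) => //; split => /=.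
- by move: u Fu; exact/subsetPset/Fnd/leq_maxl.
- by move: v Gv; exact/subsetPset/Gnd/leq_maxr.
Qed.

(* The library declares the product measure sigma-finite for factors that are
   subprobabilities, and that instance hides the general one. *)
Definition product_sfm : {sigma_finite_measure set (T1 * T2)%type -> \bar R} :=
  HB.pack_for {sigma_finite_measure set (T1 * T2)%type -> \bar R} (product_measure1 m1 m2)
    (Measure_isSigmaFinite.Build _ _ _ (product_measure1 m1 m2) sigma_finite_product).

End product.

Lemma integral_params (f : R * R * R * R * R -> \bar R) :
  measurable_fun setT f -> (forall p, 0 <= f p) ->
  \int[leb \x leb \x leb \x leb \x leb]_p f p =
  \int[leb]_rh \int[leb]_s2 \int[leb]_s1 \int[leb]_m1 \int[leb]_m2 f (m1, m2, s1, s2, rh).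
Proof.
move=> mf f0; pose MR := measurableTypeR R.
pose M2 := @product_sfm _ _ MR MR leb leb.
pose M3 := @product_sfm _ _ (MR * MR)%type MR M2 leb.
pose M4 := @product_sfm _ _ (MR * MR * MR)%type MR M3 leb.
have mf4 (rh : R) : measurable_fun setT (fun q : R * R * R * R => f (q, rh)).
  by apply: (measurableT_comp mf); mfun.
have mf3 (rh s2 : R) : measurable_fun setT (fun q : R * R * R => f (q, s2, rh)).
  by apply: (measurableT_comp (mf4 rh)); mfun.
have mf2 (rh s2 s1 : R) : measurable_fun setT (fun q : R * R => f (q, s1, s2, rh)).
  by apply: (measurableT_comp (mf3 rh s2)); mfun.
etransitivity; first exact: (@fubini_tonelli2 _ _ (MR * MR * MR * MR)%type MR R M4 leb f mf f0).
rewrite /fubini_G; apply: eq_integral => rh _.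
etransitivity; first exact: (@fubini_tonelli2 _ _ (MR * MR * MR)%type MR R M3 leb _ (mf4 rh) (fun _ => f0 _)).
rewrite /fubini_G; apply: eq_integral => s2 _.
etransitivity; first exact: (@fubini_tonelli2 _ _ (MR * MR)%type MR R M2 leb _ (mf3 rh s2) (fun _ => f0 _)).
rewrite /fubini_G; apply: eq_integral => s1 _.
exact: (@fubini_tonelli1 _ _ MR MR R leb leb _ (mf2 rh s2 s1) (fun _ => f0 _)).
Qed.

Lemma tonelli_reverse (f : R -> R -> R -> \bar R) :
  measurable_fun setT (fun q : R * R * R => f q.1.1 q.1.2 q.2) ->
  (forall x y z, 0 <= f x y z) ->
  \int[leb]_x \int[leb]_y \int[leb]_z f x y z = \int[leb]_z \int[leb]_y \int[leb]_x f x y z.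
Proof.
move=> mf f0.
have mf' d (T : measurableType d) (f1 f2 f3 : T -> R) : measurable_fun setT f1 ->
    measurable_fun setT f2 -> measurable_fun setT f3 ->
    measurable_fun setT (fun t => f (f1 t) (f2 t) (f3 t)).
  move=> h1 h2 h3; exact: (measurableT_comp mf (measurable_fun_pair (measurable_fun_pair h1 h2) h3)).
transitivity (\int[leb]_x \int[leb]_z \int[leb]_y f x y z).
  apply: eq_integral => x _.
  have m : measurable_fun setT (fun q : R * R => f x q.1 q.2) by apply: mf'; mfun.
  exact: (@tonelli_swap _ _ _ _ _ leb leb (fun y z : R => f x y z) m).
transitivity (\int[leb]_z \int[leb]_x \int[leb]_y f x y z).
  apply: (@tonelli_swap _ _ _ _ _ leb leb (fun x z : R => \int[leb]_y f x y z)).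
    have m : measurable_fun setT (fun q : R * R * R => f q.1.1 q.2 q.1.2) by apply: mf'; mfun.
    exact: (@measurable_integral_snd _ _ _ _ _ leb (fun (q : R * R) y => f q.1 y q.2) m).
  by move=> x z; exact: integral_ge0.
apply: eq_integral => z _.
have m : measurable_fun setT (fun q : R * R => f q.1 q.2 z) by apply: mf'; mfun.
exact: (@tonelli_swap _ _ _ _ _ leb leb (fun x y : R => f x y z) m).
Qed.

End iterated_integral.

Section powers.
Context {R : realType}.

Lemma gt0_powRE (x p : R) : 0 < x -> x `^ p = expR (p * ln x).
Proof. by move=> x0; rewrite /powR gt_eqF. Qed.

Lemma gt0_exprNE (x : R) n : 0 < x -> x ^- n = expR (- (n%:R * ln x)).
Proof. by move=> x0; rewrite -powR_mulrn ?ltW// gt0_powRE// expRN. Qed.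

End powers.

(** * The posterior with the means integrated out *)

Section posterior_density.
Context {R : realType}.
Local Notation leb := (@lebesgue_measure R).
Variables (n : nat) (x : 'I_n.+1 -> R * R) (a b : R).

(* Agrees with [normal_pdf] for [s > 0], and is jointly measurable in [m, s, y]. *)
Definition npdf (m s y : R) : R :=
  (Num.sqrt ((s ^+ 2 * pi) * 2))^-1 * expR (- (y - m) ^+ 2 * (s ^+ 2 * 2)^-1).

Lemma npdfE m s y : 0 < s -> npdf m s y = normal_pdf m s y.
Proof.
move=> s0; rewrite normal_pdfE ?gt_eqF// /normal_peak /normal_fun.
by rewrite -(mulr_natr (s ^+ 2 * pi)) -(mulr_natr (s ^+ 2)).
Qed.

Lemma npdf_shift m c s y : 0 < s -> npdf (m + c) s y = normal_pdf m s (y - c).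
Proof.
by move=> s0; rewrite -npdfE// /npdf (_ : y - (m + c) = y - c - m)//; ring.
Qed.

Lemma measurable_npdf_comp d (T : measurableType d) (m s y : T -> R) :
  measurable_fun setT m -> measurable_fun setT s -> measurable_fun setT y ->
  measurable_fun setT (fun t => npdf (m t) (s t) (y t)).
Proof. by move=> mm ms my; rewrite /npdf; mfun. Qed.

(** A version of likelihood times prior that is measurable and nonnegative for all tuples, not only
    on [param_space], so that Tonelli's theorem applies to it times an indicator. *)
Definition posterior_density (p : R * R * R * R * R) : R :=
  (\prod_k npdf (mu1 p) (sigma1 p) (x k).1) *
  (\prod_k npdf (mu2 p + slope p * ((x k).1 - mu1 p)) (resid_sd p) (x k).2) * prior a b p.

Lemma posterior_densityE p : param_space p -> likelihood x p * prior a b p = posterior_density p.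
Proof.
move=> hp; have [s1 _ _] := hp; congr (_ * _).
rewrite /likelihood -big_split; apply: eq_bigr => k _; case: (x k) => u v /=.
by rewrite binormal_pdfE// !npdfE// resid_sd_gt0.
Qed.

Lemma prior_ge0 p : 0 <= prior a b p.
Proof. by rewrite invr_ge0 !mulr_ge0// powR_ge0. Qed.

Lemma posterior_density_ge0 p : 0 <= posterior_density p.
Proof.
rewrite mulr_ge0 ?prior_ge0// mulr_ge0//; apply: prodr_ge0 => k _;
  by rewrite mulr_ge0 ?expR_ge0// invr_ge0 sqrtr_ge0.
Qed.

Lemma measurable_posterior_density : measurable_fun setT posterior_density.
Proof.
apply: measurable_funM; first apply: measurable_funM.
- apply: (@measurable_prod _ _ R setT _ (index_enum _) (fun k p => npdf (mu1 p) (sigma1 p) (x k).1)) => k _.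
  by apply: measurable_npdf_comp; rewrite /mu1 /sigma1; mfun.
- apply: (@measurable_prod _ _ R setT _ (index_enum _) (fun k p =>
    npdf (mu2 p + slope p * ((x k).1 - mu1 p)) (resid_sd p) (x k).2)) => k _.
  by apply: measurable_npdf_comp; rewrite /slope /resid_sd /theta2 /mu1 /mu2 /sigma1 /sigma2 /rho; mfun.
- by rewrite /prior /sigma1 /sigma2 /rho; mfun.
Qed.

Lemma measurable_param_space : measurable (@param_space R).
Proof.
rewrite (_ : param_space = ([set p | 0 < sigma1 p] `&` [set p | 0 < sigma2 p]) `&`
  ([set p | -1 < rho p] `&` [set p | rho p < 1])).
  by apply: measurableI; apply: measurableI; apply: measurable_lt_set;
    rewrite /sigma1 /sigma2 /rho; mfun.
apply/seteqP; split => p /=; first by move=> [? ? /andP[]].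
by move=> [[? ?] [? ?]]; split => //; apply/andP.
Qed.

Lemma measurable_theta2 : measurable_fun setT (@theta2 R).
Proof. by rewrite /theta2 /sigma2 /rho; mfun. Qed.

Definition mu_integral (s1 s2 rh : R) : R :=
  gauss_const n s1 * expR (- (s11 x / (2 * s1 ^+ 2))) *
  (gauss_const n (Num.sqrt (s2 ^+ 2 * (1 - rh ^+ 2))) *
   expR (- ((s22 x - 2 * (rh * s2 / s1) * s12 x + (rh * s2 / s1) ^+ 2 * s11 x) /
            (2 * Num.sqrt (s2 ^+ 2 * (1 - rh ^+ 2)) ^+ 2)))) *
  prior a b (0, 0, s1, s2, rh).

Lemma mu_integral_ge0 s1 s2 rh : 0 < s1 -> 0 <= mu_integral s1 s2 rh.
Proof.
move=> s10; have g0 s : 0 <= s -> 0 <= gauss_const n s.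
  by move=> s0; rewrite !mulr_ge0// ?invr_ge0 ?exprn_ge0 ?sqrtr_ge0.
rewrite /mu_integral.
apply: mulr_ge0; last exact: prior_ge0.
apply: mulr_ge0; apply: mulr_ge0; [|exact: expR_ge0| |exact: expR_ge0].
  by apply: g0; exact: ltW.
by apply: g0; exact: sqrtr_ge0.
Qed.

Lemma integral_mu s1 s2 rh : 0 < s1 -> 0 < s2 -> -1 < rh < 1 ->
  (\int[leb]_m1 \int[leb]_m2 (posterior_density (m1, m2, s1, s2, rh))%:E =
   (mu_integral s1 s2 rh)%:E)%E.
Proof.
move=> h1 h2 h3; have hp : param_space (0, 0, s1, s2, rh) by split.
pose tau := Num.sqrt (s2 ^+ 2 * (1 - rh ^+ 2)); pose be := rh * s2 / s1.
have tau0 : 0 < tau := resid_sd_gt0 hp.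
pose pr := prior a b (0, 0, s1, s2, rh).
pose P1 m1 := \prod_k normal_pdf m1 s1 (x k).1.
have P1_ge0 m1 : 0 <= P1 m1 by apply: prodr_ge0 => k _; exact: normal_pdf_ge0.
have mprod (s : R) (c : 'I_n.+1 -> R) : 0 < s ->
    measurable_fun setT (fun m : R => (\prod_k normal_pdf m s (c k))).
  move=> s0; apply: (@measurable_prod _ _ R setT _ (index_enum _) (fun k m => normal_pdf m s (c k))) => k _.
  by apply: measurable_normal_pdf_comp; [move=> _; rewrite gt_eqF|mfun..].
pose C2 := gauss_const n tau * expR (- ((s22 x - 2 * be * s12 x + be ^+ 2 * s11 x) / (2 * tau ^+ 2))) * pr.
have C2_ge0 : 0 <= C2.
  exact: (mulr_ge0 (mulr_ge0 (ltW (gauss_const_gt0 n tau0)) (expR_ge0 _)) (prior_ge0 _)).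
have inner m1 : (\int[leb]_m2 (posterior_density (m1, m2, s1, s2, rh))%:E = C2%:E * (P1 m1)%:E)%E.
  transitivity (\int[leb]_m2 ((P1 m1 * pr)%:E *
     (\prod_k normal_pdf m2 tau ((x k).2 - be * ((x k).1 - m1)))%:E))%E.
    apply: eq_integral => m2 _; rewrite -EFinM; congr (_%:E).
    rewrite /posterior_density mulrAC; congr (_ * _ * _).
      by apply: eq_bigr => k _; exact: npdfE.
    by apply: eq_bigr => k _; exact: npdf_shift.
  rewrite ge0_integralZl_EFin//; first last.
  - by rewrite mulr_ge0// prior_ge0.
  - by apply/measurable_EFinP; exact: mprod.
  - by move=> m _; rewrite lee_fin; apply: prodr_ge0 => k _; exact: normal_pdf_ge0.
  rewrite integral_prod_normal_pdf//.
  (* The first mean enters only through the constant [be * m1], to which centred sums are blind;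
     hence the inner integral depends on [m1] only through [P1]. *)
  have E : (fun k => (x k).2 - be * ((x k).1 - m1)) =
           (fun k => be * m1 + (1 * x2 x k + (- be) * x1 x k)).
    by apply/funext => k; rewrite /x1 /x2; ring.
  rewrite E scross_quadratic -!EFinM; congr (_%:E).
  rewrite [scross (x2 x) (x1 x)]scrossC -/(s11 x) -/(s12 x) -/(s22 x).
  rewrite (_ : 1 ^+ 2 * s22 x + 2 * 1 * - be * s12 x + (- be) ^+ 2 * s11 x =
    s22 x - 2 * be * s12 x + be ^+ 2 * s11 x); last by ring.
  by rewrite /C2; ring.
under eq_integral do rewrite inner.
rewrite ge0_integralZl_EFin//; first last.
- by apply/measurable_EFinP; exact: mprod.
- by move=> m _; rewrite lee_fin.
rewrite integral_prod_normal_pdf// -EFinM; congr (_%:E).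
by rewrite /C2 /mu_integral -/tau -/be -/pr -/(s11 x); ring.
Qed.

End posterior_density.

(** * Separation of the posterior into one-parameter kernels *)

Section posterior_kernel.
Context {R : realType}.
Local Notation leb := (@lebesgue_measure R).
Variables (n : nat) (x : 'I_n.+1 -> R * R) (a b : R).
Hypotheses (nd : nondegenerate_data x) (ha : a < n.+1%:R).

Let s11_gt0 : 0 < s11 x. Proof. by case: nd. Qed.
Let w := Num.sqrt (s11 x).
Let w_gt0 : 0 < w. Proof. by rewrite sqrtr_gt0. Qed.
Let w2 : w ^+ 2 = s11 x. Proof. by rewrite sqr_sqrtr// ltW. Qed.
Let S := s22 x - s12 x ^+ 2 / s11 x.
Let nu := n.+1%:R - b.
Let q : R := Num.sqrt (pi *+ 2).
Let q_gt0 : 0 < q. Proof. exact: sqrt2pi_gt0. Qed.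

(** The square collects the numerical parts of the two [gauss_const]; the 2 comes from the
    derivative of the square root in sigma2 = sqrt (theta / (1 - rho^2)). *)
Definition kernel_const : R := (q ^- n / Num.sqrt n.+1%:R) ^+ 2 / 2.
Definition sigma1_kernel (s : R) : R :=
  s `^ (- (n%:R + 3 - a)) * expR (- (s11 x / (2 * s ^+ 2))).
Definition theta_kernel (t : R) : R := t `^ (- (nu / 2) - 1) * expR (- (S / (2 * t))).
(** Here [t] stands for theta. The power -3/2 is cancelled by the Jacobian of [integral_sqrt1D], and
    the exponent is quadratic in rho / sqrt (1 - rho^2). *)
Definition rho_kernel (s t rh : R) : R :=
  (1 - rh ^+ 2) `^ (- (3 / 2)) *
  expR (- ((rh * (1 - rh ^+ 2) `^ (- 2^-1) * t `^ (2^-1) * w / s - s12 x / w) ^+ 2 / (2 * t))).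

Lemma kernel_const_gt0 : 0 < kernel_const.
Proof. by rewrite divr_gt0// exprn_gt0// divr_gt0 ?invr_gt0 ?exprn_gt0// sqrtr_gt0. Qed.

Let sqr_half (t : R) : 0 < t -> (t `^ (2^-1)) ^+ 2 = t.
Proof. by move=> t0; rewrite powR12_sqrt ?ltW// sqr_sqrtr// ltW. Qed.

Let one_sub_gt0 (rh : R) : -1 < rh < 1 -> 0 < 1 - rh ^+ 2.
Proof. by move=> h; rewrite subr_gt0 -real_normK ?num_real// expr_lt1// ltr_norml. Qed.

Let sqr_Nhalf (D : R) : 0 < D -> (D `^ (- 2^-1)) ^+ 2 * D = 1.
Proof.
move=> D0; by rewrite powRN exprVn sqr_half// mulVf// gt_eqF.
Qed.

Lemma theta_of_sigma2 (rh t : R) : -1 < rh < 1 -> 0 < t ->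
  ((1 - rh ^+ 2) `^ (- 2^-1) * t `^ (2^-1)) ^+ 2 * (1 - rh ^+ 2) = t.
Proof.
by move=> h t0; rewrite exprMn mulrAC sqr_Nhalf ?one_sub_gt0// mul1r sqr_half.
Qed.

Lemma mu_integral_theta (s rh t : R) : 0 < s -> -1 < rh < 1 -> 0 < t ->
  let K := (1 - rh ^+ 2) `^ (- 2^-1) in
  mu_integral x a b s (K * t `^ (2^-1)) rh * (`|2^-1| * K * t `^ (2^-1 - 1)) =
  kernel_const * sigma1_kernel s * theta_kernel t * rho_kernel s t rh.
Proof.
move=> s0 h t0 /=; have D0 := one_sub_gt0 h; have E := theta_of_sigma2 h t0.
rewrite /mu_integral /rho_kernel E -powR12_sqrt ?ltW//; move: D0 {E}.
set D := 1 - rh ^+ 2; set K := D `^ (- 2^-1); set r := t `^ (2^-1) => D0.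
have r0 : 0 < r by rewrite powR_gt0.
have K0 : 0 < K by rewrite powR_gt0.
have r2 : r ^+ 2 = t by exact: sqr_half.
have lr : ln r = 2^-1 * ln t by rewrite /r ln_powR.
have lK : ln K = - 2^-1 * ln D by rewrite /K ln_powR.
have ls : ln (K * r) = - 2^-1 * ln D + 2^-1 * ln t by rewrite lnM ?posrE// lr lK.
have s0' : s != 0 by rewrite gt_eqF.
have r0' : r != 0 by rewrite gt_eqF.
have w0' : w != 0 by rewrite gt_eqF.
have P1 : s ^- n * (s `^ (3 - a))^-1 = s `^ (- (n%:R + 3 - a)).
  by rewrite !gt0_powRE// gt0_exprNE// -expRN -expRD; congr expR; ring.
(* In the power of D the contributions (2 - b) / 2 of sigma2, b / 2 - 2 of the prior and -1/2 of the
   Jacobian add up to -3/2: the prior is shaped so that [b] cancels. In the power of t they leave -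
   nu / 2 - 1. *)
have P2 : r ^- n * ((K * r) `^ (2 - b))^-1 * (D `^ (2 - b / 2))^-1 * K * t `^ (2^-1 - 1) =
    t `^ (- (nu / 2) - 1) * D `^ (- (3 / 2)).
  rewrite (gt0_powRE _ D0) (gt0_powRE (2^-1 - 1) t0) (gt0_powRE (- (nu / 2) - 1) t0).
  rewrite (gt0_powRE _ (mulr_gt0 K0 r0)) (gt0_powRE (- (3 / 2)) D0) gt0_exprNE// ls lr.
  rewrite -[in LHS](lnK (x := K)) ?posrE// lK -!expRN -!expRD; congr expR.
  by rewrite /nu -natr1; field.
(* Completing the square in rho / sqrt (1 - rho^2) isolates the residual sum of squares [S]. *)
have P3 : (s22 x - 2 * (rh * (K * r) / s) * s12 x + (rh * (K * r) / s) ^+ 2 * s11 x) / (2 * r ^+ 2) =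
    S / (2 * t) + (rh * K * r * w / s - s12 x / w) ^+ 2 / (2 * t).
  by rewrite /S -r2 -w2; field; rewrite ?s0' ?r0' ?w0'.
rewrite P3 opprD expRD /gauss_const /prior /sigma1_kernel /theta_kernel /= -/D -/q.
rewrite ger0_norm ?invr_ge0//.
move: (expR (- (s11 x / _))) (expR (- (S / _))) (expR (- (_ ^+ 2 / _))) => e1 e2 e3.
transitivity (kernel_const * (s ^- n * (s `^ (3 - a))^-1) *
  (r ^- n * ((K * r) `^ (2 - b))^-1 * (D `^ (2 - b / 2))^-1 * K * t `^ (2^-1 - 1)) * (e1 * e2 * e3)).
  rewrite /sigma1 /sigma2 /rho /= -/D !invfM /kernel_const.
  move: (s ^- n) (r ^- n) (s `^ _)^-1 ((K * r) `^ _)^-1 (D `^ _)^-1 (t `^ _) (q ^- n / _) => *.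
  by ring.
by rewrite P1 P2; ring.
Qed.

(** After the substitution the kernel is a multiple of a normal density in u with standard deviation
    s / w. Theta shifts only its mean, so the integral does not depend on it. *)
Lemma integral_rho_kernel (s t : R) : 0 < s -> 0 < t ->
  (\int[leb]_(rh in `](-1)%R, 1%R[) (rho_kernel s t rh)%:E = (q * (s / w))%:E)%E.
Proof.
move=> s0 t0.
rewrite (@integral_sqrt1D R (fun rh => (rho_kernel s t rh)%:E)); first last.
- by move=> rh; rewrite lee_fin mulr_ge0 ?powR_ge0 ?expR_ge0.
- by apply/measurable_EFinP; rewrite /rho_kernel; mfun.
pose r := t `^ (2^-1); have r0 : 0 < r by rewrite powR_gt0.
have sw0 : 0 < s / w by rewrite divr_gt0.
pose m := s12 x * s / (w ^+ 2 * r).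
transitivity (\int[leb]_u ((q * (s / w))%:E * (normal_pdf m (s / w) u)%:E))%E; last first.
  rewrite ge0_integralZl_EFin//; first last.
  - by rewrite mulr_ge0 ?ltW.
  - by apply/measurable_EFinP; exact: measurable_normal_pdf.
  - by move=> u _; rewrite lee_fin normal_pdf_ge0.
  by rewrite integral_normal_pdf mule1.
apply: eq_integral => u _; rewrite -!EFinM; congr (_%:E).
rewrite (normal_pdf_sqrt2piE _ _ sw0) -/q.
have E0 : 0 < 1 + u ^+ 2 by rewrite ltr_pwDl// sqr_ge0.
rewrite /rho_kernel; set E := 1 + u ^+ 2 in E0 *.
have -> : 1 - (u * E `^ (- 2^-1)) ^+ 2 = E^-1.
  have E1 : E != 0 by rewrite gt_eqF.
  have uE : (u * E `^ (- 2^-1)) ^+ 2 * E = u ^+ 2 by rewrite exprMn -mulrA sqr_Nhalf// mulr1.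
  by apply: (mulIf E1); rewrite mulVf// mulrBl mul1r uE /E addrK.
have -> : u * E `^ (- 2^-1) * E^-1 `^ (- 2^-1) = u.
  rewrite !gt0_powRE ?invr_gt0// lnV ?posrE// -mulrA -expRD.
  by rewrite (_ : _ + _ = 0) ?expR0 ?mulr1//; ring.
rewrite mulrAC (_ : E^-1 `^ (- (3 / 2)) * E `^ (- (3 / 2)) = 1); last first.
  rewrite !gt0_powRE ?invr_gt0// lnV ?posrE// -expRD.
  by rewrite (_ : _ + _ = 0) ?expR0//; ring.
have q0 : q != 0 by rewrite gt_eqF.
have s0' : s != 0 by rewrite gt_eqF.
have r0' : r != 0 by rewrite gt_eqF.
have w0' : w != 0 by rewrite gt_eqF.
have qs : q * (s / w) != 0 by rewrite !mulf_neq0 ?invr_neq0.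
rewrite mul1r [s / w * q]mulrC [RHS]mulrA mulfV// [RHS]mul1r.
congr (expR (- _)); rewrite -/r /m; have := sqr_half t0; rewrite -/r => <-.
by field; rewrite ?s0' ?r0' ?w0'.
Qed.

(** The factor s is the one left by the correlation. With s = u^(-1/2) this is a gamma integral of
    shape (n.+1 - a) / 2, finite because a < n.+1. *)
Lemma integral_sigma1_kernel : exists2 c : R, 0 < c &
  (\int[leb]_(s in `]0%R, +oo[) (sigma1_kernel s * s)%:E = c%:E)%E.
Proof.
pose al := (n.+1%:R - a) / 2.
have al0 : 0 < al by rewrite divr_gt0// subr_gt0.
have r0 : 0 < s11 x / 2 by rewrite divr_gt0.
exists (2^-1 * (gamma_function al / (s11 x / 2) `^ al)).
  by rewrite mulr_gt0 ?divr_gt0 ?gamma_function_gt0 ?powR_gt0.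
(* The absolute value changes nothing for s > 0 and supplies the nonnegativity on the whole line
   that [integral_pow] asks for. *)
pose f (s : R) : \bar R := `|sigma1_kernel s * s|%:E.
transitivity (\int[leb]_(s in `]0%R, +oo[) f s)%E.
  apply: eq_integral => s; rewrite inE/= in_itv/= andbT => s0.
  by rewrite /f ger0_norm// mulr_ge0 ?(ltW s0)// mulr_ge0 ?powR_ge0 ?expR_ge0.
have mf : measurable_fun setT f.
  apply/measurable_EFinP; apply: (measurableT_comp (@normr_measurable R setT)).
  by rewrite /sigma1_kernel; mfun.
have p0 : (- 2^-1 : R) != 0 by rewrite oppr_eq0 invr_eq0.
rewrite (integral_pow ltr01 p0 mf (fun _ => normr_ge0 _)).
transitivity (\int[leb]_(u in `]0%R, +oo[) ((2^-1)%:E * (u `^ (al - 1) * expR (- (s11 x / 2 * u)))%:E))%E.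
  apply: eq_integral => u; rewrite inE/= in_itv/= andbT => u0.
  rewrite /f mul1r -!EFinM; congr (_%:E).
  have v0 : 0 < u `^ (- 2^-1) by rewrite powR_gt0.
  rewrite ger0_norm; last by rewrite mulr_ge0 ?(ltW v0)// mulr_ge0 ?powR_ge0 ?expR_ge0.
  rewrite normrN ger0_norm ?invr_ge0// mulr1 /sigma1_kernel.
  have -> : s11 x / (2 * (u `^ (- 2^-1)) ^+ 2) = s11 x / 2 * u.
    have h := sqr_Nhalf u0; have u0' : u != 0 by rewrite gt_eqF.
    have -> : (u `^ (- 2^-1)) ^+ 2 = u^-1 by apply: (mulIf u0'); rewrite h mulVf.
    by field.
  have H : (u `^ (- 2^-1)) `^ (- (n%:R + 3 - a)) * u `^ (- 2^-1) * u `^ (- 2^-1 - 1) = u `^ (al - 1).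
    rewrite (gt0_powRE _ v0) ln_powR !(gt0_powRE _ u0) -!expRD; congr expR.
    by rewrite /al -natr1; field.
  by rewrite -H; ring.
rewrite ge0_integralZl_EFin//; first last.
- by apply/measurable_EFinP; apply: measurable_funTS; mfun.
- by move=> u _; rewrite lee_fin mulr_ge0 ?powR_ge0 ?expR_ge0.
by rewrite integral_gamma_kernel.
Qed.

(** The substitution t = S / u turns the kernel into a multiple of the chi-squared density in u, and
    the event t in B into S / u in B, which is the event defining [theta2_star]. *)
Lemma theta_kernel_star : 0 < nu -> exists2 c : R, 0 < c & forall B, measurable B ->
  (\int[leb]_(t in `]0%R, +oo[) (theta_kernel t * \1_B t)%:E = c%:E * theta2_star x b B)%E.
Proof.
move=> nu0; have S0 : 0 < S by rewrite /S -residual_nondegenerate// residual_gt0.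
have s0 : 0 < nu / 2 by rewrite divr_gt0.
have h2 : (0 < 1 / 2 :> R) by rewrite divr_gt0.
pose g := gamma_function (nu / 2) / (1 / 2) `^ (nu / 2).
have g0 : 0 < g by rewrite divr_gt0 ?gamma_function_gt0 ?powR_gt0.
exists (S `^ (- (nu / 2)) * g); first by rewrite mulr_gt0 ?powR_gt0.
move=> B mB; pose f t : \bar R := (theta_kernel t * \1_B t)%:E.
have mI : measurable_fun setT (\1_B : R -> R) by exact: measurable_indic.
have mk : measurable_fun setT theta_kernel by rewrite /theta_kernel; mfun.
have mf : measurable_fun setT f by apply/measurable_EFinP; exact: measurable_funM.
have f0 t : (0 <= f t)%E by rewrite lee_fin mulr_ge0// mulr_ge0 ?powR_ge0 ?expR_ge0.
have p0 : (- 1 : R) != 0 by rewrite oppr_eq0.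
rewrite [LHS](integral_pow S0 p0 mf f0).
have mD : measurable_fun setT (fun c : R => S / c) by mfun.
rewrite /theta2_star /pushforward residual_nondegenerate// -/S -/nu /chi2 gamma_law_density.
rewrite [in RHS]integral_indicM [in LHS]integral_indicM -ge0_integralZl_EFin//; first last.
- by rewrite mulr_ge0 ?powR_ge0// ltW.
- apply: emeasurable_funM; apply/measurable_EFinP.
    apply: measurable_funM; first exact: measurable_gamma_pdf.
    exact: measurable_indic.
  by apply: measurable_indic; rewrite -[X in measurable X]setTI; exact: mD.
- by move=> u _; rewrite -EFinM lee_fin mulr_ge0// mulr_ge0// gamma_pdf_ge0.
apply: eq_integral => u _.
have [u0|u0] := ltP 0 u; last first.
  rewrite (_ : \1_(`]0, +oo[%classic : set R) u = 0); last first.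
    by rewrite indicE memNset//= in_itv/= andbT => /lt_le_trans/(_ u0); rewrite ltxx.
  by rewrite mulr0 !mule0 mul0e mule0.
rewrite (_ : \1_(`]0, +oo[%classic : set R) u = 1); last first.
  by rewrite indicE mem_set//= in_itv/= u0.
rewrite mule1 mulr1 /f powRN powRr1 ?(ltW u0)//.
have -> : \1_((fun c => S / c) @^-1` B) u = \1_B (S / u) :> R by [].
rewrite -!EFinM; congr (_%:E).
rewrite [RHS]mulrA mulrAC; congr (_ * _).
rewrite gamma_pdfE// -/g /theta_kernel.
have u0' : u != 0 by rewrite gt_eqF.
have S0' : S != 0 by rewrite gt_eqF.
have -> : S / (2 * (S / u)) = 1 / 2 * u by field; rewrite S0' u0'.
rewrite [RHS]mulrA mulfK ?gt_eqF// [RHS]mulrA mulrAC; congr (_ * _).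
rewrite normrN1 mul1r !gt0_powRE ?divr_gt0// lnM ?posrE ?invr_gt0// lnV ?posrE//.
rewrite -[X in _ * (X * _) = _](lnK (x := S)) ?posrE// -!expRD; congr expR.
by ring.
Qed.

End posterior_kernel.

(** * Assembly of the posterior law of theta *)

Section posterior_law.
Context {R : realType}.
Local Notation leb := (@lebesgue_measure R).
Local Notation pos := (`]0%R, +oo[%classic : set R).
Local Notation unit := (`](-1)%R, 1%R[%classic : set R).
Variables (n : nat) (x : 'I_n.+1 -> R * R) (a b : R).
Hypotheses (nd : nondegenerate_data x) (ha : a < n.+1%:R) (hb : b < n.+1%:R).
Local Notation w := (Num.sqrt (s11 x)).
Local Notation q := (Num.sqrt (pi *+ 2) : R).
Local Notation k1 := (sigma1_kernel x a).
Local Notation k2 := (theta_kernel x b).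
Local Notation k3 := (rho_kernel x).
Local Open Scope ereal_scope.

Let pos1 (t : R) : (0 < t)%R -> \1_pos t = 1%R :> R.
Proof. by move=> t0; rewrite indicE mem_set//= in_itv/= t0. Qed.

Let pos0 (t : R) : (t <= 0)%R -> \1_pos t = 0%R :> R.
Proof.
by move=> t0; rewrite indicE memNset//= in_itv/= andbT => /lt_le_trans/(_ t0); rewrite ltxx.
Qed.

Let unit1 (t : R) : (-1 < t < 1)%R -> \1_unit t = 1%R :> R.
Proof. by move=> t0; rewrite indicE mem_set//= in_itv/= t0. Qed.

Let unit0 (t : R) : ~~ (-1 < t < 1)%R -> \1_unit t = 0%R :> R.
Proof. by move=> t0; rewrite indicE memNset//= in_itv/=; apply/negP. Qed.

Let measurable_indic_comp d (T : measurableType d) (A : set R) (f : T -> R) :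
  measurable A -> measurable_fun setT f -> measurable_fun setT (fun t => \1_A (f t) : R).
Proof. by move=> mA mf; exact: (measurableT_comp (@measurable_indic _ _ R setT _ mA) mf). Qed.

Let mpos : measurable pos. Proof. exact: measurable_itv. Qed.
Let munit : measurable unit. Proof. exact: measurable_itv. Qed.

Let k1_ge0 s : (0 <= k1 s)%R. Proof. by rewrite mulr_ge0 ?powR_ge0 ?expR_ge0. Qed.
Let k2_ge0 s : (0 <= k2 s)%R. Proof. by rewrite mulr_ge0 ?powR_ge0 ?expR_ge0. Qed.
Let k3_ge0 s t r : (0 <= k3 s t r)%R. Proof. by rewrite mulr_ge0 ?powR_ge0 ?expR_ge0. Qed.

Let indic_ge0 (D : set R) u : (0 <= \1_D u :> R)%R. Proof. by rewrite indicE. Qed.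
Let kc_ge0 : (0 <= kernel_const n :> R)%R. Proof. by apply/ltW; exact: kernel_const_gt0. Qed.
Let qw_ge0 : (0 <= q / w)%R. Proof. by rewrite divr_ge0 ?sqrtr_ge0. Qed.

Section fixed_set.
Variable B : set R.
Hypothesis mB : measurable B.
Let A : set (R * R * R * R * R) := (@theta2 R) @^-1` B `&` param_space.

Let mA : measurable A.
Proof.
apply: measurableI; last exact: measurable_param_space.
by rewrite -[X in measurable X]setTI; exact: measurable_theta2.
Qed.

(** Membership in [A] does not involve the means, so they are set to 0. *)
Let ind s1 s2 rh : R := \1_A (0, 0, s1, s2, rh)%R.
Let H s1 s2 rh : R := (mu_integral x a b s1 s2 rh * ind s1 s2 rh)%R.
(** Indicators replace the ranges of integration, so that the integrals can be reordered over the
    whole line. *)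
Let J s t rh : R := (k1 s * \1_pos s * (k2 t * \1_B t * \1_pos t) *
  (k3 s t rh * \1_unit rh) * kernel_const n)%R.

Let indE s1 s2 rh : (0 < s1)%R -> (-1 < rh < 1)%R ->
  ind s1 s2 rh = (\1_B (s2 ^+ 2 * (1 - rh ^+ 2)) * \1_pos s2)%R.
Proof.
move=> h1 h3; rewrite /ind !indicE -natrM mulnb; congr (_%:R); congr nat_of_bool.
apply/idP/andP => [|[]]; rewrite !inE.
  by move=> [hB [_ h2 _]]; split => //=; rewrite in_itv/= andbT.
by move=> hB; rewrite /= in_itv/= andbT => h2; split.
Qed.

Let ind0 s1 s2 rh : ~~ ((0 < s1)%R && (-1 < rh < 1)%R) -> ind s1 s2 rh = 0%R.
Proof.
move=> h; rewrite /ind indicE memNset// => -[_ [h1 _ h3]].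
by move/negP: h; apply; rewrite h1.
Qed.

Let H_ge0 s1 s2 rh : (0 <= H s1 s2 rh)%R.
Proof.
have [/andP[h1 _]|h] := boolP ((0 < s1)%R && (-1 < rh < 1)%R).
  by rewrite mulr_ge0 ?mu_integral_ge0// indicE.
by rewrite /H ind0// mulr0.
Qed.

Let J_ge0 s t rh : (0 <= J s t rh)%R.
Proof.
exact: (mulr_ge0 (mulr_ge0 (mulr_ge0 (mulr_ge0 (k1_ge0 _) (indic_ge0 _ _))
  (mulr_ge0 (mulr_ge0 (k2_ge0 _) (indic_ge0 _ _)) (indic_ge0 _ _)))
  (mulr_ge0 (k3_ge0 _ _ _) (indic_ge0 _ _))) kc_ge0).
Qed.

Let integral_mu_ind rh s2 s1 :
  \int[leb]_m1 \int[leb]_m2 (posterior_density x a b (m1, m2, s1, s2, rh) *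
    \1_A (m1, m2, s1, s2, rh))%:E = (H s1 s2 rh)%:E.
Proof.
have iE m1 m2 : \1_A (m1, m2, s1, s2, rh) = ind s1 s2 rh :> R by [].
have [hA|hA] := boolP ((0, 0, s1, s2, rh)%R \in A).
  have [_ [h1 h2 h3]] : A (0, 0, s1, s2, rh)%R by move: hA; rewrite inE.
  have i1 : ind s1 s2 rh = 1%R by rewrite /ind indicE hA.
  rewrite /H i1 mulr1 -(integral_mu x a b h1 h2 h3); apply: eq_integral => m1 _.
  by apply: eq_integral => m2 _; rewrite iE i1 mulr1.
have i1 : ind s1 s2 rh = 0%R by rewrite /ind indicE (negbTE hA).
rewrite /H i1 mulr0; apply: integral0_eq => m1 _; apply: integral0_eq => m2 _.
by rewrite iE i1 mulr0.
Qed.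

Let measurable_mu_integral d (T : measurableType d) (f g h : T -> R) :
  measurable_fun setT f -> measurable_fun setT g -> measurable_fun setT h ->
  measurable_fun setT (fun t => mu_integral x a b (f t) (g t) (h t)).
Proof.
move=> mf mg mh; rewrite /mu_integral /gauss_const /prior /sigma1 /sigma2 /rho /=.
by mfun.
Qed.

(** For fixed rho, the passage from sigma2 to theta is a power substitution with exponent 1/2 and
    constant (1 - rho^2)^(-1/2); for this, sigma2 must be integrated inside the integral over
    rho. *)
Let integral_sigma2 rh s : \int[leb]_s2 (H s s2 rh)%:E = \int[leb]_t (J s t rh)%:E.
Proof.
have [/andP[s0 h]|h] := boolP ((0 < s)%R && (-1 < rh < 1)%R); last first.
  rewrite integral0_eq; last by move=> s2 _; rewrite /H ind0// mulr0.
  rewrite integral0_eq// => t _; rewrite /J; move: h; rewrite negb_and -leNgt.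
  by move=> /orP[/pos0 ->|/unit0 ->]; rewrite !(mulr0, mul0r).
pose f s2 : \bar R := (mu_integral x a b s s2 rh * \1_B (s2 ^+ 2 * (1 - rh ^+ 2)))%:E.
transitivity (\int[leb]_(s2 in pos) f s2).
  rewrite [RHS]integral_indicM; apply: eq_integral => s2 _.
  by rewrite -EFinM; congr (_%:E); rewrite /H indE// mulrA.
have K0 : (0 < (1 - rh ^+ 2) `^ (- 2^-1))%R.
  by rewrite powR_gt0// subr_gt0 -real_normK ?num_real// expr_lt1// ltr_norml.
have p0 : (2^-1 != 0 :> R)%R by rewrite invr_eq0.
have mf : measurable_fun setT f.
  apply/measurable_EFinP; apply: measurable_funM.
    by apply: measurable_mu_integral; mfun.
  by apply: measurable_indic_comp => //; mfun.
have f0 s2 : 0 <= f s2 by rewrite lee_fin mulr_ge0 ?mu_integral_ge0// indicE.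
rewrite (integral_pow K0 p0 mf f0) integral_indicM; apply: eq_integral => t _.
have [t0|t0] := ltP 0%R t; last by rewrite /J !(pos0 t0) !(mulr0, mul0r) mule0.
rewrite (pos1 t0) mule1 /f theta_of_sigma2// -EFinM; congr (_%:E).
rewrite mulrAC mu_integral_theta// /J !pos1// unit1//.
by rewrite !mulr1; ring.
Qed.

Let integral_rho_sigma1 c t : (\int[leb]_(s in pos) (k1 s * s)%:E = c%:E) ->
  \int[leb]_s \int[leb]_rh (J s t rh)%:E =
  (kernel_const n * (q / w) * c)%:E * ((k2 t * \1_B t)%:E * (\1_pos t)%:E).
Proof.
move=> cE; have [t0|t0] := ltP 0%R t; last first.
  rewrite (pos0 t0) !mule0; apply: integral0_eq => s _; apply: integral0_eq => rh _.
  by rewrite /J (pos0 t0) !(mulr0, mul0r).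
have w0 : (0 < w)%R by rewrite sqrtr_gt0; case: nd.
pose C := (k2 t * \1_B t * kernel_const n * (q / w))%R.
have C0 : (0 <= C)%R.
  exact: (mulr_ge0 (mulr_ge0 (mulr_ge0 (k2_ge0 _) (indic_ge0 _ _)) kc_ge0) qw_ge0).
transitivity (\int[leb]_s (C%:E * ((k1 s * s)%:E * (\1_pos s)%:E))).
  apply: eq_integral => s _; have [s0|s0] := ltP 0%R s; last first.
    rewrite (pos0 s0) !mule0; apply: integral0_eq => rh _.
    by rewrite /J (pos0 s0) !(mulr0, mul0r).
  transitivity (\int[leb]_rh ((k1 s * (k2 t * \1_B t) * kernel_const n)%:E *
     ((k3 s t rh)%:E * (\1_unit rh)%:E))).
    apply: eq_integral => rh _; rewrite -!EFinM; congr (_%:E).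
    by rewrite /J !pos1//; ring.
  rewrite ge0_integralZl_EFin//; first last.
  - exact: (mulr_ge0 (mulr_ge0 (k1_ge0 _) (mulr_ge0 (k2_ge0 _) (indic_ge0 _ _))) kc_ge0).
  - apply: emeasurable_funM; apply/measurable_EFinP.
      by rewrite /rho_kernel; mfun.
    by apply: measurable_indic_comp => //; mfun.
  - by move=> rh _; rewrite mule_ge0// lee_fin.
  rewrite -integral_indicM (integral_rho_kernel nd s0 t0) -!EFinM; congr (_%:E).
  by rewrite (pos1 s0) /C; ring.
rewrite ge0_integralZl_EFin//; first last.
- apply: emeasurable_funM; apply/measurable_EFinP.
    by rewrite /sigma1_kernel; mfun.
  by apply: measurable_indic_comp => //; mfun.
- move=> s _; have [s0|s0] := ltP 0%R s; last by rewrite (pos0 s0) mule0.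
  by rewrite mule_ge0// lee_fin// mulr_ge0// ltW.
rewrite -integral_indicM cE -!EFinM; congr (_%:E).
by rewrite (pos1 t0) /C; ring.
Qed.

Lemma unnormalized_posterior_theta2 c : (\int[leb]_(s in pos) (k1 s * s)%:E = c%:E) -> (0 <= c)%R ->
  unnormalized_posterior x a b ((@theta2 R) @^-1` B) =
  (kernel_const n * (q / w) * c)%:E * \int[leb]_(t in pos) (k2 t * \1_B t)%:E.
Proof.
move=> cE c0; rewrite /unnormalized_posterior integral_indicM.
transitivity (\int[leb \x leb \x leb \x leb \x leb]_p (posterior_density x a b p * \1_A p)%:E).
  apply: eq_integral => p _; rewrite -EFinM; congr (_%:E); rewrite indicE -/A.
  have [hA|_] := boolP (p \in A); last by rewrite !mulr0.
  by have [_ hp] : A p by [move: hA; rewrite inE]; rewrite posterior_densityE.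
have mI : measurable_fun setT (fun p => (posterior_density x a b p * \1_A p)%:E).
  apply/measurable_EFinP; apply: measurable_funM; first exact: measurable_posterior_density.
  exact: measurable_indic.
have I0 p : 0 <= (posterior_density x a b p * \1_A p)%:E.
  by rewrite lee_fin mulr_ge0// posterior_density_ge0.
rewrite (integral_params mI I0).
transitivity (\int[leb]_rh \int[leb]_s2 \int[leb]_s1 (H s1 s2 rh)%:E).
  apply: eq_integral => rh _; apply: eq_integral => s2 _; apply: eq_integral => s1 _.
  exact: integral_mu_ind.
transitivity (\int[leb]_rh \int[leb]_s1 \int[leb]_s2 (H s1 s2 rh)%:E).
  apply: eq_integral => rh _.
  have m : measurable_fun setT (fun r : R * R => (H r.2 r.1 rh)%:E).
    apply/measurable_EFinP; apply: measurable_funM.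
      by apply: measurable_mu_integral; mfun.
    have m2 : measurable_fun setT (fun r : R * R => ((0 : R), (0 : R), r.2, r.1, rh)%R) by mfun.
    exact: (measurableT_comp (@measurable_indic _ _ R setT _ mA) m2).
  apply: (@tonelli_swap _ _ _ _ _ leb leb (fun s2 s1 : R => (H s1 s2 rh)%:E) m).
  by move=> s2 s1; rewrite lee_fin.
transitivity (\int[leb]_rh \int[leb]_s \int[leb]_t (J s t rh)%:E).
  by apply: eq_integral => rh _; apply: eq_integral => s _; exact: integral_sigma2.
(* The order is reversed because the integral over rho leaves a factor s, to be absorbed by the
   integral over sigma1, and theta has to remain last. *)
transitivity (\int[leb]_t \int[leb]_s \int[leb]_rh (J s t rh)%:E).
  have m : measurable_fun setT (fun r : R * R * R => (J r.1.2 r.2 r.1.1)%:E).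
    apply/measurable_EFinP; rewrite /J.
    have p1 : measurable_fun setT (fun r : R * R * R => r.1.1) by mfun.
    have p2 : measurable_fun setT (fun r : R * R * R => r.1.2) by mfun.
    have p3 : measurable_fun setT (fun r : R * R * R => r.2) by mfun.
    have := (measurable_indic_comp mpos p2, measurable_indic_comp mB p3,
      measurable_indic_comp mpos p3, measurable_indic_comp munit p1) => -[[[i1 i2] i3] i4].
    apply: measurable_funM; last exact: measurable_cst.
    apply: measurable_funM; first apply: measurable_funM.
    - by apply: measurable_funM => //; rewrite /sigma1_kernel; mfun.
    - apply: measurable_funM => //; apply: measurable_funM => //.
      by rewrite /theta_kernel; mfun.
    - by apply: measurable_funM => //; rewrite /rho_kernel; mfun.
  apply: (@tonelli_reverse R (fun rh s t : R => (J s t rh)%:E) m).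
  by move=> rh s t; rewrite lee_fin.
transitivity (\int[leb]_t ((kernel_const n * (q / w) * c)%:E * ((k2 t * \1_B t)%:E * (\1_pos t)%:E))).
  by apply: eq_integral => t _; exact: integral_rho_sigma1.
rewrite ge0_integralZl_EFin//; first last.
- exact: (mulr_ge0 (mulr_ge0 kc_ge0 qw_ge0) c0).
- apply: emeasurable_funM; apply/measurable_EFinP.
    by apply: measurable_funM; [rewrite /theta_kernel; mfun|exact: measurable_indic].
  exact: measurable_indic.
- by move=> t _; rewrite mule_ge0// lee_fin// mulr_ge0.
by rewrite -integral_indicM.
Qed.

End fixed_set.

Lemma posterior_theta2 (B : set R) : measurable B ->
  pushforward (posterior x a b) (@theta2 R) B = theta2_star x b B.
Proof.
move=> mB; have nu0 : (0 < n.+1%:R - b)%R by rewrite subr_gt0.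
have [c c0 cE] := integral_sigma1_kernel nd ha.
have [c' c'0 starE] := theta_kernel_star nd nu0.
have w0 : (0 < w)%R by rewrite sqrtr_gt0; case: nd.
pose K := (kernel_const n * (q / w) * c * c')%R.
have K0 : (0 < K)%R.
  apply: (mulr_gt0 _ c'0); apply: (mulr_gt0 _ c0).
  by rewrite mulr_gt0 ?kernel_const_gt0 ?divr_gt0 ?sqrt2pi_gt0.
have UE D : measurable D ->
    unnormalized_posterior x a b ((@theta2 R) @^-1` D) = K%:E * theta2_star x b D.
  move=> mD; rewrite (unnormalized_posterior_theta2 mD cE (ltW c0)) starE//.
  by rewrite muleA -EFinM.
(* The normalising constant is the same formula for the full set, hence [K]. As [K] is positive and
   finite, the quotient avoids the default values of extended division. *)
rewrite /pushforward /posterior UE// -[setT](preimage_setT (@theta2 R)) UE//.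
have -> : theta2_star x b setT = 1.
  by apply: gamma_lawT; rewrite divr_gt0.
by rewrite mule1 muleAC inver gt_eqF// -EFinM mulfV ?gt_eqF// mul1e.
Qed.

End posterior_law.

Theorem theorem5 (R : realType) (n : nat) (a b : R)
    (hn : (3 <= n)%N) (ha : a < n%:R) (hb : b < n%:R) :
  (forall x : 'I_n -> R * R, nondegenerate_data x ->
     forall B : set R, measurable B ->
       pushforward (posterior x a b) theta2 B = theta2_star x b B)
  /\
  (forall (p : R * R * R * R * R) (d : measure_display) (T : measurableType d)
     (P : probability T R) (X : 'I_n -> {RV P >-> (R * R)%type}),
     param_space p -> iid_binormal p X ->
     {ae P, forall w, nondegenerate_data (fun k => X k w)} /\
     forall alpha : R, 0 < alpha < 1 ->
       P [set w | theta2 p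
                    < quantile (theta2_star (fun k => X k w) b) (1 - alpha)]
       = chi2 (n%:R - 2) `]quantile (chi2 (n%:R - b)) alpha, +oo[%classic)
  /\
  (forall alpha : R, 0 < alpha < 1 ->
     (chi2 (n%:R - 2) `]quantile (chi2 (n%:R - b)) alpha, +oo[%classic
        = (1 - alpha)%:E <-> b = 2)).
Proof.
case: n hn ha hb => [|[|[|m]]] // hn ha hb; split; [|split].
- by move=> x nd B mB; exact: posterior_theta2.
- move=> p d T P X hp iidX; split.
    by apply: filterS (nondegenerate_ae hp iidX) => w [].
  by move=> alpha h; exact: (coverage_quantile hp iidX hb h).
- move=> alpha h.
  have m0 : 0 < m.+3%:R - 2 :> R by rewrite -[m.+3]addn2 natrD addrK.
  have b0 : 0 < m.+3%:R - b by rewrite subr_gt0.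
  apply: (iff_trans (chi2_gt_quantile_eq m0 b0 h)).
  by split=> [/addrI/oppr_inj //|->].
Qed.
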